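(* Let $n$ be a positive integer and put $G=SO_0(1,n)$ and $H=SO(n)$. Let $\rho\colon G\to GL(\mathbb{R}^{n+1})$ be the natural representation, and denote by $e_0,\dots,e_n$ the standard basis of $\mathbb{R}^{n+1}$. Then $v_0:=e_0\in\mathbb{R}^{n+1}$ is $H$-fixed, and the family $\mathcal{P}$ obtained from $(G,H,\mathbb{R}^{n+1},v_0)$ by the method described in the context, under the identification $SO_0(1,n)/SO(n)\simeq H^n$, $gSO(n)\mapsto g\cdot e_0$, is the family of hyperboloid distributions on the $n$-dimensional hyperbolic space $H^n$, $$\left\{c_\kappa\exp(\kappa\langle\xi,v\rangle)\,d\nu(v)\right\}_{(\kappa,\xi)\in\mathbb{R}_{>0}\times H^n}\qquad(v\in H^n),$$ where $\langle x,y\rangle=-x_0y_0+x_1y_1+\cdots+x_ny_n$, $\nu$ is a $G$-invariant measure on $H^n$, which is described as $\sinh^{n-1}u\,\sin^{n-2}v_1\cdots\sin v_{n-2}\,du\,dv_1\cdots dv_{n-1}$ in hyperbolic-spherical coordinates $(u,v_1,\dots,v_{n-1})$, and $c_\kappa$ is the normalizing constant $$c_\kappa=\frac{\kappa^{\frac{n-1}{2}}}{(2\pi)^{\frac{n-1}{2}}\,2K_{\frac{n-1}{2}}(\kappa)}.$$ Here $K_\lambda$ is the modified Bessel function of the second kind with index $\lambda$.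
   Context: The hyperbolic space is $H^n=\{x\in\mathbb{R}^{n+1}\mid x_0>0,\ \langle x,x\rangle=-1\}$ with $\langle x,y\rangle:=-x_0y_0+x_1y_1+\cdots+x_ny_n$, and with the metric which is the restriction of $-dx_0^2+dx_1^2+\cdots+dx_n^2$. $SO_0(1,n)$ is the identity component of the group $SO(1,n)$ of this form; it acts transitively on $H^n$. $SO(n)$ is embedded in $SO_0(1,n)$ as the matrices $\mathrm{diag}(1,k)$, $k\in SO(n)$. Hyperbolic-spherical coordinates on $H^n$ for $n\geq2$ are $x_0=\cosh u$, $(x_1,\dots,x_n)=\sinh u\cdot\omega$, where $u>0$ and $\omega\in S^{n-1}$ has the usual spherical coordinates $v_1,\dots,v_{n-2}\in(0,\pi)$, $v_{n-1}\in(0,2\pi)$: $\omega_1=\cos v_1$, $\omega_2=\sin v_1\cos v_2$, ..., $\omega_{n-1}=\sin v_1\cdots\sin v_{n-2}\cos v_{n-1}$, $\omega_n=\sin v_1\cdots\sin v_{n-2}\sin v_{n-1}$. (For $n=2$ the measure is $\sinh u\,du\,dv_1$; for $n=1$ the only coordinate is $u\in\mathbb{R}$, with $x_0=\cosh u$, $x_1=\sinh u$, and the measure is $du$.) The method: let $G$ be a Lie group with finitely many connected components, $H$ a closed subgroup, $X:=G/H$, $\rho\colon G\to GL(V)$ a continuous finite dimensional real representation and $v_0\in V$ an $H$-fixed vector. Put $W_0(G,H):=\{\tau\colon G\to\mathbb{R}\mid\tau\text{ is a continuous group homomorphism with }\tau|_H=0\}$. Take a nonzero relatively $G$-invariant Radon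 measure $\nu$ on $X$ (i.e. for some $\chi\colon G\to\mathbb{R}_{>0}$ the pushforward satisfies $g\cdot\nu=\chi(g)^{-1}\nu$ for all $g\in G$), assumed to exist; the resulting family does not depend on the choice of $\nu$. For $\theta=(\varphi,\tau)\in V^\vee\times W_0(G,H)$ (where $V^\vee$ is the dual space of $V$) and $x=gH$, put $\rho(x)v_0:=\rho(g)v_0$, $\tau(x):=\tau(g)$ and $d\tilde p_\theta(x):=\exp(-\langle\varphi,\rho(x)v_0\rangle+\tau(x))\,d\nu(x)$, where here $\langle\cdot,\cdot\rangle$ is the pairing between $V^\vee$ and $V$. Let $\Theta:=\{\theta\in V^\vee\times W_0(G,H)\mid\int_Xd\tilde p_\theta<\infty\}$ and, for $\theta\in\Theta$, $p_\theta:=(\int_Xd\tilde p_\theta)^{-1}\tilde p_\theta$. The family obtained is the set $\mathcal{P}:=\{p_\theta\}_{\theta\in\Theta}$ of probability measures on $X$.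
   Formalization: For n=1 the equality of families fails, since W_0(G,H) is not 0 (e.g. exp(-cosh u+u)du, normalized, lies in P but is not a hyperboloid distribution); there it is proved only for the subfamily with tau=0 and invariant nu. For n≥2 it is proved in full. *)

(* Defs.v *)
From HB Require Import structures.
From mathcomp Require Import all_boot all_order all_algebra generic_quotient.
From mathcomp Require Import all_classical all_reals all_analysis.

Set Implicit Arguments.
Unset Strict Implicit.
Unset Printing Implicit Defensive.

Import Order.TTheory GRing.Theory Num.Theory.
Import numFieldNormedType.Exports.

Local Open Scope classical_set_scope.
Local Open Scope ring_scope.
Local Open Scope quotient_scope.

HB.mixin Record isTopGroup G of Topological G & Group G := {
  mulg_continuous : continuous (fun p : G * G => (p.1 * p.2)%g) ;
  invg_continuous : continuous (fun g : G => g^-1%g)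
}.

#[short(type="topGroupType")]
HB.structure Definition TopGroup :=
  {G of Topological G & Group G & isTopGroup G}.

Definition closed_subgroup (G : topGroupType) (H : set G) :=
  [/\ closed H, H 1%g & forall g h, H g -> H h -> H (g^-1 * h)%g].

Section Homogeneous.
Variables (G : topGroupType) (H : set G).

Definition coset_of_set (g : G) : set G := [set (g * h)%g | h in H].

Definition coset_rel : rel G :=
  fun g g' => `[< coset_of_set g = coset_of_set g' >].

Local Lemma coset_rel_refl : reflexive coset_rel.
Proof. by move=> g; apply/asboolP. Qed.

Local Lemma coset_rel_sym : symmetric coset_rel.
Proof. by move=> g g'; apply/asboolP/asboolP => ->. Qed.

Local Lemma coset_rel_trans : transitive coset_rel.
Proof. by move=> g g' g'' /asboolP e /asboolP e'; apply/asboolP; rewrite e. Qed.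

Canonical coset_equiv :=
  EquivRel coset_rel coset_rel_refl coset_rel_sym coset_rel_trans.

(* \pi_homog g stands for the coset gH *)
Definition homog : Type := quotient_topology {eq_quot coset_rel}.

HB.instance Definition _ := Quotient.copy homog {eq_quot coset_rel}.
HB.instance Definition _ :=
  Topological.copy homog (quotient_topology {eq_quot coset_rel}).
HB.instance Definition _ := isPointed.Build homog (\pi_homog 1%g).

Definition homog_act (g : G) (x : homog) : homog := \pi_homog (g * repr x)%g.

End Homogeneous.

Definition borel (T : ptopologicalType) := g_sigma_algebraType (@open T).

Definition radon (R : realType) (T : ptopologicalType)
    (mu : {measure set (borel T) -> \bar R}) :=
  [/\ forall K : set T, compact K -> (mu K < +oo)%E,
      forall A : set (borel T), measurable A ->
        mu A = ereal_inf [set mu U | U in [set U : set T | open U /\ A `<=` U]] &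
      forall U : set T, open U ->
        mu U = ereal_sup [set mu K | K in [set K : set T | compact K /\ K `<=` U]]].

Section Invariance.
Variables (R : realType) (G : topGroupType) (H : set G).
Implicit Type mu : {measure set (borel (homog H)) -> \bar R}.

(* the pushforward g.mu sends A to mu of the preimage of A under x |-> g.x *)
Definition relatively_invariant mu :=
  exists chi : G -> R, (forall g, 0 < chi g) /\
    forall g (A : set (borel (homog H))), measurable A ->
      mu (homog_act g @^-1` A) = (((chi g)^-1)%:E * mu A)%E.

Definition G_invariant mu :=
  forall g (A : set (borel (homog H))), measurable A ->
    mu (homog_act g @^-1` A) = mu A.

End Invariance.

(* V = R^m; rep_1 and rep_M force the values to be invertible *)
Record representation (R : realType) (G : topGroupType) (m : nat) :=
  Representation {
    rep_fun :> G -> 'M[R]_m ;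
    rep_1 : rep_fun 1%g = 1%:M ;
    rep_M : forall g h, rep_fun (g * h)%g = rep_fun g *m rep_fun h ;
    rep_continuous : continuous rep_fun
  }.

Section Method.
Variables (R : realType) (G : topGroupType) (H : set G) (m : nat).
Variables (rho : representation R G m) (v0 : 'cV[R]_m).

Definition W0 : set (G -> R) :=
  [set tau | [/\ continuous tau,
                 forall g h, tau (g * h)%g = tau g + tau h &
                 forall h, H h -> tau h = 0]].

(* repr x is some g with x = gH; the value below does not depend on the choice
   of g when v0 is H-fixed and tau vanishes on H *)
Definition tilde_density (phi : {scalar 'cV[R]_m}) (tau : G -> R)
    (x : homog H) : R :=
  expR (- phi (rho (repr x) *m v0) + tau (repr x)).

Variable mu : {measure set (borel (homog H)) -> \bar R}.

Definition tilde_p phi tau (A : set (borel (homog H))) : \bar R :=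
  (\int[mu]_(x in A) (tilde_density phi tau x)%:E)%E.

(* W = W0 gives the whole family {p_theta}_(theta in Theta); a smaller W gives
   the subfamily of the theta = (phi, tau) with tau in W. *)
Definition exp_family_on (W : set (G -> R)) :
    set (probability (borel (homog H)) R) :=
  [set p | exists phi : {scalar 'cV[R]_m}, exists tau : G -> R,
    [/\ W tau, (tilde_p phi tau setT < +oo)%E &
        forall A, measurable A ->
          p A = (((fine (tilde_p phi tau setT))^-1)%:E * tilde_p phi tau A)%E]].

Definition exp_family := exp_family_on W0.

End Method.

Section MatrixContinuity.
Variable R : realType.

Lemma mx_continuous (T : topologicalType) m n (f : T -> 'M[R]_(m, n)) :
  (forall i j, continuous (fun t => f t i j)) -> continuous f.
Proof.
move=> cf t A [P Pn PA].
have : \forall s \near t, forall i j, P i j (f s i j).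
  apply: filter_forall => i; apply: filter_forall => j.
  exact: (cf i j t _ (Pn i j)).
by apply: filterS => s Ps; apply: PA => i j; exact: Ps.
Qed.

Lemma mulmx_continuous (T : topologicalType) m n p
    (f : T -> 'M[R]_(m, n)) (g : T -> 'M[R]_(n, p)) :
  continuous f -> continuous g -> continuous (fun t => f t *m g t).
Proof.
move=> cf cg; apply: mx_continuous => i j.
under eq_fun do rewrite mxE.
apply: continuous_big => [|k _]; first exact: add_continuous.
move=> t; apply: cvgM.
  exact: (continuous_comp (cf t) (@coord_continuous R _ _ i k (f t))).
exact: (continuous_comp (cg t) (@coord_continuous R _ _ k j (g t))).
Qed.

Lemma scale_continuous (T : topologicalType) (c : R) (f : T -> R) :
  continuous f -> continuous (fun t => c * f t).
Proof. by move=> cf t; apply: cvgMl_tmp; exact: cf. Qed.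

End MatrixContinuity.

Section Lorentz.
Variables (R : realType) (n : nat).
Implicit Types (x y : 'cV[R]_n.+1) (g h : 'M[R]_n.+1).

Definition lform x y : R :=
  - (x ord0 0 * y ord0 0) +
  \sum_(i < n) x (lift ord0 i) 0 * y (lift ord0 i) 0.

Definition SO1 : set 'M[R]_n.+1 :=
  [set g | \det g = 1 /\ forall x y, lform (g *m x) (g *m y) = lform x y].

Definition SO01 : set 'M[R]_n.+1 := connected_component SO1 1%:M.

Definition e_ (i : 'I_n.+1) : 'cV[R]_n.+1 := delta_mx i 0.

Definition hyp : set 'cV[R]_n.+1 :=
  [set x : 'cV[R]_n.+1 | 0 < x ord0 0 /\ lform x x = -1].

Lemma SO1_1 : SO1 1%:M.
Proof. by split; [rewrite det1|move=> x y; rewrite !mul1mx]. Qed.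

Lemma SO1_unit g : SO1 g -> g \in unitmx.
Proof. by case=> dg _; rewrite unitmxE dg unitr1. Qed.

Lemma SO1_M g h : SO1 g -> SO1 h -> SO1 (g *m h).
Proof.
move=> [dg fg] [dh fh]; split; first by rewrite det_mulmx dg dh mulr1.
by move=> x y; rewrite -!mulmxA fg fh.
Qed.

Lemma SO1_V g : SO1 g -> SO1 (invmx g).
Proof.
move=> Sg; have gu := SO1_unit Sg; case: Sg => dg fg.
split; first by rewrite det_inv dg invr1.
by move=> x y; rewrite -fg !mulKVmx.
Qed.

Lemma SO01_SO1 g : SO01 g -> SO1 g.
Proof. exact: connected_component_sub. Qed.

Lemma SO01_1 : SO01 1%:M.
Proof. exact/connected_component_refl/SO1_1. Qed.

Lemma SO01_VM g h : SO01 g -> SO01 h -> SO01 (invmx g *m h).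
Proof.
move=> Cg Ch.
have Sg := SO01_SO1 Cg; have gu := SO1_unit Sg.
have sub : [set invmx g *m k | k in SO01] `<=` SO01.
  apply: connected_component_max.
  - by exists g => //; rewrite mulVmx.
  - by move=> _ [k Ck <-]; apply: SO1_M; [exact: SO1_V|exact: SO01_SO1].
  - apply: connected_continuous_connected; first exact: component_connected.
    apply: continuous_subspaceT; apply: mulmx_continuous.
      exact: cst_continuous.
    by move=> ?; exact: cvg_id.
by apply: sub; exists h.
Qed.

Lemma SO01_V g : SO01 g -> SO01 (invmx g).
Proof. by move=> Cg; rewrite -[invmx g]mulmx1; apply: SO01_VM => //; exact: SO01_1. Qed.

Lemma SO01_M g h : SO01 g -> SO01 h -> SO01 (g *m h).
Proof. by move=> Cg Ch; rewrite -[g]invmxK; apply: SO01_VM => //; exact: SO01_V. Qed.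


Lemma lformC x y : lform x y = lform y x.
Proof.
by rewrite /lform mulrC; congr (_ + _); apply: eq_bigr => i _; rewrite mulrC.
Qed.

Lemma lform_e (i : 'I_n.+1) x :
  lform (e_ i) x = (if i == ord0 then -1 else 1) * x i 0.
Proof.
rewrite /lform /e_ !mxE eqxx andbT.
case: (unliftP ord0 i) => [j|] ->.
  rewrite (negbTE (neq_lift ord0 j)) mul0r oppr0 add0r eq_sym.
  rewrite (negbTE (neq_lift ord0 j)) mul1r (bigD1 j)//= !mxE eqxx mul1r.
  rewrite big1 ?addr0// => k kj; rewrite !mxE (inj_eq lift_inj) (negbTE kj).
  by rewrite mul0r.
rewrite eqxx mul1r mulN1r big1 ?addr0// => k _.
by rewrite !mxE eq_sym (negbTE (neq_lift ord0 k)) mul0r.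
Qed.

Lemma SO1_invE g i j : SO1 g ->
  invmx g i j = (if i == ord0 then -1 else 1) *
                ((if j == ord0 then -1 else 1) * g j i).
Proof.
move=> Sg; have gu := SO1_unit Sg; have [_ fg] := Sg.
have coord (h : 'M[R]_n.+1) k l : h k l = (h *m e_ l) k 0.
  by rewrite -colE mxE.
have s2 (b : bool) : (if b then -1 else 1) * (if b then -1 else 1) = 1 :> R.
  by case: b; rewrite ?mulrNN mulr1.
rewrite [g j i]coord -lform_e.
have -> : lform (e_ j) (g *m e_ i) = lform (e_ i) (invmx g *m e_ j).
  by rewrite -[RHS]fg mulKVmx// lformC.
by rewrite lform_e mulrA s2 mul1r -coord.
Qed.

Lemma hyp_e0 : hyp (e_ ord0).
Proof. by split; rewrite ?lform_e ?eqxx /e_ !mxE !eqxx ?mulr1// ltr01. Qed.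

Lemma hyp_ge1 x : lform x x = -1 -> 1 <= x ord0 0 ^+ 2.
Proof.
rewrite /lform -expr2 => /eqP; rewrite addrC subr_eq addrC => /eqP e.
have : 0 <= \sum_(i < n) x (lift ord0 i) 0 * x (lift ord0 i) 0.
  by apply: sumr_ge0 => i _; rewrite -expr2 sqr_ge0.
by rewrite e subr_ge0.
Qed.

Lemma SO01_hyp g x : SO01 g -> hyp x -> hyp (g *m x).
Proof.
move=> Cg [x0 fx].
have fh h : SO01 h -> lform (h *m x) (h *m x) = -1.
  by move=> /SO01_SO1[_ ->].
split; last exact: fh.
rewrite ltNge; apply/negP => le0.
pose f (h : 'M[R]_n.+1) := (h *m x) ord0 0.
have fc : continuous f.
  have mc : continuous (fun h : 'M[R]_n.+1 => h *m x).
    by apply: mulmx_continuous; [move=> t; exact: cvg_id|exact: cst_continuous].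
  move=> h.
  exact: (continuous_comp (mc h) (@coord_continuous R _ _ ord0 0 (h *m x))).
have : connected (f @` SO01).
  apply: connected_continuous_connected; first exact: component_connected.
  exact: continuous_subspaceT.
move=> /connected_intervalP itv.
have : (f @` SO01) 0.
  apply: (itv (f g) (x ord0 0)); first by exists g.
    by exists 1%:M; [exact: SO01_1|rewrite /f mul1mx].
  by rewrite le0 ltW.
move=> [h Ch fh0].
by have := hyp_ge1 (fh _ Ch); rewrite -/(f h) fh0 expr0n /= ler10.
Qed.

End Lorentz.

Definition lorentz (R : realType) (n : nat) : Type := @SO01 R n.
Definition hyperbolic (R : realType) (n : nat) : Type := @hyp R n.

Section LorentzGroup.
Variables (R : realType) (n : nat).
Local Notation G := (lorentz R n).

HB.instance Definition _ := Topological.copy G (@SO01 R n).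

Definition lorentz_val (g : G) : 'M[R]_n.+1 := set_val g.

Lemma lorentzP (g : G) : SO01 (lorentz_val g).
Proof. exact: set_valP. Qed.

Definition lorentz_of (g : 'M[R]_n.+1) (Sg : SO01 g) : G := SigSub (mem_set Sg).

Lemma lorentz_valK g Sg : lorentz_val (@lorentz_of g Sg) = g.
Proof. by []. Qed.

Lemma lorentz_inj : injective lorentz_val.
Proof. exact: val_inj. Qed.

Definition lorentz_one : G := lorentz_of (@SO01_1 R n).
Definition lorentz_mul (g h : G) : G :=
  lorentz_of (SO01_M (lorentzP g) (lorentzP h)).
Definition lorentz_inv (g : G) : G := lorentz_of (SO01_V (lorentzP g)).

Lemma lorentz_mulA : associative lorentz_mul.
Proof. by move=> g h k; apply: lorentz_inj; rewrite !lorentz_valK mulmxA. Qed.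

Lemma lorentz_mul1 : left_id lorentz_one lorentz_mul.
Proof. by move=> g; apply: lorentz_inj; rewrite !lorentz_valK mul1mx. Qed.

Lemma lorentz_mulr1 : right_id lorentz_one lorentz_mul.
Proof. by move=> g; apply: lorentz_inj; rewrite !lorentz_valK mulmx1. Qed.

Lemma lorentz_unit (g : G) : lorentz_val g \in unitmx.
Proof. exact/SO1_unit/SO01_SO1/lorentzP. Qed.

Lemma lorentz_mulV : left_inverse lorentz_one lorentz_inv lorentz_mul.
Proof.
move=> g; apply: lorentz_inj.
by rewrite !lorentz_valK mulVmx// lorentz_unit.
Qed.

Lemma lorentz_mulrV : right_inverse lorentz_one lorentz_inv lorentz_mul.
Proof.
move=> g; apply: lorentz_inj.
by rewrite !lorentz_valK mulmxV// lorentz_unit.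
Qed.

HB.instance Definition _ := isGroup.Build G lorentz_mulA lorentz_mul1
  lorentz_mulr1 lorentz_mulV lorentz_mulrV.

Lemma lorentz_val_continuous : continuous lorentz_val.
Proof. exact: initial_continuous. Qed.

Lemma continuous_lorentz (T : topologicalType) (f : T -> G) :
  continuous (lorentz_val \o f) -> continuous f.
Proof. exact: continuous_comp_initial. Qed.

Lemma lorentz_mul_continuous :
  continuous (fun p : G * G => (p.1 * p.2)%g).
Proof.
apply: continuous_lorentz; apply: mulmx_continuous => p.
  by apply: continuous_comp; [exact: cvg_fst|exact: lorentz_val_continuous].
by apply: continuous_comp; [exact: cvg_snd|exact: lorentz_val_continuous].
Qed.

Lemma lorentz_inv_continuous : continuous (fun g : G => g^-1%g).
Proof.
apply: continuous_lorentz; apply: mx_continuous => i j.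
rewrite (_ : (fun _ => _) = fun g : G => (if i == ord0 then -1 else 1) *
    ((if j == ord0 then -1 else 1) * lorentz_val g j i)); last first.
  by apply/funext => g; exact: (SO1_invE i j (SO01_SO1 (lorentzP g))).
have cc : continuous (fun g : G => lorentz_val g j i).
  move=> g; exact: (continuous_comp (@lorentz_val_continuous g)
    (@coord_continuous R _ _ j i (lorentz_val g))).
by apply: scale_continuous; exact: scale_continuous.
Qed.

HB.instance Definition _ :=
  isTopGroup.Build G lorentz_mul_continuous lorentz_inv_continuous.

(* the matrices diag(1, k) with k in SO(n) *)
Definition SOn : set G :=
  [set g | exists k : 'M[R]_n, [/\ k^T *m k = 1%:M, \det k = 1 &
     lorentz_val g = block_mx (1%:M : 'M[R]_1) 0 0 k :> 'M[R]_(1 + n)]].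

Lemma SOnP (g : G) : SOn g <-> lorentz_val g *m e_ R ord0 = e_ R ord0.
Proof.
have lift1 (i : 'I_n) : rshift 1 i = lift ord0 i :> 'I_(1 + n).
  exact/val_inj.
have l0 : lshift n ord0 = ord0 :> 'I_(1 + n) by exact/val_inj.
split=> [[k [_ _ gk]]|ge].
  rewrite (_ : e_ R ord0 = col_mx (1%:M : 'M[R]_1) (0 : 'M[R]_(n, 1))).
    by rewrite gk (@mul_block_col _ 1 n 1 n) !mulmx1 !mulmx0 !addr0.
  apply/colP => i; have [j ->|j ->] := @split_ordP 1 n i.
    by rewrite (@col_mxEu _ 1 n 1) !mxE !ord1 l0 !eqxx.
  by rewrite (@col_mxEd _ 1 n 1) !mxE lift1.
have Sg := SO01_SO1 (lorentzP g); have [dg fg] := Sg.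
set M := lorentz_val g in ge dg fg *.
have M0 i : M i ord0 = (i == ord0)%:R.
  by move/colP/(_ i): ge; rewrite -colE !mxE eqxx andbT.
have Me i j : M i j = (M *m e_ R j) i 0 by rewrite -colE mxE.
have M0r j : M ord0 j = (j == ord0)%:R.
  have : lform (e_ R ord0) (M *m e_ R j) = lform (e_ R ord0) (e_ R j).
    by rewrite -{1}ge fg.
  by rewrite !lform_e eqxx !mulN1r => /oppr_inj; rewrite -Me !mxE eqxx andbT eq_sym.
have MB : M = block_mx (1%:M : 'M[R]_1) 0 0 (drsubmx (M : 'M[R]_(1 + n))).
  apply/matrixP => i j; have [i' ->|i' ->] := @split_ordP 1 n i;
    have [j' ->|j' ->] := @split_ordP 1 n j.
  - by rewrite (@block_mxEul _ 1 n 1 n) !mxE !ord1 l0 M0 !eqxx.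
  - by rewrite (@block_mxEur _ 1 n 1 n) !mxE !ord1 l0 lift1 M0r.
  - by rewrite (@block_mxEdl _ 1 n 1 n) !mxE !ord1 l0 lift1 M0.
  - by rewrite (@block_mxEdr _ 1 n 1 n) !mxE.
exists (drsubmx (M : 'M[R]_(1 + n))); split=> //.
  apply/matrixP => i j; have := fg (e_ R (lift ord0 i)) (e_ R (lift ord0 j)).
  rewrite lform_e /lform -!Me !M0r !mul0r oppr0 add0r /= mul1r !mxE eqxx andbT.
  rewrite (inj_eq lift_inj) => <-; apply: eq_bigr => l _.
  by rewrite -!Me !mxE !lift1.
by move: dg; rewrite {1}MB (@det_ublock _ 1 n) det1 mul1r.
Qed.

Lemma SOn_closed_subgroup : closed_subgroup SOn.
Proof.
split.
- have -> : SOn = \bigcap_(i in [set: 'I_n.+1])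
      ((fun g : G => lorentz_val g i ord0) @^-1` [set e_ R ord0 i 0]).
    apply/seteqP; split=> g.
      by move=> /SOnP ge i _ /=; rewrite -ge -colE mxE.
    by move=> ge; apply/SOnP/colP => i; rewrite -colE mxE; exact: ge.
  apply: closed_bigI => i _; apply: closed_comp; last exact: closed_eq.
  move=> g _; exact: (continuous_comp (@lorentz_val_continuous g)
    (@coord_continuous R _ _ i ord0 (lorentz_val g))).
- by apply/SOnP; rewrite mul1mx.
- move=> g h /SOnP ge /SOnP he; apply/SOnP.
  rewrite -[lorentz_val _]/(invmx (lorentz_val g) *m lorentz_val h).
  by rewrite -mulmxA he -{1}ge mulKmx// lorentz_unit.
Qed.

Lemma rep_lorentz1 : lorentz_val 1%g = 1%:M. Proof. by []. Qed.

Lemma rep_lorentzM (g h : G) :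
  lorentz_val (g * h)%g = lorentz_val g *m lorentz_val h.
Proof. by []. Qed.

Definition natural_rep : representation R G n.+1 :=
  Representation rep_lorentz1 rep_lorentzM lorentz_val_continuous.

End LorentzGroup.

Section HyperbolicSpace.
Variables (R : realType) (n : nat).
Local Notation G := (lorentz R n).
Local Notation Hn := (hyperbolic R n).

Definition hyperbolic_of (x : 'cV[R]_n.+1) (hx : hyp x) : Hn :=
  SigSub (mem_set hx).

HB.instance Definition _ := Topological.copy Hn (@hyp R n).
HB.instance Definition _ := isPointed.Build Hn (hyperbolic_of (@hyp_e0 R n)).

Definition hyperbolic_val (x : Hn) : 'cV[R]_n.+1 := set_val x.

Lemma hyperbolicP (x : Hn) : hyp (hyperbolic_val x).
Proof. exact: set_valP. Qed.

Definition hyperbolic_act (g : G) (x : Hn) : Hn :=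
  hyperbolic_of (SO01_hyp (lorentzP g) (hyperbolicP x)).

Lemma hyperbolic_actE g x :
  hyperbolic_val (hyperbolic_act g x) = lorentz_val g *m hyperbolic_val x.
Proof. by []. Qed.

(* SO_0(1,n)/SO(n) -> H^n, gSO(n) |-> g e_0 *)
Definition hyp_of_coset (x : homog (@SOn R n)) : Hn :=
  hyperbolic_act (repr x) (hyperbolic_of (@hyp_e0 R n)).

(* Measures are compared on Borel sets only: the values of a library measure
   outside the sigma-algebra are not meaningful. *)
Definition transport (F : set (probability (borel (homog (@SOn R n))) R)) :
    set (probability (borel Hn) R) :=
  [set q | exists2 p, F p &
     forall A : set (borel Hn), measurable A -> q A = p (hyp_of_coset @^-1` A)].

End HyperbolicSpace.

Section Coordinates.
Variables (R : realType).

Definition cosh (t : R) : R := (expR t + expR (- t)) / 2.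
Definition sinh (t : R) : R := (expR t - expR (- t)) / 2.

(* iterated Lebesgue integral of f over D_0 x D_1 x ... *)
Fixpoint iter_integral (D : seq (set R)) (f : seq R -> \bar R) : \bar R :=
  if D is D0 :: D' then
    (\int[@lebesgue_measure R]_(t in D0) iter_integral D' (fun s => f (t :: s)))%E
  else f [::].

(* Below, a point of coordinate space is the sequence s = [:: u; v_1; ...;
   v_(n-1)], so that s`_0 = u and s`_j = v_j. For n = 1 the only coordinate u
   ranges over R. *)
Definition hypsph_dom (n : nat) : seq (set R) :=
  if n is m.+2 then
    `]0, +oo[%classic :: rcons (nseq m `]0, pi[%classic) `]0, (2 * pi)[%classic
  else [:: setT].

Definition hypsph_point (n : nat) (s : seq R) : 'cV[R]_n.+1 :=
  \col_(i < n.+1)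
    if i == ord0 then cosh s`_0
    else sinh s`_0 * (\prod_(1 <= j < i) sin s`_j) *
         (if (i < n)%N then cos s`_i else 1).

Definition hypsph_density (n : nat) (s : seq R) : R :=
  sinh s`_0 ^+ n.-1 * \prod_(1 <= j < n) sin s`_j ^+ (n.-1 - j).

Definition hypsph_measure (n : nat) (A : set (hyperbolic R n)) : \bar R :=
  iter_integral (hypsph_dom n) (fun s =>
    (hypsph_density n s * \1_(@hyperbolic_val R n @` A) (hypsph_point n s))%:E).

End Coordinates.

Section Hyperboloid.
Variables (R : realType) (n : nat).
Local Notation Hn := (hyperbolic R n).

(* K_lam(x), by its integral formula for real lam and x > 0 *)
Definition besselK (lam x : R) : R :=
  \int[@lebesgue_measure R]_(t in `]0, +oo[) (expR (- (x * cosh t)) * cosh (lam * t)).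

Definition hyperboloid_const (kappa : R) : R :=
  kappa `^ ((n%:R - 1) / 2) /
  ((2 * pi) `^ ((n%:R - 1) / 2) * (2 * besselK ((n%:R - 1) / 2) kappa)).

Definition hyperboloid_density (kappa : R) (xi v : Hn) : R :=
  hyperboloid_const kappa *
  expR (kappa * lform (hyperbolic_val xi) (hyperbolic_val v)).

Variable nu : {measure set (borel Hn) -> \bar R}.

Definition hyperboloid_family : set (probability (borel Hn) R) :=
  [set p | exists kappa : R, exists xi : Hn, 0 < kappa /\
     forall A : set (borel Hn), measurable A ->
       p A = (\int[nu]_(v in A) (hyperboloid_density kappa xi v)%:E)%E].

End Hyperboloid.

(* Main.v *)
From HB Require Import structures.
From mathcomp Require Import all_boot all_order all_algebra generic_quotient.
From mathcomp Require Import all_classical all_reals all_analysis measurable_realfun ring lra.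
Require Import Defs.
Import Order.TTheory GRing.Theory Num.Theory.
Import numFieldNormedType.Exports.
Import HBNNSimple.

Set Implicit Arguments.
Unset Strict Implicit.
Unset Printing Implicit Defensive.

Local Open Scope classical_set_scope.
Local Open Scope ring_scope.

(* In horospherical coordinates t = ln (x_0 + x_1), y = (x_2, ..., x_n), the
   subgroups A (boosts in the plane of e_0, e_1) and N (null rotations) of G act
   by translations of t and by y |-> y + e^t b, so Lebesgue measure dt dy gives a
   measure nu that is AN-invariant; since AN is transitive, all balls (the sets
   - <x, y> < c) of a given radius have the same nu-measure. Two measures that
   are uniform in this sense are proportional: integrate the indicator of
   nearby pairs in both orders (Christensen). This yields the G-invariance of nu
   as well as the uniqueness of the G-invariant Radon measure. The substitution
   x_1 = sqrt (1 + |y|^2) sinh s, followed by polar coordinates, turns dt dy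
   into the hyperbolic-spherical expression, and a Gaussian integral in y gives
   the Bessel normalization.

   For n >= 2 a homomorphism from G to R that vanishes on SO(n) is zero: a boost
   is conjugate to its inverse by a rotation, a null rotation is conjugate to
   its square by a boost, and G = NA SO(n). So tau = 0, and the multiplier of nu
   is 1. Finally exp <eta, v> is integrable only for eta in the open future
   cone: otherwise it is bounded below on a slab - <l, v> < c along a null
   vector l, and boosts scale l, so that all these slabs have the same measure,
   which is that of their union, namely infinite. *)

(** * Substitutions in integrals over the line *)

(** Rotations have no simple expression in horospherical coordinates, and this shapes the proof:
    invariance is proved by hand for AN only, and the rest is extracted from the masses of balls.
    That condition does not mention a group, so it holds for the image of [nu] under any element of
    G as soon as it holds for [nu]. It is also all that has to be known of a measure on G/H in order
    to compare it with [nu]. Integrals in n variables are iterated integrals over sequences of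
    reals, and every change of coordinates is cut into substitutions in one variable, with Tonelli's
    theorem in between; no Jacobian determinant is computed. For [n = 1] the group SO(1) is trivial
    and G consists of the boosts of one plane, so that [W0] contains the multiples of the boost
    parameter, and relatively invariant measures need not be invariant. Hence the last clause of the
    theorem restricts to [tau = 0] and to G-invariant measures. *)

Lemma ge0_integral_density d (T : measurableType d) (R : realType)
    (mu m : {measure set T -> \bar R}) (w : T -> R) (f : T -> \bar R) :
  measurable_fun setT w -> (forall x, 0 <= w x) ->
  (forall A, measurable A -> m A = (\int[mu]_(x in A) (w x)%:E)%E) ->
  measurable_fun setT f -> (forall x, (0 <= f x)%E) ->
  (\int[m]_x f x = \int[mu]_x (f x * (w x)%:E))%E.
Proof.
move=> mw w0 mE mf f0.
(* For the indicator of a measurable set the claim is the hypothesis [mE]; it passes to simple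
   functions by linearity and to [f] by monotone convergence along [g]. *)
pose g := nnsfun_approx measurableT mf.
have mEw : measurable_fun setT (EFin \o w) by exact/measurable_EFinP.
have simple n : (\int[m]_x (g n x)%:E = \int[mu]_x ((g n x)%:E * (w x)%:E))%E.
  under eq_integral do rewrite fimfunE -fsumEFin//.
  rewrite ge0_integral_fsum//; last 2 first.
  - by move=> r; exact/measurable_EFinP/measurableT_comp.
  - by move=> r x _; rewrite nnfun_muleindic_ge0.
  transitivity (\sum_(r \in range (g n)) \int[mu]_x
      ((r * \1_(g n @^-1` [set r]) x)%:E * (w x)%:E))%E; last first.
    rewrite -ge0_integral_fsum//; last 2 first.
    - move=> r; apply: emeasurable_funM => //.
      exact/measurable_EFinP/measurableT_comp.
    - by move=> r x _; rewrite mule_ge0 ?lee_fin//; exact: (nnfun_muleindic_ge0 (g n)).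
    apply: eq_integral => x _; rewrite [in RHS]fimfunE -fsumEFin//.
    rewrite ge0_mule_fsuml// => r; exact: (nnfun_muleindic_ge0 (g n)).
  apply: eq_fsbigr => r _; rewrite integralZl_indic_nnsfun//.
  rewrite integral_indic// setIT mE//.
  under [RHS]eq_integral do rewrite EFinM -muleA.
  have [r0|r0] := ltP r 0.
    by rewrite preimage_nnfun0// integral_set0 mule0; under eq_integral do
      rewrite indic0 mul0e mule0; rewrite integral0.
  rewrite ge0_integralZl//.
  - congr (_ * _)%E; rewrite integral_mkcond; apply: eq_integral => x _.
    rewrite patchE indicE; case: ifP => _; first by rewrite mul1e.
    by rewrite mul0e.
  - apply: emeasurable_funM => //; exact/measurable_EFinP/measurable_indic.
  - by move=> x _; rewrite -EFinM lee_fin mulr_ge0.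
transitivity (limn (fun n => \int[m]_x (g n x)%:E))%E.
  rewrite -monotone_convergence//.
  - by apply: eq_integral => x _; apply/esym/cvg_lim => //; exact: cvg_nnsfun_approx.
  - by move=> n; exact/measurable_EFinP.
  - by move=> n x _; rewrite lee_fin.
  - by move=> x _ a b ab; rewrite lee_fin; exact/lefP/nd_nnsfun_approx.
under eq_fun do rewrite simple.
rewrite -monotone_convergence//.
- apply: eq_integral => x _; apply/cvg_lim => //.
  apply: cvgeZr => //; exact: cvg_nnsfun_approx.
- by move=> n; apply: emeasurable_funM => //; exact/measurable_EFinP.
- by move=> n x _; rewrite mule_ge0 ?lee_fin.
- move=> x _ a b ab; rewrite lee_wpmul2r ?lee_fin//; exact/lefP/nd_nnsfun_approx.
Qed.

Lemma density_measure d (T : measurableType d) (R : realType)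
    (mu : {measure set T -> \bar R}) (w : T -> R) :
  measurable_fun setT w -> (forall x, 0 <= w x) ->
  exists m : {measure set T -> \bar R},
    forall A, m A = (\int[mu]_(x in A) (w x)%:E)%E.
Proof.
move=> mw w0.
have mEw : measurable_fun setT (EFin \o w) by exact/measurable_EFinP.
have Ew0 t : (0 <= (EFin \o w) t)%E by rewrite lee_fin.
pose m0 := fun A : set T => (\int[mu]_(x in A) (EFin \o w) x)%E.
have m00 : m0 set0 = 0%E by rewrite /m0 integral_set0.
have m0ge A : (0 <= m0 A)%E by exact: integral_ge0.
pose m : {measure set T -> \bar R} := HB.pack m0
  (isMeasure.Build _ _ _ m0 m00 m0ge (semi_sigma_additive_nng_induced mEw Ew0)).
by exists m.
Qed.

Lemma pushforward_measure d1 d2 (X : measurableType d1) (Y : measurableType d2)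
    (R : realType) (mu : {measure set X -> \bar R}) (phi : X -> Y) :
  measurable_fun setT phi ->
  exists m : {measure set Y -> \bar R}, (forall A, m A = mu (phi @^-1` A)) /\
    forall g : Y -> \bar R, measurable_fun setT g -> (forall y, (0 <= g y)%E) ->
      (\int[m]_y g y = \int[mu]_x g (phi x))%E.
Proof.
move=> mphi.
pose m : {measure set Y -> \bar R} := pushforward mu phi.
exists (m mphi); split => // g mg g0.
by rewrite /m/= ge0_integral_pushforward// preimage_setT.
Qed.

Section substitution.
Context {R : realType}.
Notation mu := (@lebesgue_measure R).
Variables (D : set R) (F F' G : R -> R).
Hypothesis oD : open D.
Hypothesis iD : forall x y z, D x -> D y -> x <= z <= y -> D z.
Hypothesis dF : forall t, D t -> is_derive t 1 F (F' t).
Hypothesis cF' : forall t, D t -> {for t, continuous F'}.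
Hypothesis F'0 : forall t, D t -> 0 < F' t.
Hypothesis GD : forall x, D (G x).
Hypothesis FK : forall x, F (G x) = x.

Let cF t : D t -> {for t, continuous F}.
Proof.
move=> Dt; apply: differentiable_continuous; apply/derivable1_diffP.
by have := dF Dt.
Qed.

Let F_incr x y : D x -> D y -> x < y -> F x < F y.
Proof.
move=> Dx Dy xy.
have DI t : t \in `[x, y] -> D t by rewrite in_itv/= => ?; apply: iD Dx Dy _.
have DI' t : t \in `]x, y[ -> D t by move=> /subset_itv_oo_cc; exact: DI.
apply: (@gtr0_derive1_incr _ F x y) => //.
- by move=> t /DI' Dt; have [] := dF Dt.
- by move=> t /DI' Dt; rewrite derive1E (@derive_val _ _ _ _ _ _ _ (dF Dt)) F'0.
- apply: continuous_in_subspaceT => t /set_mem/= /DI; exact: cF.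
Qed.

Let F_le x t : D t -> (F t <= x) = (t <= G x).
Proof.
move=> Dt; rewrite -{1}(FK x); apply/idP/idP.
  by apply: contraTT; rewrite -!ltNge => ?; apply: F_incr.
by rewrite le_eqVlt => /predU1P[->//|?]; apply/ltW/F_incr.
Qed.

Let integral_F' x y : x < y ->
  (\int[mu]_(t in `]G x, G y]) (F' t)%:E = (y - x)%:E)%E.
Proof.
move=> xy.
have Gxy : G x < G y by rewrite ltNge -F_le// FK -ltNge.
have DI t : t \in `[G x, G y] -> D t by rewrite in_itv/= => ?; apply: iD (GD x) (GD y) _.
have DI' t : t \in `]G x, G y[ -> D t by move=> /subset_itv_oo_cc; exact: DI.
have cI : {within `[G x, G y], continuous F'}.
  by apply: continuous_in_subspaceT => t /set_mem/= /DI; exact: cF'.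
rewrite integral_itv_obnd_cbnd; last first.
  apply/measurable_EFinP; apply: (@measurable_funS _ _ _ _ `[G x, G y]%classic) => //.
    exact: subset_itv_oc_cc.
  exact: subspace_continuous_measurable_fun.
rewrite (@continuous_FTC2 _ F' F)// ?FK//.
  split.
  - by move=> t /DI' Dt; have [] := dF Dt.
  - by apply: cvg_at_right_filter; exact: cF.
  - by apply: cvg_at_left_filter; exact: cF.
by move=> t /DI' Dt; rewrite derive1E (@derive_val _ _ _ _ _ _ _ (dF Dt)).
Qed.

(** The image under [F] of the measure with density [F'] on [D] gives []x, y]] the mass [y - x], by
    the fundamental theorem of calculus between [G x] and [G y]. Hence this image is Lebesgue
    measure, and the integral of [f] against it unfolds to the right-hand side. *)
Lemma ge0_integral_subst (f : R -> \bar R) :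
  measurable_fun setT f -> (forall x, (0 <= f x)%E) ->
  (\int[mu]_x f x = \int[mu]_(t in D) (f (F t) * (F' t)%:E))%E.
Proof.
move=> mf f0.
have mD : measurable D by exact: open_measurable.
(* Both are extended by 0 outside [D]. The value 0 of [H] there is harmless, since [w] leaves no
   mass outside [D]. *)
pose w := F' \_ D; pose H := F \_ D.
have mF' : measurable_fun D (F' : R -> measurableTypeR R).
  apply: open_continuous_measurable_fun => //.
  by move=> t /set_mem; exact: cF'.
have mF : measurable_fun D (F : R -> measurableTypeR R).
  apply: open_continuous_measurable_fun => //.
  by move=> t /set_mem; exact: cF.
have mw : measurable_fun setT (w : _ -> measurableTypeR R).
  by move/(measurable_restrictT _ mD) : mF'.
have mH : measurable_fun setT (H : _ -> measurableTypeR R).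
  by move/(measurable_restrictT _ mD) : mF.
have w0 t : 0 <= w t.
  by rewrite /w patchE; case: ifP => // /set_mem /F'0/ltW.
have [m0 m0E] := density_measure mu mw w0.
have [m [mE intm]] := pushforward_measure m0 mH.
have muE A : measurable A -> mu A = m A.
  apply: lebesgue_measure_unique => _ [[x y] _ <-] /=.
  transitivity (\int[mu]_(t in `]G x, G y]) (F' t)%:E)%E.
    rewrite lebesgue_measure_itv/= lte_fin; case: ltP => [/integral_F'->//|yx].
    by rewrite set_itv_ge ?integral_set0// bnd_simp -leNgt -F_le// FK.
  rewrite mE m0E [LHS]integral_mkcond [RHS]integral_mkcond.
  apply: eq_integral => t _ /=; rewrite !patchE.
  have [Dt|nDt] := pselect (D t).
    have -> : (t \in H @^-1` `]x, y]) = (t \in `]G x, G y]%classic).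
      have HtE : H t = F t by rewrite /H patchE mem_set.
      have E : (x < F t <= y) = (G x < t <= G y) by rewrite !ltNge !F_le.
      by apply/idP/idP => /set_mem/= h; apply/mem_set; move: h;
        rewrite /= HtE !in_itv/= E.
    by rewrite /w patchE (mem_set Dt).
  rewrite /w patchE (memNset nDt) if_same ifF//; apply/negP.
  rewrite inE/= in_itv/= => /andP[/ltW Gxt tGy].
  by apply: nDt; apply: iD (GD x) (GD y) _; rewrite Gxt.
rewrite (eq_measure_integral m)//; last by move=> A mA _; exact: muE.
rewrite intm// (ge0_integral_density (mu := mu) (w := w))//.
  rewrite [RHS]integral_mkcond; apply: eq_integral => t _.
  rewrite /w /H !patchE; case: ifPn => //; by rewrite mule0.
by apply: measurableT_comp.
Qed.
End substitution.

(** * Hyperbolic sine and cosine *)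

Section hyperbolic_functions.
Context {R : realType}.
Implicit Types x t : R.

Lemma cosh_gt0 t : 0 < cosh t.
Proof. by rewrite /cosh divr_gt0// addr_gt0// expR_gt0. Qed.

Lemma cosh2_sinh2 t : cosh t ^+ 2 - sinh t ^+ 2 = 1.
Proof.
rewrite /cosh /sinh expRN.
by have := expR_gt0 t => e0; field; rewrite gt_eqF.
Qed.

Lemma coshN t : cosh (- t) = cosh t.
Proof. by rewrite /cosh opprK addrC. Qed.

Lemma sinhN t : sinh (- t) = - sinh t.
Proof. by rewrite /sinh opprK -mulNr opprB. Qed.

Lemma coshD s t : cosh (s + t) = cosh s * cosh t + sinh s * sinh t.
Proof. by rewrite /cosh /sinh opprD !expRD; field. Qed.

Lemma sinhD s t : sinh (s + t) = sinh s * cosh t + cosh s * sinh t.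
Proof. by rewrite /cosh /sinh opprD !expRD; field. Qed.

Lemma cosh_sinh_expR t : cosh t + sinh t = expR t.
Proof. by rewrite /cosh /sinh; field. Qed.

Lemma sqrt_cosh t : Num.sqrt (1 + sinh t ^+ 2) = cosh t.
Proof.
by rewrite -(cosh2_sinh2 t) subrK sqrtr_sqr ger0_norm// ltW// cosh_gt0.
Qed.

#[global] Instance is_derive_sinh t : is_derive t 1 (@sinh R) (cosh t).
Proof.
rewrite /sinh /cosh; apply: is_derive_eq.
by rewrite !scaler0 add0r mulrN1 opprK [LHS]mulrC.
Qed.

Lemma continuous_cosh : continuous (@cosh R).
Proof.
move=> t; apply: cvgM; last exact: cvg_cst.
apply: cvgD; first exact: continuous_expR.
by apply: continuous_comp; [exact: opp_continuous|exact: continuous_expR].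
Qed.

Lemma continuous_sinh : continuous (@sinh R).
Proof.
move=> t; apply: cvgM; last exact: cvg_cst.
apply: cvgB; first exact: continuous_expR.
by apply: continuous_comp; [exact: opp_continuous|exact: continuous_expR].
Qed.

Definition asinh x := ln (x + Num.sqrt (1 + x ^+ 2)).

Lemma asinhK : cancel asinh (@sinh R).
Proof.
move=> x; set s := Num.sqrt (1 + x ^+ 2).
have s2 : s ^+ 2 = 1 + x ^+ 2 by rewrite sqr_sqrtr// addr_ge0// sqr_ge0.
have y0 : 0 < x + s.
  have : `|x| < s.
    by rewrite -sqrtr_sqr ltr_sqrt ?ltrDr// ltr_pwDl// sqr_ge0.
  by rewrite ltr_norml => /andP[? _]; lra.
rewrite /asinh /sinh expRN lnK ?posrE//.
have -> : (x + s)^-1 = s - x.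
  apply: (@mulfI _ (x + s)); first by rewrite gt_eqF.
  by rewrite divff ?gt_eqF//; move: s2; lra.
by rewrite -/s; field.
Qed.

Lemma sinh_gt0 t : (0 < sinh t) = (0 < t).
Proof.
rewrite /sinh pmulr_lgt0 ?invr_gt0// subr_gt0 ltr_expR.
by apply/idP/idP; lra.
Qed.

End hyperbolic_functions.

Section substitutions.
Context {R : realType}.
Notation mu := (@lebesgue_measure R).
Implicit Types (a c y : R) (f : R -> \bar R).
Local Open Scope ereal_scope.

Lemma ge0_integral_shift a f : measurable_fun setT f -> (forall x, 0 <= f x) ->
  \int[mu]_x f (x + a)%R = \int[mu]_x f x.
Proof.
move=> mf f0.
rewrite [RHS](@ge0_integral_subst _ setT (fun x => x + a)%R (cst 1%R) (fun x => x - a)%R)//.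
- by apply: eq_integral => x _; rewrite mule1.
- exact: openT.
- by move=> t _; apply: is_derive_eq; rewrite addr0.
- by move=> t _; exact: cst_continuous.
- by move=> x; rewrite subrK.
Qed.

Lemma ge0_integral_scale c f : (0 < c)%R ->
  measurable_fun setT f -> (forall x, 0 <= f x) ->
  \int[mu]_x f x = \int[mu]_x (f (c * x)%R * c%:E).
Proof.
move=> c0 mf f0.
rewrite [LHS](@ge0_integral_subst _ setT (fun x => c * x)%R (cst c) (fun x => x / c)%R)//.
- exact: openT.
- move=> t _; rewrite -[X in is_derive _ _ X]/(c \*: id)%R -[cst c t]mulr1.
  exact: is_deriveZ.
- by move=> t _; exact: cst_continuous.
- by move=> x; rewrite mulrC divfK// gt_eqF.
Qed.

Lemma ge0_integral_sinh a f : (0 < a)%R ->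
  measurable_fun setT f -> (forall x, 0 <= f x) ->
  \int[mu]_x f x = \int[mu]_t (f (a * sinh t)%R * (a * cosh t)%:E).
Proof.
move=> a0 mf f0.
rewrite [LHS](@ge0_integral_subst _ setT (fun t => a * sinh t)%R
  (fun t => a * cosh t)%R (fun x => asinh (x / a)))//.
- exact: openT.
- by move=> t _; apply: cvgMl_tmp; exact: continuous_cosh.
- by move=> t _; rewrite mulr_gt0// cosh_gt0.
- by move=> x; rewrite asinhK mulrC divfK// gt_eqF.
Qed.

Lemma ge0_integral_oppr f : measurable_fun setT f -> (forall x, 0 <= f x) ->
  \int[mu]_x f (- x)%R = \int[mu]_x f x.
Proof.
move=> mf f0.
have mopp : measurable_fun setT (-%R : measurableTypeR R -> measurableTypeR R) by [].
have [m [mE intm]] := pushforward_measure mu mopp.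
rewrite [RHS](eq_measure_integral m); first by rewrite intm.
by move=> A mA _; apply/esym; rewrite mE; exact: lebesgue_measureN.
Qed.

(** At height [y] in the upper half plane the point of angle [t] has abscissa [y cot t]. The
    cotangent decreases while [ge0_integral_subst] takes increasing maps, so [x] is first replaced
    by [- x] and the substitution is made by [y * tan (t - pi / 2)], which is [- y cot t]. *)
Lemma ge0_integral_cot y f : (0 < y)%R ->
  measurable_fun setT f -> (forall x, 0 <= f x) ->
  \int[mu]_x f x =
  \int[mu]_(t in `]0%R, pi[) (f (y * (cos t / sin t))%R * (y / sin t ^+ 2)%:E).
Proof.
move=> y0 mf f0; rewrite -ge0_integral_oppr//.
have spos (t : R) : `]0%R, pi[%classic t -> (0 < sin t)%R.
  by rewrite /= in_itv/=; exact: sin_gt0_pi.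
have c0 (t : R) : `]0%R, pi[%classic t -> (cos (t - pi / 2) != 0)%R.
  by move=> /spos st0; rewrite cosBpihalf gt_eqF.
have dF (t : R) : `]0%R, pi[%classic t ->
    is_derive t 1%R (fun t => y * tan (t - pi / 2))%R (y / sin t ^+ 2)%R.
  move=> /c0 ct; have h : is_derive t 1%R (fun t : R => t - pi / 2)%R 1%R.
    by apply: is_derive_eq; rewrite subr0.
  have := is_deriveZ y (@is_derive1_comp _ _ (fun t => t - pi / 2)%R t _ _ (is_derive_tan ct) h).
  by rewrite cosBpihalf mulr1.
have mfN : measurable_fun setT (fun x : measurableTypeR R => f (- x)%R) by exact: measurableT_comp.
rewrite (ge0_integral_subst (G := (fun x => pi / 2 + atan (x / y))%R) _ _ dF _ _ _ _ mfN)//.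
- apply: eq_integral => t _.
  by rewrite /tan sinBpihalf cosBpihalf mulNr mulrN opprK.
- move=> x z t; rewrite /= !in_itv/= => /andP[x0 _] /andP[_ zpi] /andP[xt tz].
  by rewrite (lt_le_trans x0 xt) (le_lt_trans tz zpi).
- move=> t /spos st0; apply: cvgMl_tmp; apply: cvgV; first by rewrite expf_neq0// gt_eqF.
  by apply: cvgM; exact: continuous_sin.
- by move=> t /spos st0; rewrite divr_gt0// exprn_gt0.
- move=> x; rewrite /= in_itv/=.
  have := atan_gtNpi2 (x / y); have := atan_ltpi2 (x / y); move=> ? ?.
  by apply/andP; split; lra.
- by move=> x; rewrite addrAC subrr add0r atanK mulrC divfK// gt_eqF.
Qed.
End substitutions.

(** * Iterated integrals *)

(* A function of n real variables, given on sequences, is jointly measurable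
   (with a parameter in T) when its composite with any n measurable real
   functions is measurable; this avoids iterated product types. *)
Definition seq_measurable (R : realType) d (T : measurableType d) (n : nat)
    (F : T -> seq R -> \bar R) :=
  forall d' (U : measurableType d') (p : U -> T) (g : nat -> U -> R),
    measurable_fun setT p -> (forall i, measurable_fun setT (g i)) ->
    measurable_fun setT (fun u => F (p u) (mkseq (g^~ u) n)).

Section sigma_finite_copy.
Context d (T : measurableType d) (R : realType).
Variables (m : {measure set T -> \bar R}) (sf : sigma_finite setT m).

(** An alias of [m] that carries the proof of sigma-finiteness as an argument, so that the structure
    can be attached to it. *)
Definition sigma_finite_copy of sigma_finite setT m : set T -> \bar R := m.
Local Notation m' := (sigma_finite_copy sf).

Let m0 : m' set0 = 0%E. Proof. exact: measure0. Qed.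
Let mge0 A : (0 <= m' A)%E. Proof. exact: measure_ge0. Qed.
Let msa : semi_sigma_additive m'. Proof. exact: measure_semi_sigma_additive. Qed.
HB.instance Definition _ := isMeasure.Build _ _ _ m' m0 mge0 msa.
HB.instance Definition _ := Measure_isSigmaFinite.Build _ _ _ m' sf.

Lemma sigma_finite_measure_exists :
  exists m1 : {sigma_finite_measure set T -> \bar R},
    (forall A, m1 A = m A) /\
    (forall D f, \int[m1]_(x in D) f x = \int[m]_(x in D) f x)%E.
Proof. by exists m'; split => // D f; exact: eq_measure_integral. Qed.

End sigma_finite_copy.

Section iter_integral.
Context {R : realType}.
Notation mu := (@lebesgue_measure R).
Local Open Scope ereal_scope.

Lemma mkseqS (T : Type) (f : nat -> T) n :
  mkseq f n.+1 = f 0%N :: mkseq (fun i => f i.+1) n.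
Proof. by rewrite /mkseq /= -(addn0 1%N) iotaDl -map_comp. Qed.

(** Absorbs a domain of integration into the measure, so that Tonelli's theorem for integrals over
    whole spaces also serves integrals over [D]; the density [\1_D] keeps sigma-finiteness. *)
Lemma restrict_measure d (T : measurableType d)
    (m : {sigma_finite_measure set T -> \bar R}) (D : set T) : measurable D ->
  exists m' : {sigma_finite_measure set T -> \bar R}, forall f,
    (forall x, 0 <= f x) -> measurable_fun setT f ->
    \int[m']_x f x = \int[m]_(x in D) f x.
Proof.
move=> mD; pose w : T -> R := \1_D.
have mw : measurable_fun setT w by exact: measurable_indic.
have w0 x : (0 <= w x)%R by rewrite /w indicE.
have [m0 m0E] := density_measure m mw w0.
have m0D A : measurable A -> m0 A = m (D `&` A) by move=> mA; rewrite m0E integral_indic.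
have [|m' [_ m'E]] := @sigma_finite_measure_exists _ _ _ m0.
  have [F FT mF] := sigma_finiteT m; exists F => // k; have [mFk mk] := mF k.
  split => //; rewrite m0D//; apply: le_lt_trans mk; apply: le_measure; rewrite ?inE//.
  exact: measurableI.
exists m' => f f0 mf; rewrite m'E (ge0_integral_density mw w0 (fun A _ => m0E A))//.
rewrite [RHS]integral_mkcond; apply: eq_integral => x _.
rewrite patchE /w indicE; case: ifP => _; first by rewrite mule1.
by rewrite mule0.
Qed.

Lemma product_measure_exists d1 d2 (T1 : measurableType d1) (T2 : measurableType d2)
    (m1 : {sigma_finite_measure set T1 -> \bar R})
    (m2 : {sigma_finite_measure set T2 -> \bar R}) :
  exists m : {sigma_finite_measure set (T1 * T2)%type -> \bar R}, forall f,
    (forall x, 0 <= f x) -> measurable_fun setT f ->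
    \int[m]_x f x = \int[m1]_x \int[m2]_y f (x, y).
Proof.
have /sigma_finiteP[F [TF ndF Foo]] := sigma_finiteT m1.
have /sigma_finiteP[G [TG ndG Goo]] := sigma_finiteT m2.
have [|m [_ mE]] := @sigma_finite_measure_exists _ _ _
    [the {measure set _ -> \bar R} of m1 \x m2].
  exists (fun k => F k `*` G k) => [|k].
    apply/seteqP; split => // -[x y] _.
    have : [set: T1] x by []. have : [set: T2] y by [].
    rewrite TF TG => -[k _ Gky] [l _ Flx]; exists (maxn k l) => //; split => /=.
    - by move: x Flx; exact/subsetPset/ndF/leq_maxr.
    - by move: y Gky; exact/subsetPset/ndG/leq_maxl.
  have [? ?] := Foo k; have [? ?] := Goo k.
  split; first exact: measurableX.
  by rewrite [X in X < _]product_measure1E// lte_mul_pinfty// ge0_fin_numE.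
by exists m => f f0 mf; rewrite mE; exact: fubini_tonelli1.
Qed.

(** An iterated integral is a single integral over some measured space with coordinate functions
    [g]. The space is a nested product built by recursion on [D], but it stays hidden under the
    existential, so the dimension never appears in a type. The default [setT] of [nth] is
    measurable, so the hypothesis only constrains the entries of [D]. *)
Lemma iter_integral_measure (D : seq (set R)) :
  (forall i, measurable (nth setT D i)) ->
  exists d (T : measurableType d) (m : {sigma_finite_measure set T -> \bar R})
      (g : nat -> T -> R), (forall i, measurable_fun setT (g i)) /\
    forall f : seq R -> \bar R, (forall s, 0 <= f s) ->
      seq_measurable (size D) (fun _ : unit => f) ->
      iter_integral D f = \int[m]_t f (mkseq (g^~ t) (size D)).
Proof.
elim: D => [|D0 D IH] mD.
  (* In dimension 0 the integral is evaluation at the empty sequence: a unit mass on a point. *)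
  exists _, unit, [the {sigma_finite_measure set unit -> \bar R} of \d_tt], (fun _ => cst 0%R).
  split => // f f0 mf.
  by rewrite integral_dirac// diracT mul1e.
have [d [T [m [g [mg intm]]]]] := IH (fun i => mD i.+1).
have [m0 m0E] := @restrict_measure _ _ [the {sigma_finite_measure set (measurableTypeR R) -> \bar R} of mu] D0 (mD 0%N).
have [m1 m1E] := product_measure_exists m0 m.
exists _, _, m1, (fun i => if i is j.+1 then g j \o snd else fst).
split; first by case=> [|i]; [exact: measurable_fst|exact: measurableT_comp].
move=> f f0 mf /=.
have mf1 : measurable_fun setT (fun z : measurableTypeR R * T =>
    f (z.1 :: mkseq (fun i => g i z.2) (size D))).
  pose h i : measurableTypeR R * T -> R := if i is j.+1 then g j \o snd else fst.
  rewrite (_ : (fun _ => _) = fun z => f (mkseq (h^~ z) (size D).+1)); last first.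
    by apply/funext => z; rewrite mkseqS.
  apply: (mf _ _ (fun=> tt)) => //.
  by case=> [|i]; [exact: measurable_fst|exact: measurableT_comp].
have mfD t : seq_measurable (size D) (fun _ : unit => fun s => f (t :: s)).
  move=> d' U p h mp mh.
  rewrite (_ : (fun _ => _) = fun z =>
      f (mkseq (fun i => (if i is j.+1 then h j else cst t) z) (size D).+1)).
    by apply: (mf _ _ (fun=> tt) (fun i => if i is j.+1 then h j else cst t)) => //; case.
  by apply/funext => z; rewrite mkseqS.
under eq_integral do rewrite intm//.
rewrite -m0E; last 2 first.
- by move=> t; exact: integral_ge0.
- apply: (@measurable_fun_fubini_tonelli_F _ _ _ _ _ m _ mf1) => z; exact: f0.
rewrite m1E//.
  by apply: eq_integral => t _; apply: eq_integral => u _; rewrite mkseqS.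
by under eq_fun do rewrite mkseqS.
Qed.

Lemma seq_measurable_cat d (T : measurableType d) (F : T -> seq R -> \bar R) n k :
  seq_measurable (n + k) F ->
  forall d' (U : measurableType d') (p : U -> T) (g h : nat -> U -> R),
    measurable_fun setT p -> (forall i, measurable_fun setT (g i)) ->
    (forall i, measurable_fun setT (h i)) ->
    measurable_fun setT (fun u => F (p u) (mkseq (g^~ u) n ++ mkseq (h^~ u) k)).
Proof.
move=> mF d' U p g h mp mg mh.
have := mF _ U p (fun i => if (i < n)%N then g i else h (i - n)%N) mp.
rewrite (_ : (fun u => F _ (mkseq _ (n + k))) = (fun u => F (p u) (mkseq (g^~ u) n ++ mkseq (h^~ u) k))).
  by apply => i; case: ifP.
apply/funext => u; congr (F _ _).
rewrite /mkseq iotaD map_cat add0n; congr (_ ++ _).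
  by apply/eq_in_map => i; rewrite mem_iota add0n => /andP[_ ->].
rewrite (_ : iota n k = map (addn n) (iota 0 k)); last by rewrite -iotaDl addn0.
rewrite -map_comp; apply: eq_map => i /=.
by rewrite ltnNge leq_addr/= addKn.
Qed.

Lemma seq_measurable_iter_integral d (T : measurableType d) (D : seq (set R))
    (F : T -> seq R -> \bar R) k :
  (forall i, measurable (nth setT D i)) ->
  (forall t s, 0 <= F t s) ->
  seq_measurable (size D + k) F ->
  seq_measurable k (fun t s => iter_integral D (fun s' => F t (s' ++ s))).
Proof.
move=> mD F0 mF d' U p g mp mg.
have [d1 [X [m [h [mh intm]]]]] := iter_integral_measure mD.
rewrite (_ : (fun u => _) = (fun u => \int[m]_t
    F (p u) (mkseq (h^~ t) (size D) ++ mkseq (g^~ u) k))); last first.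
  apply/funext => u; apply: intm => // d2 U2 p2 g2 mp2 mg2.
  exact: (seq_measurable_cat mF (p := cst (p u)) (h := fun i => cst (g i u))).
apply: (@measurable_fun_fubini_tonelli_F _ _ _ _ _ m (fun z =>
  F (p z.1) (mkseq (h^~ z.2) (size D) ++ mkseq (g^~ z.1) k))) => [|z]; last exact: F0.
apply: (seq_measurable_cat mF (p := p \o fst) (g := fun i => h i \o snd)
  (h := fun i => g i \o fst)).
- exact: measurableT_comp.
- by move=> i; exact: measurableT_comp.
- by move=> i; exact: measurableT_comp.
Qed.

Lemma iter_integral_ge0 (D : seq (set R)) f : (forall s, 0 <= f s) ->
  0 <= iter_integral D f.
Proof.
elim: D f => [|D0 D IH] f f0 //=; apply: integral_ge0 => t _.
by apply: IH => s.
Qed.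

Lemma eq_iter_integral (D : seq (set R)) f g :
  (forall s, size s = size D -> (forall i, (i < size D)%N -> nth setT D i s`_i) ->
    f s = g s) ->
  iter_integral D f = iter_integral D g.
Proof.
elim: D f g => [|D0 D IH] f g fg /=; first by apply: fg.
apply: eq_integral => t /set_mem D0t; apply: IH => s sD Ds.
by apply: fg => [|[|i] iD //=]; [rewrite /= sD|exact: Ds].
Qed.

(** Brings the first variable innermost, which is needed when its change of variable depends on the
    remaining ones. *)
Lemma iter_integral_swap (D0 : set R) (D : seq (set R)) f :
  measurable D0 -> (forall i, measurable (nth setT D i)) -> (forall s, 0 <= f s) ->
  seq_measurable (size D).+1 (fun _ : unit => f) ->
  iter_integral (D0 :: D) f =
  iter_integral D (fun s => \int[mu]_(t in D0) f (t :: s)).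
Proof.
move=> mD0 mD f0 mf /=.
have [d1 [X [m [h [mh intm]]]]] := iter_integral_measure mD.
have [m0 m0E] := restrict_measure mu mD0.
pose F (z : measurableTypeR R * X) := f (z.1 :: mkseq (h^~ z.2) (size D)).
have mF : measurable_fun setT F.
  rewrite (_ : F = fun z => f (mkseq
      (fun i => (if i is j.+1 then h j \o snd else fst) z) (size D).+1)).
    apply: (mf _ _ (fun=> tt) (fun i => if i is j.+1 then h j \o snd else fst)) => //.
    by case=> [|i]; [exact: measurable_fst|exact: measurableT_comp].
  by apply/funext => z; rewrite mkseqS.
have F0 z : 0 <= F z by exact: f0.
have mF1 : measurable_fun setT (fun t => \int[m]_x F (t, x)).
  exact: (@measurable_fun_fubini_tonelli_F _ _ _ _ _ m _ mF F0).
transitivity (\int[mu]_(t in D0) \int[m]_x F (t, x)).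
  apply: eq_integral => t _; rewrite intm// => d' U p g mp mg.
  rewrite (_ : (fun _ => _) = fun z =>
      f (mkseq (fun i => (if i is j.+1 then g j else cst t) z) (size D).+1)).
    by apply: (mf _ _ (fun=> tt) (fun i => if i is j.+1 then g j else cst t)) => //; case.
  by apply/funext => z; rewrite mkseqS.
rewrite -m0E//; last by move=> t; exact: integral_ge0.
have -> : \int[m0]_t \int[m]_x F (t, x) = \int[m]_x \int[m0]_t F (t, x).
  exact: fubini_tonelli.
rewrite intm.
- apply: eq_integral => x _; rewrite m0E//.
  exact: measurableT_comp.
- by move=> s; exact: integral_ge0.
- move=> d' U p g mp mg.
  pose G (z : U * measurableTypeR R) := f (z.2 :: mkseq (g^~ z.1) (size D)).
  have mG : measurable_fun setT G.
    rewrite (_ : G = fun z => f (mkseq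
        (fun i => (if i is j.+1 then g j \o fst else snd) z) (size D).+1)).
      apply: (mf _ _ (fun=> tt) (fun i => if i is j.+1 then g j \o fst else snd)) => //.
      by case=> [|i]; [exact: measurable_snd|exact: measurableT_comp].
    by apply/funext => z; rewrite mkseqS.
  have G0 z : 0 <= G z by exact: f0.
  rewrite (_ : (fun _ => _) = fun u => \int[m0]_t G (u, t)).
    exact: (@measurable_fun_fubini_tonelli_F _ _ _ _ _ m0 _ mG G0).
  apply/funext => u; rewrite m0E//.
  exact: measurableT_comp.
Qed.

Lemma seq_measurable_cons n (f : seq R -> \bar R) :
  seq_measurable n.+1 (fun _ : unit => f) ->
  seq_measurable n (fun t s => f (t :: s)).
Proof.
move=> mf d' U p g mp mg.
rewrite (_ : (fun _ => _) = fun z =>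
    f (mkseq (fun i => (if i is j.+1 then g j else p) z) n.+1)).
  by apply: (mf _ _ (fun=> tt) (fun i => if i is j.+1 then g j else p)) => //; case.
by apply/funext => z; rewrite mkseqS.
Qed.

Lemma seq_measurable_param d (T : measurableType d) n (F : T -> seq R -> \bar R) t :
  seq_measurable n F -> seq_measurable n (fun _ : unit => F t).
Proof. by move=> mF d' U p g mp mg; apply: (mF _ _ (fun=> t)). Qed.

Lemma measurable_nth_mkseq d (T : measurableType d) (g : nat -> T -> R) n i :
  (forall i, measurable_fun setT (g i)) ->
  measurable_fun setT (fun u => (mkseq (g^~ u) n)`_i).
Proof.
move=> mg; have [ni|ni] := ltnP i n.
  rewrite (_ : (fun _ => _) = g i)//.
  by apply/funext => u; rewrite nth_mkseq.
rewrite (_ : (fun _ => _) = cst 0%R)//.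
by apply/funext => u; rewrite nth_default// size_mkseq.
Qed.

Lemma nth_nsetT n i : nth setT (nseq n (@setT R)) i = setT.
Proof. by rewrite nth_nseq if_same. Qed.

Lemma measurable_iter_integral_param d (T : measurableType d) (D : seq (set R))
    (F : T -> seq R -> \bar R) :
  (forall i, measurable (nth setT D i)) ->
  (forall t s, 0 <= F t s) -> seq_measurable (size D) F ->
  measurable_fun setT (fun t => iter_integral D (F t)).
Proof.
move=> mD F0 mF.
have := @seq_measurable_iter_integral _ T D F 0 mD F0.
rewrite addn0 => /(_ mF) h.
have := h _ T id (fun _ => cst 0%R); rewrite /mkseq/=.
have -> : (fun t => iter_integral D (F t)) =
    (fun t => iter_integral D (fun s => F t (s ++ [::]))).
  by apply/funext => t; congr iter_integral; apply/funext => s; rewrite cats0.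
by apply.
Qed.

Lemma measurable_iter_integral (D : seq (set R)) (f : seq R -> \bar R) :
  (forall i, measurable (nth setT D i)) ->
  (forall s, 0 <= f s) -> seq_measurable (size D).+1 (fun _ : unit => f) ->
  measurable_fun setT (fun t => iter_integral D (fun s => f (t :: s))).
Proof.
move=> mD f0 mf.
exact: (measurable_iter_integral_param mD (fun _ _ => f0 _) (seq_measurable_cons mf)).
Qed.

Lemma iter_integral_shift n (c : nat -> R) (f : seq R -> \bar R) :
  (forall s, 0 <= f s) -> seq_measurable n (fun _ : unit => f) ->
  iter_integral (nseq n setT) (fun s => f (mkseq (fun i => s`_i + c i)%R n)) =
  iter_integral (nseq n setT) f.
Proof.
elim: n c f => [//|n IH] c f f0 mf.
rewrite [LHS]/=.
under eq_integral do under eq_fun do rewrite mkseqS/=.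
under eq_integral => t _.
  rewrite (IH (fun i => c i.+1) (fun s => f (t + c 0%N :: s)%R))//; last first.
    exact: (seq_measurable_param _ (seq_measurable_cons mf)).
  over.
rewrite (ge0_integral_shift (c 0%N) (f := fun t => iter_integral (nseq n setT) (fun s => f (t :: s))))//.
  by apply: measurable_iter_integral => // [i|]; rewrite ?nth_nsetT ?size_nseq.
by move=> t; exact: iter_integral_ge0.
Qed.

Lemma iter_integralZl (D : seq (set R)) (c : R) (f : seq R -> \bar R) : (0 <= c)%R ->
  (forall i, measurable (nth setT D i)) ->
  (forall s, 0 <= f s) -> seq_measurable (size D) (fun _ : unit => f) ->
  iter_integral D (fun s => c%:E * f s) = c%:E * iter_integral D f.
Proof.
move=> c0; elim: D f => [//|D0 D IH] f mD f0 mf /=.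
have mD' i : measurable (nth setT D i) by exact: (mD i.+1).
under eq_integral => t _.
  rewrite IH//; last exact: (seq_measurable_param _ (seq_measurable_cons mf)).
  over.
rewrite ge0_integralZl//.
- exact: (mD 0%N).
- by apply: measurable_funTS; exact: measurable_iter_integral.
- by move=> t _; exact: iter_integral_ge0.
Qed.

Lemma ge0_tonelli d1 d2 (T1 : measurableType d1) (T2 : measurableType d2)
    (m1 : {sigma_finite_measure set T1 -> \bar R})
    (m2 : {sigma_finite_measure set T2 -> \bar R}) (D1 : set T1) (D2 : set T2)
    (f : T1 * T2 -> \bar R) :
  measurable D1 -> measurable D2 -> measurable_fun setT f -> (forall z, 0 <= f z) ->
  \int[m1]_(x in D1) \int[m2]_(y in D2) f (x, y) =
  \int[m2]_(y in D2) \int[m1]_(x in D1) f (x, y).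
Proof.
move=> mD1 mD2 mf f0.
have [m1' m1E] := restrict_measure m1 mD1; have [m2' m2E] := restrict_measure m2 mD2.
have mf1 y : measurable_fun setT (fun x => f (x, y)) by exact: measurableT_comp.
have mf2 x : measurable_fun setT (fun y => f (x, y)) by exact: measurableT_comp.
transitivity (\int[m1']_x \int[m2']_y f (x, y)).
  rewrite m1E; last 2 first.
  - by move=> x; exact: integral_ge0.
  - exact: (@measurable_fun_fubini_tonelli_F _ _ _ _ _ m2' _ mf f0).
  by apply: eq_integral => x _; rewrite m2E.
have -> : \int[m1']_x \int[m2']_y f (x, y) = \int[m2']_y \int[m1']_x f (x, y).
  exact: fubini_tonelli.
rewrite m2E; last 2 first.
- by move=> x; exact: integral_ge0.
- exact: (@measurable_fun_fubini_tonelli_G _ _ _ _ _ m1' _ mf f0).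
by apply: eq_integral => x _; rewrite m1E.
Qed.

End iter_integral.

(** * Polar coordinates *)

(** Inversion is expressed through the measurable function [powR]. The two agree on nonnegative
    reals, hence the detour through the inverse of the square, [x^-1 = x * (x ^ 2)^-1], which also
    holds at 0, where both sides vanish. *)
Lemma measurable_invr (R : realType) d (T : measurableType d) (f : T -> R) :
  measurable_fun setT f -> measurable_fun setT (fun x => (f x)^-1).
Proof.
move=> mf; rewrite (_ : (fun x => _) = fun x => f x * (f x ^+ 2) `^ (-1)).
  apply: measurable_funM => //; apply: (measurableT_comp (measurable_powR (-1))).
  exact: measurable_funX.
apply/funext => x; rewrite powR_inv1 ?sqr_ge0//.
have [->|x0] := eqVneq (f x) 0; first by rewrite invr0 mul0r.
by rewrite expr2 invfM mulrA divff// mul1r.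
Qed.

Section polar.
Context {R : realType}.
Notation mu := (@lebesgue_measure R).
Local Open Scope ereal_scope.

Lemma ge0_integral_scale_gt0 (c : R) (f : R -> \bar R) : (0 < c)%R ->
  measurable_fun setT f -> (forall x, 0 <= f x) ->
  \int[mu]_(x in `]0%R, +oo[) f x = \int[mu]_(x in `]0%R, +oo[) (f (c * x)%R * c%:E).
Proof.
move=> c0 mf f0; rewrite [LHS]integral_mkcond [RHS]integral_mkcond.
rewrite (ge0_integral_scale c0).
- apply: eq_integral => x _; rewrite !patchE.
  have -> : ((c * x)%R \in `]0%R, +oo[%classic) = (x \in `]0%R, +oo[%classic).
    by apply/idP/idP => /set_mem h; apply/mem_set; move: h;
      rewrite /= !in_itv/= !andbT pmulr_rgt0.
  by case: ifP => // _; rewrite mul0e.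
- exact/(measurable_restrictT f)/measurable_funTS.
- by move=> x; rewrite patchE; case: ifP.
Qed.

(** Two substitutions in one variable, with Tonelli in between: [x = y cot t] at fixed height [y],
    then [y = r sin t] at fixed angle [t]. The derivatives [y / sin t ^ 2] and [sin t] multiply to
    [r]. The absolute value in [|r|] keeps the integrand nonnegative for every [r], as Tonelli
    requires. *)
Lemma ge0_integral_half_plane (f : measurableTypeR R * measurableTypeR R -> \bar R) :
  measurable_fun setT f -> (forall z, 0 <= f z) ->
  \int[mu]_x \int[mu]_(y in `]0%R, +oo[) f (x, y) =
  \int[mu]_(r in `]0%R, +oo[) \int[mu]_(t in `]0%R, pi[)
    (f (r * cos t, r * sin t)%R * `|r|%:E).
Proof.
move=> mf f0.
have mitv (i : interval R) : measurable ([set` i] : set (measurableTypeR R)).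
  exact: measurable_itv.
transitivity (\int[mu]_(y in `]0%R, +oo[) \int[mu]_x f (x, y)).
  exact: (@ge0_tonelli _ _ _ _ _ mu mu _ _ f measurableT (mitv _) mf f0).
have mcos : measurable_fun setT (@cos R) by apply: continuous_measurable_fun; exact: continuous_cos.
have msin : measurable_fun setT (@sin R) by apply: continuous_measurable_fun; exact: continuous_sin.
pose g1 (z : measurableTypeR R * measurableTypeR R) :=
  f (z.1 * (cos z.2 / sin z.2), z.1)%R * (`|z.1| / sin z.2 ^+ 2)%:E.
have mcot : measurable_fun setT (fun z : measurableTypeR R * measurableTypeR R => cos z.2 / sin z.2)%R.
  apply: measurable_funM; first exact: measurableT_comp.
  by apply: measurable_invr; exact: measurableT_comp.
have mg1 : measurable_fun setT g1.
  apply: emeasurable_funM.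
    apply: measurableT_comp => //; apply: measurable_fun_pair => //.
    exact: measurable_funM.
  apply/measurable_EFinP; apply: measurable_funM; first exact: measurableT_comp.
  by apply: measurable_invr; apply: measurable_funX; exact: measurableT_comp.
have g10 z : 0 <= g1 z by rewrite mule_ge0// lee_fin divr_ge0// sqr_ge0.
pose g2 (z : measurableTypeR R * measurableTypeR R) :=
  f (z.1 * cos z.2, z.1 * sin z.2)%R * `|z.1|%:E.
have mg2 : measurable_fun setT g2.
  apply: emeasurable_funM.
    apply: measurableT_comp => //; apply: measurable_fun_pair => //;
    by apply: measurable_funM => //; exact: measurableT_comp.
  by apply/measurable_EFinP; exact: measurableT_comp.
have g20 z : 0 <= g2 z by rewrite mule_ge0// lee_fin.
transitivity (\int[mu]_(y in `]0%R, +oo[) \int[mu]_(t in `]0%R, pi[) g1 (y, t)).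
  apply: eq_integral => y /set_mem/=; rewrite in_itv/= andbT => y0.
  rewrite (ge0_integral_cot y0)//; last exact: measurableT_comp.
  by apply: eq_integral => t _; rewrite /g1/= gtr0_norm.
transitivity (\int[mu]_(t in `]0%R, pi[) \int[mu]_(y in `]0%R, +oo[) g1 (y, t)).
  exact: (@ge0_tonelli _ _ _ _ _ mu mu _ _ g1 (mitv _) (mitv _) mg1 g10).
transitivity (\int[mu]_(t in `]0%R, pi[) \int[mu]_(y in `]0%R, +oo[) g2 (y, t)); last first.
  by apply/esym; exact: (@ge0_tonelli _ _ _ _ _ mu mu _ _ g2 (mitv _) (mitv _) mg2 g20).
apply: eq_integral => t /set_mem/=; rewrite in_itv/= => t0pi.
have st : (0 < sin t)%R by exact: sin_gt0_pi.
rewrite (ge0_integral_scale_gt0 st)//; last exact: measurableT_comp.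
apply: eq_integral => r /set_mem/=; rewrite in_itv/= andbT => r0.
rewrite /g1 /g2/= -muleA -EFinM !gtr0_norm ?mulr_gt0//.
have sn0 : (sin t != 0)%R by rewrite gt_eqF.
have -> : (sin t * r * (cos t / sin t) = r * cos t)%R by field.
have -> : (sin t * r / sin t ^+ 2 * sin t = r)%R by field.
by rewrite (mulrC (sin t)).
Qed.

Let punctured (f : R -> \bar R) (a b : itv_bound R) (c : R) :
  (a <= BLeft c)%O -> (BRight c <= b)%O ->
  measurable_fun setT f -> (forall x, 0 <= f x) ->
  \int[mu]_(x in [set` Interval a b]) f x =
  \int[mu]_(x in [set` Interval a (BLeft c)]) f x +
  \int[mu]_(x in [set` Interval (BRight c) b]) f x.
Proof.
move=> ac cb mf f0.
have cb' : (BLeft c <= b)%O by apply: le_trans cb; rewrite bnd_simp.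
rewrite (itv_bndbnd_setU ac cb') ge0_integral_setU//=; last 2 first.
- exact: measurable_funTS.
- apply/disj_setPS => x [/=]; rewrite !itv_boundlr => /andP[_ +] /andP[+ _].
  by rewrite !bnd_simp => xc; rewrite leNgt xc.
by congr +%E; rewrite integral_itv_obnd_cbnd//; exact: measurable_funTS.
Qed.

Lemma ge0_integral_oppr_itv (f : R -> \bar R) (D : set R) : measurable D ->
  measurable_fun setT f -> (forall x, 0 <= f x) ->
  \int[mu]_(x in -%R @^-1` D) f (- x)%R = \int[mu]_(x in D) f x.
Proof.
move=> mD mf f0; rewrite [LHS]integral_mkcond [RHS]integral_mkcond.
rewrite -(ge0_integral_oppr (f := f \_ D)); last 2 first.
- exact/(measurable_restrictT f)/measurable_funTS.
- by move=> x; rewrite patchE; case: ifP.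
apply: eq_integral => x _; rewrite !patchE; congr (if _ then _ else _).
Qed.

Lemma ge0_integral_shift_itv (f : R -> \bar R) (D : set R) (a : R) : measurable D ->
  measurable_fun setT f -> (forall x, 0 <= f x) ->
  \int[mu]_(x in (fun x => x + a)%R @^-1` D) f (x + a)%R = \int[mu]_(x in D) f x.
Proof.
move=> mD mf f0; rewrite [LHS]integral_mkcond [RHS]integral_mkcond.
rewrite -(ge0_integral_shift a (f := f \_ D)); last 2 first.
- exact/(measurable_restrictT f)/measurable_funTS.
- by move=> x; rewrite patchE; case: ifP.
by apply: eq_integral => x _; rewrite !patchE; congr (if _ then _ else _).
Qed.

Lemma measurable_integral_param d1 d2 (T1 : measurableType d1) (T2 : measurableType d2)
    (m : {sigma_finite_measure set T2 -> \bar R}) (D : set T2) (f : T1 * T2 -> \bar R) :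
  measurable D -> measurable_fun setT f -> (forall z, 0 <= f z) ->
  measurable_fun setT (fun x => \int[m]_(y in D) f (x, y)).
Proof.
move=> mD mf f0; have [m' m'E] := restrict_measure m mD.
rewrite (_ : (fun _ => _) = fun x => \int[m']_y f (x, y)).
  exact: (@measurable_fun_fubini_tonelli_F _ _ _ _ _ m' _ mf f0).
apply/funext => x; rewrite m'E//; exact: measurableT_comp.
Qed.

(** The lower half plane is treated as the mirror image of the upper one: an angle [t] there becomes
    [2 * pi - t], which sweeps []pi, 2 * pi[]. The axis [y = 0] and the angle [pi] are dropped by
    [punctured], single points being null. *)
Lemma ge0_integral_plane (f : measurableTypeR R * measurableTypeR R -> \bar R) :
  measurable_fun setT f -> (forall z, 0 <= f z) ->
  \int[mu]_x \int[mu]_y f (x, y) =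
  \int[mu]_(r in `]0%R, +oo[) \int[mu]_(t in `]0%R, (2 * pi)%R[)
    (f (r * cos t, r * sin t)%R * `|r|%:E).
Proof.
move=> mf f0.
pose g (z : measurableTypeR R * measurableTypeR R) := f (z.1, (- z.2)%R).
have mg : measurable_fun setT g.
  apply: measurableT_comp => //; apply: measurable_fun_pair => //.
  exact: measurableT_comp.
have g0 z : 0 <= g z by exact: f0.
transitivity (\int[mu]_x (\int[mu]_(y in `]0%R, +oo[) f (x, y) +
    \int[mu]_(y in `]0%R, +oo[) g (x, y))).
  apply: eq_integral => x _; rewrite -set_itvNyy.
  have mfx : measurable_fun setT (fun y => f (x, y)) by exact: measurableT_comp.
  rewrite (@punctured _ -oo%O +oo%O 0%R)// addeC; congr +%E.
  rewrite -ge0_integral_oppr_itv//; congr (integral _ _ _).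
  by apply/seteqP; split => y /=; rewrite !in_itv/= ?andbT oppr_lt0.
have mcos : measurable_fun setT (@cos R).
  by apply: continuous_measurable_fun; exact: continuous_cos.
have msin : measurable_fun setT (@sin R).
  by apply: continuous_measurable_fun; exact: continuous_sin.
pose h1 (z : measurableTypeR R * measurableTypeR R) :=
  f (z.1 * cos z.2, z.1 * sin z.2)%R * `|z.1|%:E.
pose h2 (z : measurableTypeR R * measurableTypeR R) :=
  g (z.1 * cos z.2, z.1 * sin z.2)%R * `|z.1|%:E.
have mh (f' : measurableTypeR R * measurableTypeR R -> \bar R) : measurable_fun setT f' ->
    measurable_fun setT (fun z : measurableTypeR R * measurableTypeR R =>
      f' (z.1 * cos z.2, z.1 * sin z.2)%R * `|z.1|%:E).
  move=> mf'; apply: emeasurable_funM.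
    apply: measurableT_comp => //; apply: measurable_fun_pair => //;
    by apply: measurable_funM => //; exact: measurableT_comp.
  by apply/measurable_EFinP; exact: measurableT_comp.
have mh1 : measurable_fun setT h1 by exact: mh.
have mh2 : measurable_fun setT h2 by exact: mh.
have h10 z : 0 <= h1 z by rewrite mule_ge0 ?lee_fin.
have h20 z : 0 <= h2 z by rewrite mule_ge0 ?lee_fin.
have mitv (i : interval R) : measurable ([set` i] : set (measurableTypeR R)).
  exact: measurable_itv.
rewrite ge0_integralD//; last 4 first.
- by move=> x _; exact: integral_ge0.
- exact: (measurable_integral_param mu (mitv _) mf f0).
- by move=> x _; exact: integral_ge0.
- exact: (measurable_integral_param mu (mitv _) mg g0).
rewrite !ge0_integral_half_plane//.
rewrite -ge0_integralD//; last 4 first.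
- by move=> x _; apply: integral_ge0 => t _; rewrite mule_ge0 ?lee_fin.
- exact: measurable_funTS (measurable_integral_param mu (mitv _) mh1 h10).
- by move=> x _; apply: integral_ge0 => t _; rewrite mule_ge0 ?lee_fin.
- exact: measurable_funTS (measurable_integral_param mu (mitv _) mh2 h20).
apply: eq_integral => r /set_mem/=; rewrite in_itv/= andbT => r0.
have mh1r : measurable_fun setT (fun t => h1 (r, t)) by exact: measurableT_comp.
have pi0 := pi_gt0 R.
rewrite [RHS](@punctured (fun t => h1 (r, t)) _ _ pi)//; last first.
  by rewrite bnd_simp; lra.
congr +%E.
rewrite -(@ge0_integral_shift_itv (fun t => h1 (r, t)) _ (2 * pi)%R)//.
rewrite -ge0_integral_oppr_itv//; last 2 first.
- rewrite (_ : _ @^-1` _ = `](- pi)%R, 0%R[%classic)//.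
  by apply/seteqP; split => t /=; rewrite !in_itv/= => /andP[? ?]; apply/andP; split; lra.
- have m2 : measurable_fun setT ((fun t => h1 (r, t)) \o
      (fun x : measurableTypeR R => (x + 2 * pi)%R : measurableTypeR R)).
    by apply: measurableT_comp => //; exact: measurable_funD.
  exact: m2.
rewrite (_ : _ @^-1` _ = `]0%R, pi[%classic); last first.
  by apply/seteqP; split => t /=; rewrite !in_itv/= => /andP[? ?]; apply/andP; split; lra.
apply: eq_integral => t _; rewrite /h1/= /g/=.
by rewrite mulr_natl cosD2pi sinD2pi cosN sinN mulrN.
Qed.

End polar.

Lemma seq_measurable_comp (R : realType) d (T : measurableType d) n
    (F : T -> seq R -> \bar R) d' (U : measurableType d') (p : U -> T)
    (v : U -> seq R) :
  seq_measurable n F -> measurable_fun setT p ->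
  (forall u, size (v u) = n) -> (forall i, measurable_fun setT (fun u => (v u)`_i)) ->
  measurable_fun setT (fun u => F (p u) (v u)).
Proof.
move=> mF mp sv mv.
rewrite (_ : (fun u => _) = fun u => F (p u) (mkseq ((fun i u => (v u)`_i)^~ u) n)).
  exact: mF.
by apply/funext => u; rewrite -(sv u) mkseq_nth.
Qed.

Section spherical.
Context {R : realType}.
Notation mu := (@lebesgue_measure R).
Local Open Scope ereal_scope.

Fixpoint sph_coords (k : nat) (r : R) (v : seq R) : seq R :=
  if k is k'.+1
  then (r * cos v`_0 :: sph_coords k' (r * sin v`_0) (behead v))%R else [:: r].

(** The Jacobian of [sph_coords k] at radius 1, that is, the product of the
    [|sin v_j| ^ (k - 1 - j)]. The absolute values make it nonnegative off [sph_dom] as well; on the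
    domain they could only matter for the last angle, whose exponent is 0. *)
Fixpoint sph_weight (k : nat) (v : seq R) : R :=
  if k is k'.+1 then (`|sin v`_0| ^+ k' * sph_weight k' (behead v))%R else 1%R.

Definition sph_dom (k : nat) : seq (set R) :=
  rcons (nseq k.-1 `]0%R, pi[%classic) `]0%R, (2 * pi)%R[%classic.

Lemma size_sph_coords k r v : size (sph_coords k r v) = k.+1.
Proof. by elim: k r v => //= k IH r v; rewrite IH. Qed.

Lemma sph_weight_ge0 k v : (0 <= sph_weight k v)%R.
Proof. by elim: k v => //= k IH v; rewrite mulr_ge0// exprn_ge0. Qed.

Lemma size_sph_dom k : size (sph_dom k.+1) = k.+1.
Proof. by rewrite size_rcons size_nseq. Qed.

Lemma measurable_sph_dom k i : measurable (nth setT (sph_dom k) i).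
Proof.
rewrite nth_rcons; case: ifP => [|_]; last by case: ifP.
by rewrite size_nseq => ik; rewrite nth_nseq ik.
Qed.

Section measurability.
Context d (U : measurableType d).
Variables (r : U -> R) (v : U -> seq R).
Hypothesis mr : measurable_fun setT r.
Hypothesis mv : forall i, measurable_fun setT (fun u => (v u)`_i).

Let mcos : measurable_fun setT (@cos R).
Proof. by apply: continuous_measurable_fun; exact: continuous_cos. Qed.
Let msin : measurable_fun setT (@sin R).
Proof. by apply: continuous_measurable_fun; exact: continuous_sin. Qed.

Lemma measurable_sph_coords k i :
  measurable_fun setT (fun u => (sph_coords k (r u) (v u))`_i).
Proof.
elim: k r v mr mv i => [|k IH] r' v' mr' mv' [|i] //=.
- by apply: measurable_funM => //; exact: measurableT_comp.
- apply: IH; first by apply: measurable_funM => //; exact: measurableT_comp.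
  move=> j; rewrite (_ : (fun u => _) = fun u => (v' u)`_j.+1)//.
  by apply/funext => u; rewrite nth_behead.
Qed.

Lemma measurable_sph_weight k : measurable_fun setT (fun u => sph_weight k (v u)).
Proof.
elim: k v mv => [|k IH] v' mv' /=; first exact: measurable_cst.
apply: measurable_funM.
  by apply: measurable_funX; apply: measurableT_comp => //; exact: measurableT_comp.
apply: IH => j; rewrite (_ : (fun u => _) = fun u => (v' u)`_j.+1)//.
by apply/funext => u; rewrite nth_behead.
Qed.

End measurability.

Lemma seq_measurable_sph k n (f : seq R -> \bar R) :
  seq_measurable k.+1 (fun _ : unit => f) ->
  seq_measurable n (fun (r : measurableTypeR R) v => (`|r| ^+ k * sph_weight k v)%:E * f (sph_coords k r v)).
Proof.
move=> mf d U p g mp mg.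
have mv i : measurable_fun setT (fun u => (mkseq (g^~ u) n)`_i).
  exact: measurable_nth_mkseq.
apply: emeasurable_funM.
  apply/measurable_EFinP; apply: measurable_funM; last exact: measurable_sph_weight.
  by apply: measurable_funX; exact: measurableT_comp.
apply: (seq_measurable_comp (p := fun=> tt) mf) => //.
  by move=> u; exact: size_sph_coords.
by move=> i; exact: measurable_sph_coords.
Qed.

(** Induction on the dimension: polar coordinates of radius [rho] in all variables but the first,
    then [ge0_integral_half_plane] for the pair [(x, rho)], as [rho] is positive. With
    [rho = r sin t] the factor [rho ^ (k + 1)] splits into the power of [sin t] in [sph_weight] and
    a power of [r], to which the half plane adds one more. *)
Lemma iter_integral_polar k (f : seq R -> \bar R) :
  (forall s, 0 <= f s) -> seq_measurable k.+2 (fun _ : unit => f) ->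
  iter_integral (nseq k.+2 setT) f =
  \int[mu]_(r in `]0%R, +oo[) iter_integral (sph_dom k.+1) (fun v =>
    (`|r| ^+ k.+1 * sph_weight k.+1 v)%:E * f (sph_coords k.+1 r v)).
Proof.
elim: k f => [|k IH] f f0 mf.
  rewrite [LHS]/=.
  have mf2 : measurable_fun setT
      (fun z : measurableTypeR R * measurableTypeR R => f [:: z.1; z.2]).
    apply: (seq_measurable_comp (p := fun=> tt) (v := fun z => [:: z.1; z.2]) mf) => //.
    by case=> [|[|i]]//=; rewrite ?nth_nil//; [exact: measurable_fst|exact: measurable_snd].
  rewrite [RHS]/=; etransitivity; first exact: (ge0_integral_plane mf2 (fun _ => f0 _)).
  apply: eq_integral => r _.
  by apply: eq_integral => t _ /=; rewrite expr0 !mulr1 expr1 muleC.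
rewrite [LHS]/=.
pose F (z : measurableTypeR R * measurableTypeR R) := iter_integral (sph_dom k.+1) (fun v =>
  (`|z.2| ^+ k.+1 * sph_weight k.+1 v)%:E * f (z.1 :: sph_coords k.+1 z.2 v)).
have F0 z : 0 <= F z.
  by apply: iter_integral_ge0 => s; rewrite mule_ge0// lee_fin mulr_ge0// ?exprn_ge0// sph_weight_ge0.
have mF : measurable_fun setT F.
  apply: measurable_iter_integral_param; first exact: measurable_sph_dom.
    by move=> z s; rewrite mule_ge0// lee_fin mulr_ge0// ?exprn_ge0// sph_weight_ge0.
  rewrite size_sph_dom => d U p g mp mg.
  have mv i : measurable_fun setT (fun u => (mkseq (g^~ u) k.+1)`_i).
    exact: measurable_nth_mkseq.
  have mp2 : measurable_fun setT (fun u => (p u).2) by exact: measurableT_comp.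
  apply: emeasurable_funM.
    apply/measurable_EFinP; apply: measurable_funM; last exact: measurable_sph_weight.
    by apply: measurable_funX; exact: measurableT_comp.
  apply: (seq_measurable_comp (p := fun=> tt)
    (v := fun u => (p u).1 :: sph_coords k.+1 (p u).2 (mkseq (g^~ u) k.+1)) mf) => //.
    by move=> u; rewrite [LHS]/= size_sph_coords.
  move=> [|i]; first exact: measurableT_comp.
  exact: (measurable_sph_coords mp2 mv).
transitivity (\int[mu]_x \int[mu]_(r in `]0%R, +oo[) F (x, r)).
  apply: eq_integral => x _; apply: (IH (fun s => f (x :: s))) => //.
  exact: (seq_measurable_param _ (seq_measurable_cons mf)).
rewrite [RHS]/=; etransitivity; first exact: (ge0_integral_half_plane mF F0).
apply: eq_integral => r /set_mem/=; rewrite in_itv/= andbT => r0.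
apply: eq_integral => t /set_mem/=; rewrite in_itv/= => tpi.
have st : (0 < sin t)%R by exact: sin_gt0_pi.
rewrite /F [LHS]muleC -iter_integralZl//.
- apply: eq_iter_integral => v _ _ /=; rewrite muleA -EFinM; congr (_%:E * _).
  by rewrite normrM exprMn [(`|r| ^+ k.+2)%R]exprS !mulrA.
- exact: measurable_sph_dom.
- by move=> s; rewrite mule_ge0// lee_fin mulr_ge0// ?exprn_ge0// sph_weight_ge0.
rewrite size_sph_dom.
have mc := seq_measurable_param (r * cos t)%R (seq_measurable_cons mf).
have := @seq_measurable_sph k.+1 k.+1 _ mc.
by move=> /(seq_measurable_param (r * sin t)%R).
Qed.

End spherical.

(** * Borel sets of hyperbolic space *)

Section hyperbolic_borel.
Context {R : realType} {n : nat}.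
Notation Hn := (hyperbolic R n).

Lemma hyperbolic_inj : injective (@hyperbolic_val R n).
Proof. exact: val_inj. Qed.

Lemma hyperbolic_val_continuous : continuous (@hyperbolic_val R n).
Proof. exact: initial_continuous. Qed.

Lemma continuous_hyperbolic (T : topologicalType) (f : T -> Hn) :
  continuous (@hyperbolic_val R n \o f) -> continuous f.
Proof. exact: continuous_comp_initial. Qed.

Lemma hyperbolic_coord_continuous i : continuous (fun x : Hn => hyperbolic_val x i 0).
Proof.
move=> x; exact: (continuous_comp (@hyperbolic_val_continuous x)
  (@coord_continuous R _ _ i 0 (hyperbolic_val x))).
Qed.

Lemma continuous_hyperbolic_coord (T : topologicalType) (f : T -> Hn) :
  (forall i, continuous (fun t => hyperbolic_val (f t) i 0)) -> continuous f.
Proof.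
move=> cf; apply: continuous_hyperbolic; apply: mx_continuous => i j.
by rewrite ord1; exact: cf.
Qed.

Lemma continuous_borel_measurable (T : ptopologicalType) (f : T -> R) :
  continuous f -> measurable_fun setT (f : borel T -> R).
Proof.
move=> cf; apply: (measurability _ (RGenOpens.measurableE R)) => _ [_ [a [b ->] <-]].
by apply: sub_sigma_algebra; rewrite setTI; apply: open_comp => // x _; exact: cf.
Qed.

Lemma measurable_hyperbolic_coord i :
  measurable_fun setT (fun x : borel Hn => hyperbolic_val x i 0).
Proof. by apply: continuous_borel_measurable; exact: hyperbolic_coord_continuous. Qed.

Lemma rational_ball_cover (m : nat) (V : set 'cV[R]_m) : open V ->
  V = \bigcup_(qk in [set qk : 'cV[rat]_m * nat |
        ball (map_mx ratr qk.1 : 'cV[R]_m) qk.2.+1%:R^-1 `<=` V])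
      ball (map_mx ratr qk.1 : 'cV[R]_m) qk.2.+1%:R^-1.
Proof.
rewrite openE => oV; apply/seteqP; split; last by move=> x [qk /= sV] /sV.
move=> x /oV /nbhs_ballP[e /= e0 xeV].
have [k ke] : exists k, k.+1%:R^-1 < e / 2 :> R.
  have /ltr_add_invr[k] : 0 < e / 2 by exact: divr_gt0.
  by rewrite add0r; exists k.
have k0 : 0 < k.+1%:R^-1 :> R by rewrite invr_gt0.
have qx i : exists q : rat, ball (x i 0) k.+1%:R^-1 (ratr q).
  have [|q] := @rat_in_itvoo R (x i 0) (x i 0 + k.+1%:R^-1); first by rewrite ltrDl.
  rewrite in_itv/= => /andP[h1 h2]; exists q.
  by rewrite /ball/= ltr_distlC h2 andbT (lt_trans _ h1)// ltrBlDr ltrDl.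
(* A rational centre within [1 / (k + 1) < e / 2] of [x]: the ball of that radius about [q] contains
   [x] and lies in the ball of radius [e] about [x]. *)
pose q : 'cV[rat]_m := \col_i xchoose (qx i).
have bq : ball x k.+1%:R^-1 (map_mx ratr q : 'cV[R]_m).
  split; first by rewrite invr_gt0.
  by move=> i j; rewrite !mxE ord1; exact: (xchooseP (qx i)).
exists (q, k) => /=; last exact: ball_sym.
move=> y qy; apply: xeV; have := ball_triangle bq qy.
by apply: le_ball; rewrite [leRHS]splitr lerD// ltW.
Qed.

(** An open set is the trace of a countable union of rational boxes, and a box is a finite
    intersection of conditions on single coordinates; so Borel measurability can be tested
    coordinatewise. *)
Lemma measurable_hyperbolic d (T : measurableType d) (f : T -> borel Hn) :
  (forall i, measurable_fun setT (fun t => hyperbolic_val (f t) i 0)) ->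
  measurable_fun setT f.
Proof.
move=> mf.
have E : @measurable _ (borel Hn) = <<s (@open Hn) >> by [].
apply: (measurability _ E) => // _ [U oU <-].
rewrite setTI.
have [V oV <-] : exists2 V, open V & (@hyperbolic_val R n) @^-1` V = U by exact: oU.
rewrite (rational_ball_cover oV) -comp_preimage preimage_bigcup bigcup_mkcond.
apply: countable_bigcupT_measurable; first exact: countableP.
move=> [q k] /=; case: ifPn => // _.
rewrite [X in measurable X](_ : _ = \bigcap_(i in [set: 'I_n.+1])
    ((fun t => hyperbolic_val (f t) i 0) @^-1` ball (ratr (q i 0) : R) k.+1%:R^-1)).
  apply: fin_bigcap_measurable => // i _.
  by rewrite -[X in measurable X]setTI; apply: mf => //; exact: measurable_ball.
apply/seteqP; split => t /=.
  by move=> [_ bt] i _; have := bt i 0; rewrite mxE.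
move=> bt; split; first by rewrite invr_gt0.
by move=> i j; rewrite ord1 mxE; exact: bt.
Qed.

End hyperbolic_borel.

(** * Gauss and Bessel integrals *)

Section gaussian_bessel.
Context {R : realType}.
Notation mu := (@lebesgue_measure R).

Lemma measurable_cosh : measurable_fun setT (@cosh R).
Proof. by apply: continuous_measurable_fun; exact: continuous_cosh. Qed.

Lemma ge0_integral_gauss (b : R) : 0 < b ->
  (\int[mu]_x (expR (- (b * x ^+ 2)))%:E)%E = (Num.sqrt (pi / b))%:E.
Proof.
move=> b0; have sb0 : 0 < Num.sqrt b by rewrite sqrtr_gt0.
have mg : measurable_fun setT (fun x : R => (gauss_fun x)%:E).
  by apply/measurable_EFinP; exact: measurable_gauss_fun.
have g0 (x : R) : (0 <= (gauss_fun x)%:E)%E by rewrite lee_fin gauss_fun_ge0.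
have := @integralT_gauss R; rewrite (ge0_integral_scale sb0 mg g0).
rewrite ge0_integralZr ?lee_fin ?sqrtr_ge0//; last first.
  apply/measurable_EFinP; rewrite /gauss_fun; apply: measurableT_comp => //.
  by apply: measurableT_comp => //; apply: measurable_funX; exact: measurable_funM.
have -> : (\int[mu]_x (gauss_fun (Num.sqrt b * x))%:E =
    \int[mu]_x (expR (- (b * x ^+ 2)))%:E)%E.
  by apply: eq_integral => x _; rewrite /gauss_fun exprMn sqr_sqrtr// ltW.
move=> h; rewrite sqrtrM ?pi_ge0// sqrtrV ?ltW// EFinM -h -muleA -EFinM.
by rewrite divff ?mule1// gt_eqF.
Qed.

Lemma seq_measurable_gauss (b : R) k n : (k <= n)%N ->
  seq_measurable n (fun (_ : unit) s => (expR (- (b * \sum_(i < k) s`_i ^+ 2)))%:E).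
Proof.
move=> kn d U p g mp mg; apply/measurable_EFinP.
apply: measurableT_comp => //; apply: measurableT_comp => //.
apply: measurable_funM => //; apply: measurable_sum => i.
by apply: measurable_funX; exact: measurable_nth_mkseq.
Qed.

Lemma iter_integral_gauss (b : R) k : 0 < b ->
  iter_integral (nseq k setT)
    (fun s => (expR (- (b * \sum_(i < k) s`_i ^+ 2)))%:E) =
  (Num.sqrt (pi / b) ^+ k)%:E.
Proof.
move=> b0; elim: k => [|k IH]; first by rewrite /= big_ord0 mulr0 oppr0 expR0.
rewrite [LHS]/=.
transitivity (\int[mu]_x ((expR (- (b * x ^+ 2)))%:E * (Num.sqrt (pi / b) ^+ k)%:E))%E.
  apply: eq_integral => x _; rewrite -IH -iter_integralZl.
  - apply: eq_iter_integral => s _ _; rewrite -EFinM -expRD big_ord_recl/=.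
    by rewrite mulrDr opprD.
  - exact: expR_ge0.
  - by move=> i; rewrite nth_nsetT.
  - by move=> s; rewrite lee_fin expR_ge0.
  - by rewrite size_nseq; exact: seq_measurable_gauss.
rewrite ge0_integralZr//.
- by rewrite ge0_integral_gauss// -EFinM -exprS.
- apply/measurable_EFinP; apply: measurableT_comp => //.
  by apply: measurableT_comp => //; apply: measurable_funM => //; exact: measurable_funX.
Qed.

Lemma sinh_ge (x : R) : 0 <= x -> x <= 2 * sinh x.
Proof.
move=> x0; rewrite /sinh mulrC divfK//.
have := expR_ge1Dx x; have : expR (- x) <= 1 by rewrite -expR0 ler_expR oppr_le0.
lra.
Qed.

Lemma cosh_ge (x : R) : 1 + x ^+ 2 / 8 <= cosh x.
Proof.
wlog x0 : x / 0 <= x => [h|].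
  have [/h//|x0] := leP 0 x.
  by rewrite -coshN -sqrrN; apply: h; rewrite oppr_ge0 ltW.
(* Half-angle formula; squaring [x / 2 <= 2 * sinh (x / 2)] then yields the constant [1 / 8]. *)
have -> : cosh x = 1 + 2 * sinh (x / 2) ^+ 2.
  by rewrite {1}[x]splitr coshD -!expr2; have := cosh2_sinh2 (x / 2); lra.
have h := @sinh_ge (x / 2) _.
have {}h : x / 2 <= 2 * sinh (x / 2) by apply: h; lra.
have : (x / 2) ^+ 2 <= (2 * sinh (x / 2)) ^+ 2.
  by rewrite lerXn2r// nnegrE; [lra|apply: le_trans h; lra].
by rewrite !exprMn; lra.
Qed.

Let mbessel (k l : R) :
  measurable_fun setT (fun t : R => expR (- (k * cosh t)) * expR (l * t)).
Proof.
apply: measurable_funM; last by apply: measurableT_comp => //; exact: measurable_funM.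
apply: measurableT_comp => //; apply: measurableT_comp => //.
by apply: measurable_funM => //; exact: measurable_cosh.
Qed.

(* AM-GM: [l t <= k t^2 / 16 + 4 l^2 / k], so the integrand is below a Gaussian. *)
Lemma integral_bessel_lty (k l : R) : 0 < k ->
  (\int[mu]_t (expR (- (k * cosh t)) * expR (l * t))%:E < +oo)%E.
Proof.
move=> k0; have k16 : 0 < k / 16 by exact: divr_gt0.
have mg : measurable_fun setT (fun t : R => expR (- (k / 16 * t ^+ 2))).
  apply: measurableT_comp => //; apply: measurableT_comp => //.
  by apply: measurable_funM => //; exact: measurable_funX.
apply: (@le_lt_trans _ _ (\int[mu]_t ((expR (4 * l ^+ 2 / k))%:E *
    (expR (- (k / 16 * t ^+ 2)))%:E))%E).
  apply: ge0_le_integral => //.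
  - by apply/measurable_EFinP; exact: mbessel.
  - by apply/measurable_EFinP; exact: measurable_funM.
  move=> t _; rewrite lee_fin -!expRD ler_expR.
  have := ler_wpM2l (ltW k0) (cosh_ge t).
  have : 0 <= k / 16 * (t - 8 * l / k) ^+ 2 by rewrite mulr_ge0 ?sqr_ge0// ltW.
  have -> : k / 16 * (t - 8 * l / k) ^+ 2 = k / 16 * t ^+ 2 - l * t + 4 * l ^+ 2 / k.
    by field; rewrite gt_eqF.
  lra.
rewrite ge0_integralZl//.
- by rewrite ge0_integral_gauss// -EFinM ltry.
exact/measurable_EFinP.
Qed.

Let mbesselK (k l : R) :
  measurable_fun setT (fun t : R => expR (- (k * cosh t)) * cosh (l * t)).
Proof.
apply: measurable_funM; last first.
  by apply: (measurableT_comp measurable_cosh); exact: measurable_funM.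
apply: measurableT_comp => //; apply: measurableT_comp => //.
by apply: measurable_funM => //; exact: measurable_cosh.
Qed.

(** Folding at 0 turns [expR (l * t)] into [2 * cosh (l * t)]. The identity is kept in the extended
    reals, because [besselK_fin] draws finiteness from it. *)
Let integral_besselK_ereal (k l : R) :
  (\int[mu]_t (expR (- (k * cosh t)) * expR (l * t))%:E =
  2%:E * \int[mu]_(t in `]0%R, +oo[) (expR (- (k * cosh t)) * cosh (l * t))%:E)%E.
Proof.
pose f t := (expR (- (k * cosh t)) * expR (l * t))%:E.
have mf : measurable_fun setT f by apply/measurable_EFinP; exact: mbessel.
have f0 t : (0 <= f t)%E by rewrite lee_fin mulr_ge0 ?expR_ge0.
have -> : (\int[mu]_t f t = \int[mu]_(t in `]0%R, +oo[) f t +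
    \int[mu]_(t in `]-oo, 0%R[) f t)%E.
  rewrite -[X in (\int[_]_(_ in X) _)%E](setUv `]0%R, +oo[%classic) ge0_integral_setU//.
  - congr (_ + _)%E.
    rewrite setCitvr -integral_itv_bndo_bndc//; exact: measurable_funTS.
  - exact: measurableC.
  - by apply: measurable_funTS.
  - exact/disj_setPCl.
have -> : (\int[mu]_(t in `]-oo, 0%R[) f t = \int[mu]_(t in `]0%R, +oo[) f (- t)%R)%E.
  rewrite -(@ge0_integral_oppr_itv _ f `]-oo, 0%R[%classic)//.
  congr (integral _ _ _).
  by apply/seteqP; split => y /=; rewrite !in_itv/= ?andbT oppr_lt0.
rewrite -ge0_integralD//; last 2 first.
- exact: measurable_funTS.
- apply: measurable_funTS; apply: measurableT_comp => //.
rewrite -ge0_integralZl//.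
- apply: eq_integral => t _; rewrite /f coshN -EFinD -EFinM; congr EFin.
  by rewrite /cosh mulrN; field.
- by apply/measurable_EFinP; apply: measurable_funTS; exact: mbesselK.
- by move=> t _; rewrite lee_fin mulr_ge0 ?expR_ge0// ltW// cosh_gt0.
Qed.

Let besselK_fin (k l : R) : 0 < k ->
  (\int[mu]_(t in `]0%R, +oo[) (expR (- (k * cosh t)) * cosh (l * t))%:E =
   (besselK l k)%:E)%E.
Proof.
move=> k0; rewrite /besselK /Rintegral fineK// ge0_fin_numE; last first.
  by apply: integral_ge0 => t _; rewrite lee_fin mulr_ge0 ?expR_ge0// ltW// cosh_gt0.
have h (x : \bar R) : (2%:E * x < +oo)%E -> (x < +oo)%E.
  by case: x => [r _| |_]; rewrite ?ltry ?ltNyr// mulry gtr0_sg// mul1e.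
by have := integral_bessel_lty l k0; rewrite integral_besselK_ereal => /h.
Qed.

Lemma integral_besselK (k l : R) : 0 < k ->
  (\int[mu]_t (expR (- (k * cosh t)) * expR (l * t))%:E)%E = (2 * besselK l k)%:E.
Proof. by move=> k0; rewrite integral_besselK_ereal besselK_fin. Qed.

Lemma besselK_gt0 (k l : R) : 0 < k -> 0 < besselK l k.
Proof.
move=> k0; rewrite -lte_fin -besselK_fin//.
(* On []0, 1[] the integrand is at least a positive constant, since [cosh t <= expR 1] and
   [1 <= cosh (l * t)]. *)
apply: (@lt_le_trans _ _ (\int[mu]_(t in `]0%R, 1%R[) (expR (- (k * expR 1)) * 1)%:E)%E).
  rewrite -[X in (_ < X)%E]/(integral mu _ (cst (expR (- (k * expR 1)) * 1)%:E)).
  rewrite integral_cst//.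
  rewrite [X in (_ * X)%E](_ : _ = 1%E) ?mule1 ?lte_fin ?mulr1 ?expR_gt0//.
  by rewrite [LHS]lebesgue_measure_itv/= lte_fin ltr01 oppr0 adde0.
apply: (@le_trans _ _ (\int[mu]_(t in `]0%R, 1%R[)
    (expR (- (k * cosh t)) * cosh (l * t))%:E)%E).
  apply: ge0_le_integral => //.
  - by apply/measurable_EFinP; apply: measurable_funTS; exact: mbesselK.
  move=> t /=; rewrite in_itv/= => /andP[t0 t1].
  rewrite lee_fin ler_pM ?expR_ge0//.
    rewrite ler_expR lerN2 (ler_wpM2l (ltW k0))//.
    rewrite /cosh; have : expR (- t) <= expR t by rewrite ler_expR; lra.
    have : expR t <= expR 1 by rewrite ler_expR ltW.
    lra.
  by have := cosh_ge (l * t); have := sqr_ge0 (l * t); lra.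
apply: ge0_subset_integral => //.
- by apply/measurable_EFinP; apply: measurable_funTS; exact: mbesselK.
- by move=> t _; rewrite lee_fin mulr_ge0 ?expR_ge0// ltW// cosh_gt0.
- by move=> t /=; rewrite !in_itv/= => /andP[->].
Qed.

End gaussian_bessel.

(** * Boosts, rotations and null rotations *)

Section lform_theory.
Context {R : realType} {n : nat}.
Implicit Types (x y z p q : 'cV[R]_n.+1) (g h : 'M[R]_n.+1) (a c s t : R).

Lemma lformDr x y z : lform x (y + z) = lform x y + lform x z.
Proof.
rewrite /lform !mxE mulrDr opprD addrACA -big_split/=; congr (_ + _).
by apply: eq_bigr => i _; rewrite !mxE mulrDr.
Qed.

Lemma lformZr a x y : lform x (a *: y) = a * lform x y.
Proof.
rewrite /lform !mxE mulrDr mulrN mulrCA mulr_sumr; congr (_ + _).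
by apply: eq_bigr => i _; rewrite !mxE mulrCA.
Qed.

Lemma lformDl x y z : lform (y + z) x = lform y x + lform z x.
Proof. by rewrite lformC lformDr !(lformC x). Qed.

Lemma lformZl a x y : lform (a *: x) y = a * lform x y.
Proof. by rewrite lformC lformZr lformC. Qed.

Definition flat x : 'rV[R]_n.+1 := \row_j ((if j == ord0 then -1 else 1) * x j 0).

Definition outer p q : 'M[R]_n.+1 := p *m flat q.

Lemma outerE p q x : outer p q *m x = lform q x *: p.
Proof.
rewrite /outer -mulmxA (_ : flat q *m x = (lform q x)%:M) ?mul_mx_scalar//.
apply/matrixP => i j; rewrite !ord1 !mxE eqxx mulr1n big_ord_recl /lform !mxE/= mulN1r mulNr.
by congr (_ + _); apply: eq_bigr => k _; rewrite !mxE/= mul1r.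
Qed.

Lemma mx_act_inj g h : (forall x, g *m x = h *m x) -> g = h.
Proof.
move=> gh; apply/matrixP => i j; have := gh (e_ R j).
by rewrite -!colE => /colP/(_ i); rewrite !mxE.
Qed.

Definition isometry g := forall x y, lform (g *m x) (g *m y) = lform x y.

(** With [J] the matrix of the form, an isometry satisfies [g^T J g = J], and [\det J] is not 0. *)
Lemma isometry_det g : isometry g -> \det g ^+ 2 = 1.
Proof.
move=> ig; pose d : 'rV[R]_n.+1 := \row_j (if j == ord0 then -1 else 1).
pose J := diag_mx d.
have lE x y : lform x y = (x^T *m J *m y) 0 0.
  have -> : x^T *m J = flat x.
    by apply/rowP => j; rewrite mul_mx_diag !mxE mulrC.
  rewrite mxE big_ord_recl /lform !mxE/= mulN1r mulNr; congr (_ + _).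
  by apply: eq_bigr => k _; rewrite !mxE/= mul1r.
have gJ : g^T *m J *m g = J.
  have e (M : 'M[R]_n.+1) i j : M i j = ((e_ R i)^T *m M *m e_ R j) 0 0.
    by rewrite -mulmxA -colE trmx_delta -rowE !mxE.
  apply/matrixP => i j; rewrite e [RHS]e -lE -ig lE.
  by rewrite trmx_mul !mulmxA.
have J0 : \det J != 0.
  rewrite det_diag; apply/prodf_neq0 => i _; rewrite mxE.
  by case: ifP; rewrite ?oppr_eq0 oner_neq0.
move: gJ => /(congr1 determinant); rewrite !det_mulmx det_tr => h.
by apply: (mulIf J0); rewrite mul1r -[RHS]h expr2; ring.
Qed.

(* Each f t is a square, so that its determinant is 1 rather than -1. *)
Lemma SO01_path (f : R -> 'M[R]_n.+1) :
  continuous f -> f 0 = 1%:M -> (forall t, isometry (f t)) ->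
  (forall t, f t = f (t / 2) *m f (t / 2)) -> forall t, SO01 (f t).
Proof.
move=> cf f0 fi ff t.
have dt u : \det (f u) = 1.
  have d0 : 0 <= \det (f u) by rewrite ff det_mulmx -expr2 sqr_ge0.
  by apply/eqP; have := isometry_det (fi u) => /eqP; rewrite sqrf_eq1 => /orP[//|/eqP h]; move: d0; rewrite h; lra.
have sub : f @` setT `<=` @SO01 R n.
  apply: connected_component_max.
  - by exists 0.
  - by move=> _ [u _ <-]; split; [exact: dt|exact: fi].
  - apply: connected_continuous_connected; last exact: continuous_subspaceT.
    exact/connected_intervalP.
by apply: sub; exists t.
Qed.

Section plane.
Variables (p q : 'cV[R]_n.+1) (eps : bool).
Let e : R := (-1) ^+ eps.
Hypotheses (pp : lform p p = e) (qq : lform q q = 1) (pq : lform p q = 0).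

(** The identity on the orthogonal complement of [p] and [q]; in their plane a rotation when
    [eps = false] (with [c], [s] a cosine and a sine) and a boost when [eps = true] (with [c], [s] a
    hyperbolic cosine and sine). The sign [e] is [lform p p], so both cases are computed at once. *)
Definition plane_mx c s : 'M[R]_n.+1 :=
  1%:M + (e * (c - 1)) *: outer p p + s *: outer p q + (c - 1) *: outer q q - s *: outer q p.

Lemma plane_mxE c s x : plane_mx c s *m x =
  x + (e * (c - 1) * lform p x + s * lform q x) *: p +
  ((c - 1) * lform q x - s * lform p x) *: q.
Proof.
rewrite /plane_mx !mulmxDl mulNmx -!scalemxAl !outerE mul1mx !scalerA.
by rewrite -!scaleNr -!addrA !scalerDl -!addrA.
Qed.

Let ee : e * e = 1. Proof. by rewrite /e -expr2 sqrr_sign. Qed.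

Lemma lform_plane_p c s x :
  lform p (plane_mx c s *m x) = c * lform p x + e * s * lform q x.
Proof.
rewrite plane_mxE !lformDr !lformZr pp pq.
by move: ee; rewrite /e; case: (eps) => /=; rewrite ?expr0 ?expr1 => _; ring.
Qed.

Lemma lform_plane_q c s x :
  lform q (plane_mx c s *m x) = c * lform q x - s * lform p x.
Proof. by rewrite plane_mxE !lformDr !lformZr qq (lformC q p) pq; ring. Qed.

Lemma plane_isometry c s : c ^+ 2 + e * s ^+ 2 = 1 -> isometry (plane_mx c s).
Proof.
move=> cs x y; rewrite [X in lform _ X]plane_mxE !lformDr !lformZr.
rewrite ![lform (plane_mx _ _ *m _) _]lformC lform_plane_p lform_plane_q.
rewrite plane_mxE !lformDr !lformZr [lform y p]lformC [lform y q]lformC [lform y x]lformC.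
apply/eqP; rewrite -subr_eq0; apply/eqP.
transitivity ((c ^+ 2 + e * s ^+ 2 - 1) * (e * (lform p x * lform p y) + lform q x * lform q y)).
  by rewrite /e; case: (eps) => /=; rewrite ?expr0 ?expr1; ring.
by rewrite cs subrr mul0r.
Qed.

Lemma plane_mxM c s c' s' : plane_mx c s *m plane_mx c' s' =
  plane_mx (c * c' - e * (s * s')) (s * c' + c * s').
Proof.
apply: mx_act_inj => x; rewrite -mulmxA plane_mxE lform_plane_p lform_plane_q.
rewrite !plane_mxE -!addrA; congr (_ + _).
apply/colP => i; rewrite !mxE /e.
by case: (eps) => /=; rewrite ?expr0 ?expr1; ring.
Qed.

End plane.

Section null_rotation.
Variables (l b : 'cV[R]_n.+1).
Hypotheses (ll : lform l l = 0) (lb : lform l b = 0).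

(** The exponential of [t N] for [N x = lform b x *: l - lform l x *: b], where [N ^ 3 = 0] because
    [l] is null and orthogonal to [b]; hence a one-parameter group. *)
Definition null_mx t : 'M[R]_n.+1 :=
  1%:M - t *: outer b l + t *: outer l b - (t ^+ 2 / 2 * lform b b) *: outer l l.

Lemma null_mxE t x : null_mx t *m x = x - (t * lform l x) *: b +
  (t * lform b x - t ^+ 2 / 2 * lform b b * lform l x) *: l.
Proof.
rewrite /null_mx !mulmxDl !mulNmx -!scalemxAl !outerE mul1mx !scalerA.
by apply/colP => i; rewrite !mxE; ring.
Qed.

Lemma lform_null_l t x : lform l (null_mx t *m x) = lform l x.
Proof. by rewrite null_mxE -scaleNr !lformDr !lformZr lb ll; ring. Qed.

Lemma lform_null_b t x :
  lform b (null_mx t *m x) = lform b x - t * lform l x * lform b b.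
Proof. by rewrite null_mxE -scaleNr !lformDr !lformZr (lformC b l) lb; ring. Qed.

Lemma null_isometry t : isometry (null_mx t).
Proof.
move=> x y; rewrite [X in lform _ X]null_mxE -scaleNr !lformDr !lformZr.
rewrite ![lform (null_mx _ *m _) _]lformC lform_null_l lform_null_b.
rewrite null_mxE -scaleNr !lformDr !lformZr.
rewrite [lform y l]lformC [lform y b]lformC [lform y x]lformC.
by field.
Qed.

Lemma null_mxM s t : null_mx s *m null_mx t = null_mx (s + t).
Proof.
apply: mx_act_inj => x; rewrite -mulmxA null_mxE lform_null_l lform_null_b.
by rewrite !null_mxE; apply/colP => i; rewrite !mxE; field.
Qed.

End null_rotation.

Lemma cosh0 : cosh 0 = 1 :> R.
Proof. by rewrite /cosh oppr0 expR0; field. Qed.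

Lemma sinh0 : sinh 0 = 0 :> R.
Proof. by rewrite /sinh oppr0 subrr mul0r. Qed.

Lemma plane_mx10 p q eps : plane_mx p q eps 1 0 = 1%:M.
Proof. by rewrite /plane_mx subrr mulr0 !scale0r !addr0 subr0. Qed.

Lemma continuous_plane_mx p q eps (c s : R -> R) : continuous c -> continuous s ->
  continuous (fun t => plane_mx p q eps (c t) (s t)).
Proof.
move=> cc cs; apply: mx_continuous => i j; rewrite /plane_mx.
have -> : (fun t : R => plane_mx p q eps (c t) (s t) i j) = fun t =>
    ((i == j)%:R + ((-1) ^+ eps * (c t - 1)) * outer p p i j + s t * outer p q i j +
     (c t - 1) * outer q q i j - s t * outer q p i j).
  by apply/funext => t; rewrite !mxE.
move=> t; apply: cvgB; last by apply: cvgMr_tmp; exact: cs.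
apply: cvgD; last by apply: cvgMr_tmp; apply: cvgB; [exact: cc|exact: cvg_cst].
apply: cvgD; last by apply: cvgMr_tmp; exact: cs.
apply: cvgD; first exact: cvg_cst.
apply: cvgMr_tmp; apply: cvgMl_tmp; apply: cvgB; [exact: cc|exact: cvg_cst].
Qed.

Lemma continuous_null_mx l b : continuous (null_mx l b).
Proof.
apply: mx_continuous => i j.
have -> : (fun t : R => null_mx l b t i j) = fun t =>
    ((i == j)%:R - t * outer b l i j + t * outer l b i j
     - (t ^+ 2 / 2 * lform b b) * outer l l i j).
  by apply/funext => t; rewrite !mxE.
move=> t; apply: cvgB; last first.
  apply: cvgMr_tmp; apply: cvgMr_tmp; apply: cvgMr_tmp.
  exact: exprn_continuous.
apply: cvgD; last by apply: cvgMr_tmp; exact: cvg_id.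
by apply: cvgB; [exact: cvg_cst|apply: cvgMr_tmp; exact: cvg_id].
Qed.

Lemma boost_SO01 p q t : lform p p = -1 -> lform q q = 1 -> lform p q = 0 ->
  SO01 (plane_mx p q true (cosh t) (sinh t)).
Proof.
move=> pp qq pq; pose f u := plane_mx p q true (cosh u) (sinh u).
apply: (@SO01_path f) => [|||u].
- apply: continuous_plane_mx; [exact: continuous_cosh|exact: continuous_sinh].
- by rewrite /f cosh0 sinh0 plane_mx10.
- by move=> u; apply: plane_isometry; rewrite //= expr1; have := cosh2_sinh2 u; lra.
- rewrite /f plane_mxM// [in LHS](splitr u) coshD sinhD expr1.
  by congr plane_mx; ring.
Qed.

Lemma rotation_SO01 p q t : lform p p = 1 -> lform q q = 1 -> lform p q = 0 ->
  SO01 (plane_mx p q false (cos t) (sin t)).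
Proof.
move=> pp qq pq; pose f u := plane_mx p q false (cos u) (sin u).
apply: (@SO01_path f) => [|||u].
- apply: continuous_plane_mx; [exact: continuous_cos|exact: continuous_sin].
- by rewrite /f cos0 sin0 plane_mx10.
- by move=> u; apply: plane_isometry; rewrite //= expr0 mul1r cos2Dsin2.
- rewrite /f plane_mxM// [in LHS](splitr u) cosD sinD expr0.
  by congr plane_mx; ring.
Qed.

Lemma null_SO01 l b t : lform l l = 0 -> lform l b = 0 -> SO01 (null_mx l b t).
Proof.
move=> ll lb; apply: (@SO01_path (null_mx l b)) => [|||u].
- exact: continuous_null_mx.
- by rewrite /null_mx expr2 !mul0r !scale0r !subr0 addr0.
- exact: null_isometry.
- by rewrite null_mxM// -splitr.
Qed.

End lform_theory.

(** * The subgroup AN and its section over hyperbolic space *)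

Section horospherical_section.
Context {R : realType} {m : nat}.
Implicit Types (x y z : 'cV[R]_m.+2) (s t : R).

Definition ord1' : 'I_m.+2 := lift ord0 ord0.
Definition e0 : 'cV[R]_m.+2 := e_ R ord0.
Definition e1 : 'cV[R]_m.+2 := e_ R ord1'.
Definition nul : 'cV[R]_m.+2 := e0 - e1.
Definition ucoord x : R := x ord0 0 + x ord1' 0.
(** Deleting the coordinates 0 and 1 makes the vector orthogonal to [nul], as a null rotation
    demands; thus any vector can serve as parameter of [nrot]. *)
Definition hpart x : 'cV[R]_m.+2 := \col_i (if (i < 2)%N then 0 else x i 0).

Lemma ordP2 (P : 'I_m.+2 -> Prop) : P ord0 -> P ord1' ->
  (forall i : 'I_m, P (lift ord0 (lift ord0 i))) -> forall i, P i.
Proof.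
move=> P0 P1 P2 i; case: (unliftP ord0 i) => [j ->|->//].
by case: (unliftP ord0 j) => [k ->|->].
Qed.

Lemma lformE2 x y : lform x y = - (x ord0 0 * y ord0 0) + (x ord1' 0 * y ord1' 0 +
  \sum_(i < m) x (lift ord0 (lift ord0 i)) 0 * y (lift ord0 (lift ord0 i)) 0).
Proof. by rewrite /lform big_ord_recl. Qed.

Lemma lform_e0 x : lform e0 x = - x ord0 0.
Proof. by rewrite lform_e eqxx mulN1r. Qed.

Lemma lform_e1 x : lform e1 x = x ord1' 0.
Proof. by rewrite lform_e mul1r. Qed.

Lemma lform_nul x : lform nul x = - ucoord x.
Proof. by rewrite /nul -scaleN1r lformDl lformZl lform_e0 lform_e1 mulN1r opprD. Qed.

Lemma e0e0 : lform e0 e0 = -1 :> R.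
Proof. by rewrite lform_e0 mxE !eqxx. Qed.
Lemma e1e1 : lform e1 e1 = 1 :> R.
Proof. by rewrite lform_e1 mxE !eqxx. Qed.
Lemma e0e1 : lform e0 e1 = 0 :> R.
Proof. by rewrite lform_e0 mxE oppr0. Qed.
Lemma nulnul : lform nul nul = 0 :> R.
Proof. by rewrite lform_nul /ucoord !mxE /=; ring. Qed.
Lemma nul_hpart x : lform nul (hpart x) = 0 :> R.
Proof. by rewrite lform_nul /ucoord !mxE /=; ring. Qed.

Definition abst t : 'M[R]_m.+2 := plane_mx e0 e1 true (cosh t) (sinh t).
Definition nrot x : 'M[R]_m.+2 := null_mx nul (hpart x) 1.

Lemma abst_SO01 t : SO01 (abst t).
Proof. exact: boost_SO01 e0e0 e1e1 e0e1. Qed.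

Lemma nrot_SO01 x : SO01 (nrot x).
Proof. exact: null_SO01 nulnul (nul_hpart x). Qed.

Lemma ucoord_abst t x : ucoord (abst t *m x) = expR t * ucoord x.
Proof.
have := @lform_plane_p _ _ e0 e1 true e0e0 e0e1 (cosh t) (sinh t) x.
have := @lform_plane_q _ _ e0 e1 true e1e1 e0e1 (cosh t) (sinh t) x.
rewrite expr1 -/(abst t) !lform_e0 !lform_e1 /ucoord -cosh_sinh_expR => h1 h2.
by rewrite h1 -[(_ *m _) ord0 0]opprK h2; ring.
Qed.

Lemma abst_tail t x (i : 'I_m) :
  (abst t *m x) (lift ord0 (lift ord0 i)) 0 = x (lift ord0 (lift ord0 i)) 0.
Proof. by rewrite plane_mxE !mxE /=; ring. Qed.

Lemma ucoord_nrot b x : ucoord (nrot b *m x) = ucoord x.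
Proof.
by have := lform_null_l nulnul (nul_hpart b) 1 x; rewrite !lform_nul => /oppr_inj.
Qed.

Lemma nrot_tail b x (i : 'I_m) : (nrot b *m x) (lift ord0 (lift ord0 i)) 0 =
  x (lift ord0 (lift ord0 i)) 0 + ucoord x * b (lift ord0 (lift ord0 i)) 0.
Proof. by rewrite null_mxE lform_nul !mxE /=; ring. Qed.

Lemma hyp_ucoord_gt0 x : hyp x -> 0 < ucoord x.
Proof.
move=> [x0]; rewrite lformE2 => h.
have : 0 <= \sum_(i < m) x (lift ord0 (lift ord0 i)) 0 * x (lift ord0 (lift ord0 i)) 0.
  by apply: sumr_ge0 => i _; rewrite -expr2 sqr_ge0.
rewrite /ucoord => s0.
have : `|x ord1' 0| < x ord0 0.
  rewrite -(@ltr_pXn2r _ 2)// ?nnegrE ?ltW// real_normK ?num_real//.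
  by move: h s0; rewrite !expr2; lra.
by rewrite ltr_norml => /andP[]; lra.
Qed.

(** On the hyperboloid [(x_0 + x_1) (x_0 - x_1)] equals 1 plus the squared norm of the tail, so
    [ucoord] and the tail determine [x_0 - x_1] too. This is how points are compared in
    horospherical coordinates. *)
Lemma hyp_ext x z : hyp x -> hyp z -> ucoord x = ucoord z ->
  (forall i : 'I_m, x (lift ord0 (lift ord0 i)) 0 = z (lift ord0 (lift ord0 i)) 0) ->
  x = z.
Proof.
move=> hx hz ux yx; have u0 := hyp_ucoord_gt0 hz.
move: (hx.2) (hz.2); rewrite !lformE2 (eq_bigr _ (fun i _ => congr2 _ (yx i) (yx i))).
move: ux; rewrite /ucoord in u0 *; set S := \sum_(i < m) _ => ux h1 h2.
have e : (z ord0 0 + z ord1' 0) * (x ord0 0 - x ord1' 0) =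
         (z ord0 0 + z ord1' 0) * (z ord0 0 - z ord1' 0).
  by rewrite -{1}ux; move: h1 h2; lra.
have {}e : x ord0 0 - x ord1' 0 = z ord0 0 - z ord1' 0 by apply: (mulfI _ e); rewrite gt_eqF.
by apply/colP; apply: ordP2 => //; lra.
Qed.

(** The element of NA that sends [e_0] to [x]: the boost produces the right [ucoord] and leaves the
    tail 0, and the null rotation adds to the tail [ucoord] times its parameter, whence the division
    by [ucoord x]. *)
Definition sect x : 'M[R]_m.+2 :=
  nrot ((ucoord x)^-1 *: x) *m abst (ln (ucoord x)).

Lemma sect_SO01 x : SO01 (sect x).
Proof. by apply: SO01_M; [exact: nrot_SO01|exact: abst_SO01]. Qed.

Lemma sectE x : hyp x -> sect x *m e0 = x.
Proof.
move=> hx; have u0 := hyp_ucoord_gt0 hx.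
have u1 : ucoord e0 = 1 by rewrite /ucoord !mxE /= addr0.
apply: hyp_ext => //; first by apply: SO01_hyp; [exact: sect_SO01|exact: hyp_e0].
  by rewrite /sect -mulmxA ucoord_nrot ucoord_abst u1 mulr1 lnK.
move=> i; rewrite /sect -mulmxA nrot_tail abst_tail ucoord_abst u1 mulr1 lnK//.
by rewrite !mxE /= add0r mulrA divff ?mul1r// gt_eqF.
Qed.

End horospherical_section.

(** * Horospherical coordinates *)

Lemma continuous_borel_map (X Y : ptopologicalType) (f : X -> Y) :
  continuous f -> measurable_fun setT (f : borel X -> borel Y).
Proof.
move=> cf; have E : @measurable _ (borel Y) = <<s (@open Y) >> by [].
apply: (measurability _ E) => _ [U oU <-].
by apply: sub_sigma_algebra; rewrite setTI; apply: open_comp => // x _; exact: cf.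
Qed.

Lemma hyperbolic_act_continuous (R : realType) n (g : lorentz R n) :
  continuous (hyperbolic_act g).
Proof.
apply: continuous_hyperbolic; apply: mulmx_continuous; first exact: cst_continuous.
exact: hyperbolic_val_continuous.
Qed.

Lemma measurable_hyperbolic_act (R : realType) n (g : lorentz R n)
    (A : set (borel (hyperbolic R n))) : measurable A ->
  measurable (hyperbolic_act g @^-1` A : set (borel (hyperbolic R n))).
Proof.
move=> mA; rewrite -[X in measurable X]setTI.
exact: (continuous_borel_map (@hyperbolic_act_continuous _ _ g) measurableT mA).
Qed.

Section horospherical_chart.
Context {R : realType} {m : nat}.
Notation mu := (@lebesgue_measure R).
Notation Hn := (hyperbolic R m.+1).
Implicit Types s : seq R.

Definition horo_sq s : R := 1 + \sum_(j < m) s`_j.+1 ^+ 2.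

(** For [s = t :: y], the point with [x_0 + x_1 = e^t] and tail [y]. As [horo_sq s] is [1 + |y|^2],
    the hyperboloid equation forces [x_0 - x_1 = horo_sq s * e^(- t)]. *)
Definition horo_vec s : 'cV[R]_m.+2 := \col_i
  (if i == ord0 then (expR s`_0 + horo_sq s * expR (- s`_0)) / 2
   else if i == ord1' then (expR s`_0 - horo_sq s * expR (- s`_0)) / 2
   else s`_i.-1).

Lemma horo_vec_tail s (i : 'I_m) : horo_vec s (lift ord0 (lift ord0 i)) 0 = s`_i.+1.
Proof. by rewrite mxE. Qed.

Lemma ucoord_horo s : ucoord (horo_vec s) = expR s`_0.
Proof. by rewrite /ucoord !mxE /=; field. Qed.

Lemma horo_vec_hyp s : hyp (horo_vec s).
Proof.
have e0 := expR_gt0 s`_0; have q0 : 0 <= \sum_(j < m) s`_j.+1 ^+ 2.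
  by apply: sumr_ge0 => i _; rewrite sqr_ge0.
split.
  rewrite mxE /= divr_gt0// addr_gt0// mulr_gt0 ?expR_gt0// /horo_sq; lra.
rewrite lformE2.
rewrite (eq_bigr (fun j : 'I_m => s`_j.+1 ^+ 2)); last by move=> i _; rewrite !mxE -expr2.
by rewrite !mxE /= /horo_sq expRN; field; rewrite gt_eqF.
Qed.

Definition horo s : Hn := hyperbolic_of (horo_vec_hyp s).

Lemma horo_val s : hyperbolic_val (horo s) = horo_vec s. Proof. by []. Qed.

Lemma measurable_horo d (U : measurableType d) (g : nat -> U -> R) :
  (forall i, measurable_fun setT (g i)) ->
  measurable_fun setT (fun u => horo (mkseq (g^~ u) m.+1) : borel Hn).
Proof.
move=> mg; apply: measurable_hyperbolic => i; rewrite /=.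
have mn j := measurable_nth_mkseq m.+1 j mg.
have mq : measurable_fun setT (fun u => horo_sq (mkseq (g^~ u) m.+1)).
  apply: measurable_funD => //; apply: measurable_sum => j.
  by apply: measurable_funX.
have mE (h : R -> R) : measurable_fun setT h ->
    measurable_fun setT (fun u => h (mkseq (g^~ u) m.+1)`_0).
  by move=> mh; exact: measurableT_comp.
have mexpN : measurable_fun setT (fun u => expR (- (mkseq (g^~ u) m.+1)`_0)).
  by apply: (mE (fun x => expR (- x))); exact: measurableT_comp.
pattern i; apply: ordP2 => [||{}i].
- under eq_fun do rewrite mxE/=.
  apply: measurable_funM => //; apply: measurable_funD; first exact: (mE (@expR R)).
  exact: measurable_funM.
- under eq_fun do rewrite mxE/=.
  apply: measurable_funM => //; apply: measurable_funB; first exact: (mE (@expR R)).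
  exact: measurable_funM.
- rewrite [X in measurable_fun _ X](_ : _ = fun u => (mkseq (g^~ u) m.+1)`_i.+1)//.
  by apply/funext => u; exact: horo_vec_tail.
Qed.

Lemma seq_measurable_horo (f : borel Hn -> \bar R) : measurable_fun setT f ->
  seq_measurable m.+1 (fun _ : unit => fun s => f (horo s)).
Proof. by move=> mf d U p g mp mg; exact: (measurableT_comp mf (measurable_horo mg)). Qed.

(** [nu] is [dt dy] in the chart. It is characterized through integrals of nonnegative functions,
    since [iter_integral] is not itself a measure. *)
Definition horo_measure (nu : {measure set (borel Hn) -> \bar R}) :=
  forall f : borel Hn -> \bar R, measurable_fun setT f -> (forall x, (0 <= f x)%E) ->
    (\int[nu]_x f x)%E = iter_integral (nseq m.+1 setT) (fun s => f (horo s)).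

Lemma horo_measure_exists : exists nu, horo_measure nu.
Proof.
have [|d [T [mT [g [mg intT]]]]] := @iter_integral_measure R (nseq m.+1 setT).
  by move=> i; rewrite nth_nsetT.
rewrite size_nseq in intT.
have [nu [_ intnu]] := pushforward_measure mT (measurable_horo mg).
exists nu => f mf f0; rewrite intnu// (intT (fun s => f (horo s)))//.
exact: seq_measurable_horo.
Qed.

Section invariance.
Variable nu : {measure set (borel Hn) -> \bar R}.
Hypothesis nuE : horo_measure nu.

Definition invariant_under (g : lorentz R m.+1) :=
  forall A : set (borel Hn), measurable A -> nu (hyperbolic_act g @^-1` A) = nu A.

Lemma horo_measureE (A : set (borel Hn)) : measurable A ->
  nu A = iter_integral (nseq m.+1 setT) (fun s => (\1_A (horo s))%:E).
Proof.
move=> mA; rewrite -(nuE (f := fun x => (\1_A x)%:E)).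
- by rewrite integral_indic// setIT.
- exact/measurable_EFinP/measurable_indic.
- by move=> x; rewrite lee_fin.
Qed.

Lemma abst_invariant t : invariant_under (lorentz_of (abst_SO01 t)).
Proof.
move=> A mA; set g := lorentz_of _.
have mgA : measurable (hyperbolic_act g @^-1` A : set (borel Hn)).
  exact: measurable_hyperbolic_act.
rewrite !horo_measureE//.
rewrite -[RHS](iter_integral_shift (fun i => if i is 0%N then t else 0)); last 2 first.
- by move=> s; rewrite lee_fin.
- apply: (@seq_measurable_horo (fun x => (\1_A x)%:E)).
  exact/measurable_EFinP/measurable_indic.
apply: eq_iter_integral => s _ _; rewrite !indicE; congr (_%:R%:E).
suff -> : horo (mkseq (fun i => s`_i + (if i is 0%N then t else 0)) m.+1) =
    hyperbolic_act g (horo s).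
  by [].
apply: hyperbolic_inj; apply: hyp_ext; [exact: horo_vec_hyp|exact: hyperbolicP| |].
  by rewrite ucoord_horo hyperbolic_actE/= ucoord_abst ucoord_horo -expRD addrC.
move=> i; rewrite horo_vec_tail hyperbolic_actE/= abst_tail horo_vec_tail.
by rewrite (nth_map 0%N) ?size_iota// nth_iota// addr0.
Qed.

Lemma nrot_invariant b : invariant_under (lorentz_of (@nrot_SO01 R m b)).
Proof.
move=> A mA; set g := lorentz_of _.
have mgA : measurable (hyperbolic_act g @^-1` A : set (borel Hn)).
  exact: measurable_hyperbolic_act.
(* For a fixed first coordinate [t] the null rotation translates the remaining ones by [e^t b], so
   the inner integral alone is invariant. *)
rewrite !horo_measureE//=; apply: eq_integral => t _.
have mf : seq_measurable m.+1 (fun _ : unit => fun s => (\1_A (horo s))%:E).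
  apply: (@seq_measurable_horo (fun x => (\1_A x)%:E)).
  exact/measurable_EFinP/measurable_indic.
(* The tail of [b] starts at index 2, whence [i.+2]. *)
rewrite -[RHS](iter_integral_shift (fun i => expR t * b (inord i.+2) 0)); last 2 first.
- by move=> s; rewrite lee_fin.
- exact: (seq_measurable_param _ (seq_measurable_cons mf)).
apply: eq_iter_integral => s _ _; rewrite !indicE; congr (_%:R%:E).
set s' := mkseq _ _.
suff -> : horo (t :: s') = hyperbolic_act g (horo (t :: s)).
  by [].
apply: hyperbolic_inj; apply: hyp_ext; [exact: horo_vec_hyp|exact: hyperbolicP| |].
  by rewrite ucoord_horo hyperbolic_actE/= ucoord_nrot ucoord_horo.
move=> i; rewrite horo_vec_tail hyperbolic_actE/= nrot_tail horo_vec_tail ucoord_horo/=.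
rewrite nth_mkseq//; congr (_ + _ * b _ _).
by apply/val_inj; rewrite /= inordK// !ltnS ltn_ord.
Qed.

End invariance.
End horospherical_chart.

(** * The normalizing constant and hyperbolic-spherical coordinates *)

Section normalization.
Context {R : realType} {m : nat}.
Notation mu := (@lebesgue_measure R).
Notation Hn := (hyperbolic R m.+1).
Variable nu : {measure set (borel Hn) -> \bar R}.
Hypothesis nuE : @horo_measure R m nu.

Let half_powR (a : R) : 0 <= a -> a `^ ((m.+1%:R - 1) / 2) = Num.sqrt a ^+ m.
Proof.
move=> a0; rewrite -natr1 addrK mulrC powRrM powR12_sqrt// powR_mulrn//.
Qed.

Lemma hyperboloid_const_gt0 (k : R) : 0 < k -> 0 < hyperboloid_const m.+1 k.
Proof.
move=> k0; rewrite /hyperboloid_const divr_gt0 ?powR_gt0// mulr_gt0 ?powR_gt0//.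
  by rewrite mulr_gt0 ?pi_gt0.
by rewrite mulr_gt0// besselK_gt0.
Qed.

(** In the chart [x_0 = cosh t + e^(- t) |y|^2 / 2]. The Gaussian integral over the [m] variables
    [y] contributes [(2 pi / k)^(m / 2) e^(m t / 2)], and the last factor fixes the Bessel index
    [m / 2 = (n - 1) / 2]. *)
Lemma integral_expR_height (k : R) : 0 < k ->
  (\int[nu]_v (expR (- (k * hyperbolic_val v ord0 0)))%:E)%E =
  ((hyperboloid_const m.+1 k)^-1)%:E.
Proof.
move=> k0; rewrite nuE; last 2 first.
- apply/measurable_EFinP; apply: measurableT_comp => //; apply: measurableT_comp => //.
  by apply: measurable_funM => //; exact: measurable_hyperbolic_coord.
- by move=> v; rewrite lee_fin expR_ge0.
rewrite [LHS]/=.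
have pk0 : 0 < 2 * pi / k by rewrite divr_gt0// mulr_gt0 ?pi_gt0.
transitivity (\int[mu]_t ((Num.sqrt (2 * pi / k) ^+ m)%:E *
    (expR (- (k * cosh t)) * expR (((m.+1%:R - 1) / 2) * t))%:E))%E.
  apply: eq_integral => t _.
  have b0 : 0 < k * expR (- t) / 2 by rewrite divr_gt0// mulr_gt0 ?expR_gt0.
  have e : Num.sqrt (pi / (k * expR (- t) / 2)) = Num.sqrt (2 * pi / k) * expR (t / 2).
    have -> : pi / (k * expR (- t) / 2) = 2 * pi / k * expR (t / 2) ^+ 2.
      rewrite -expRM_natl mulrCA divff// mulr1 expRN.
      by have := expR_gt0 t => ?; field; rewrite !gt_eqF.
    by rewrite sqrtrM ?ltW// sqrtr_sqr ger0_norm ?expR_ge0.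
  transitivity ((expR (- (k * cosh t)))%:E * iter_integral (nseq m setT)
      (fun s => (expR (- (k * expR (- t) / 2 * \sum_(i < m) s`_i ^+ 2)))%:E))%E.
    rewrite -iter_integralZl.
    - apply: eq_iter_integral => s _ _; rewrite -EFinM -expRD; congr (expR _)%:E.
      rewrite mxE /= /horo_sq /= /cosh.
      by set S := \sum_(_ < _) _; field.
    - exact: expR_ge0.
    - by move=> i; rewrite nth_nsetT.
    - by move=> s; rewrite lee_fin expR_ge0.
    - by rewrite size_nseq; exact: seq_measurable_gauss.
  rewrite iter_integral_gauss// e -!EFinM exprMn mulrCA; congr (_ * (_ * _))%:E.
  by rewrite -expRM_natl -[m.+1%:R]natr1 addrK; congr expR; field.
rewrite ge0_integralZl//.
- rewrite integral_besselK// -EFinM; congr EFin.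
  rewrite /hyperboloid_const !half_powR ?ltW ?mulr_gt0 ?pi_gt0// invf_div.
  rewrite sqrtrM ?mulr_ge0 ?pi_ge0// sqrtrV ?ltW// exprMn exprVn.
  by rewrite mulrAC.
- apply/measurable_EFinP; apply: measurable_funM.
    apply: measurableT_comp => //; apply: measurableT_comp => //.
    by apply: measurable_funM => //; exact: measurable_cosh.
  by apply: measurableT_comp => //; exact: measurable_funM.
Qed.

Lemma horo_measure_setT : nu setT = +oo%E.
Proof.
rewrite (horo_measureE nuE)//.
have lT : mu setT = +oo%E by rewrite -set_itvNyy lebesgue_measure_itv.
have h k : iter_integral (nseq k.+1 (@setT R)) (fun _ => 1%E) = +oo%E.
  elim: k => [|k IH].
    rewrite [LHS]/= -[LHS]/(integral mu setT (cst 1%E)) integral_cst//.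
    by rewrite [X in (_ * X)%E]lT mul1e.
  transitivity (integral mu setT (cst +oo%E)); first by apply: eq_integral => t _; exact: IH.
  rewrite integral_cst//.
  by rewrite [X in (_ * X)%E]lT mulyy.
rewrite -[RHS](h m); apply: eq_iter_integral => s _ _.
by rewrite indicE mem_set.
Qed.

End normalization.

(** * Cartesian and hyperbolic-spherical coordinates *)

Section hyperbolic_spherical.
Context {R : realType}.
Notation mu := (@lebesgue_measure R).

Section cartesian.
Context {m : nat}.
Notation Hn := (hyperbolic R m.+1).

Definition norm2 (s : seq R) : R := \sum_(i < m.+1) s`_i ^+ 2.

Definition cart_vec (s : seq R) : 'cV[R]_m.+2 := \col_i
  (if i == ord0 then Num.sqrt (1 + norm2 s) else s`_i.-1).

Lemma norm2_ge0 s : 0 <= norm2 s.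
Proof. by apply: sumr_ge0 => i _; rewrite sqr_ge0. Qed.

Lemma cart_vec_hyp s : hyp (cart_vec s).
Proof.
have n0 := norm2_ge0 s; split.
  by rewrite mxE /= sqrtr_gt0; lra.
rewrite /lform mxE /= -expr2 sqr_sqrtr; last lra.
rewrite (eq_bigr (fun i : 'I_m.+1 => s`_i ^+ 2)).
  by rewrite -/(norm2 s); ring.
by move=> i _; rewrite !mxE /= -expr2.
Qed.

Definition cart s : Hn := hyperbolic_of (cart_vec_hyp s).

Lemma measurable_norm2 d (U : measurableType d) (v : U -> seq R) :
  (forall i, measurable_fun setT (fun u => (v u)`_i)) ->
  measurable_fun setT (fun u => norm2 (v u)).
Proof. by move=> mv; apply: measurable_sum => i; exact: measurable_funX. Qed.

Lemma measurable_sqrt_norm2 d (U : measurableType d) (v : U -> seq R) :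
  (forall i, measurable_fun setT (fun u => (v u)`_i)) ->
  measurable_fun setT (fun u => Num.sqrt (1 + norm2 (v u))).
Proof.
move=> mv; apply: (measurableT_comp (f := @Num.sqrt R)).
  by apply: continuous_measurable_fun; exact: sqrt_continuous.
by apply: measurable_funD => //; exact: measurable_norm2.
Qed.

Lemma measurable_cart d (U : measurableType d) (v : U -> seq R) :
  (forall i, measurable_fun setT (fun u => (v u)`_i)) ->
  measurable_fun setT (fun u => cart (v u) : borel Hn).
Proof.
move=> mv; apply: measurable_hyperbolic => i.
case: (unliftP ord0 i) => [j ->|->].
  rewrite [X in measurable_fun _ X](_ : _ = fun u => (v u)`_j)//.
  by apply/funext => u; rewrite /= mxE.
rewrite [X in measurable_fun _ X](_ : _ = fun u => Num.sqrt (1 + norm2 (v u))).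
  exact: measurable_sqrt_norm2.
by apply/funext => u; rewrite /= mxE.
Qed.

(** In the coordinates [x_1, ..., x_n] the invariant measure is Lebesgue measure divided by
    [x_0]. *)
Definition cart_density (A : set (borel Hn)) (s : seq R) : \bar R :=
  (\1_A (cart s) / Num.sqrt (1 + norm2 s))%:E.

Lemma cart_density_ge0 A s : (0 <= cart_density A s)%E.
Proof. by rewrite lee_fin divr_ge0// ?sqrtr_ge0// indicE. Qed.

Lemma seq_measurable_cart_density A : measurable A ->
  seq_measurable m.+1 (fun _ : unit => cart_density A).
Proof.
move=> mA d U p g mp mg.
have mn i : measurable_fun setT (fun u => (mkseq (g^~ u) m.+1)`_i).
  exact: measurable_nth_mkseq.
apply/measurable_EFinP; apply: measurable_funM.
  exact: (measurableT_comp (measurable_indic mA) (measurable_cart mn)).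
by apply: measurable_invr; exact: measurable_sqrt_norm2.
Qed.

Lemma horo_sq_gt0 (s : seq R) : 0 < horo_sq (m := m) s.
Proof. by rewrite /horo_sq ltr_pwDl// sumr_ge0// => i _; rewrite sqr_ge0. Qed.

Lemma norm2_sinh (t : R) (y : seq R) : let a := Num.sqrt (horo_sq (m := m) (t :: y)) in
  1 + norm2 (a * sinh t :: y) = (a * cosh t) ^+ 2.
Proof.
move=> a; rewrite /norm2 big_ord_recl /=.
have : a ^+ 2 = horo_sq (m := m) (t :: y) by rewrite sqr_sqrtr// ltW// horo_sq_gt0.
rewrite /horo_sq [(a * sinh t) ^+ 2]exprMn [(a * cosh t) ^+ 2]exprMn.
have := cosh2_sinh2 t => h1 h2.
have -> : cosh t ^+ 2 = 1 + sinh t ^+ 2 by lra.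
by rewrite mulrDr mulr1 {2}h2 -addrA; congr (1 + _); exact: addrC.
Qed.

(** From [x_1 = a sinh t] and [a^2 = 1 + |y|^2] follows [x_0 = a cosh t], so [x_0 + x_1 = a e^t] has
    logarithm [t + ln a]. *)
Lemma horo_cart (t : R) (y : seq R) : let a := Num.sqrt (horo_sq (m := m) (t :: y)) in
  horo (t + ln a :: y) = cart (a * sinh t :: y).
Proof.
move=> a; have a0 : 0 < a by rewrite sqrtr_gt0 horo_sq_gt0.
apply: hyperbolic_inj; apply: hyp_ext; [exact: horo_vec_hyp|exact: cart_vec_hyp| |].
  rewrite ucoord_horo /= expRD lnK ?posrE// /ucoord !mxE /= norm2_sinh.
  rewrite sqrtr_sqr ger0_norm; last by rewrite mulr_ge0 ?ltW// cosh_gt0.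
  by rewrite -cosh_sinh_expR -/a; ring.
by move=> i; rewrite horo_vec_tail mxE.
Qed.

Lemma horo_measure_cart (nu : {measure set (borel Hn) -> \bar R}) A :
  horo_measure nu -> measurable A ->
  nu A = iter_integral (nseq m.+1 setT) (cart_density A).
Proof.
move=> nuE mA; rewrite (horo_measureE nuE)//.
have mf : seq_measurable m.+1 (fun _ : unit => fun s => (\1_A (horo s))%:E : \bar R).
  apply: (@seq_measurable_horo R m (fun x => (\1_A x)%:E)).
  exact/measurable_EFinP/measurable_indic.
have mc := seq_measurable_cart_density mA.
have mT i : measurable (nth setT (nseq m (@setT R)) i) by rewrite nth_nsetT.
(* The change of variable in the first coordinate involves [a], a function of [y]; so that
   coordinate is integrated innermost, at fixed [y]. *)
rewrite [nseq m.+1 _]/= [LHS]iter_integral_swap ?size_nseq//.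
rewrite [RHS]iter_integral_swap ?size_nseq//; last by move=> s; exact: cart_density_ge0.
apply: eq_iter_integral => y; rewrite size_nseq => sy _.
(* [horo_sq] ignores the head of its argument; 0 is a placeholder. *)
pose a := Num.sqrt (horo_sq (m := m) (0 :: y)).
have a0 : 0 < a by rewrite sqrtr_gt0 horo_sq_gt0.
have my i : measurable_fun setT (fun t : measurableTypeR R => (t :: y)`_i).
  by case: i => [|i] /=.
have mfy : measurable_fun setT (fun t => (\1_A (horo (t :: y)))%:E : \bar R).
  by apply: (seq_measurable_comp (p := fun=> tt) mf) => // u; rewrite /= sy.
have mcy : measurable_fun setT (fun t => cart_density A (t :: y)).
  by apply: (seq_measurable_comp (p := fun=> tt) mc) => // u; rewrite /= sy.
(* Translation by [ln a] on one side, [x_1 = a sinh t] on the other, whose derivative [a cosh t] is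
   [x_0] and cancels the density. *)
rewrite -(ge0_integral_shift (ln a) mfy)//.
rewrite (ge0_integral_sinh a0 mcy)//; last by move=> x; exact: cart_density_ge0.
apply: eq_integral => t _; rewrite (horo_cart t y) /cart_density -EFinM; congr EFin.
rewrite (norm2_sinh t y) sqrtr_sqr ger0_norm; last by rewrite mulr_ge0 ?ltW// cosh_gt0.
by rewrite divfK// mulf_neq0 ?gt_eqF// ?cosh_gt0.
Qed.

End cartesian.

Lemma norm2_sph_coords k (r : R) v : norm2 (m := k) (sph_coords k r v) = r ^+ 2.
Proof.
rewrite /norm2; elim: k r v => [|k IH] r v; first by rewrite big_ord1.
by rewrite big_ord_recl /= IH !exprMn -mulrDr cos2Dsin2 mulr1.
Qed.

Lemma nth_sph_coords k (r : R) v i : (i <= k)%N ->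
  (sph_coords k r v)`_i =
  r * (\prod_(0 <= j < i) sin v`_j) * (if (i < k)%N then cos v`_i else 1).
Proof.
elim: k r v i => [|k IH] r v [|i] // ik.
- by rewrite big_geq// !mulr1.
- by rewrite big_geq// mulr1.
rewrite [LHS]/= IH// nth_behead ltnS [in RHS]big_nat_recl// !mulrA.
by congr (_ * _ * _); apply: eq_bigr => j _; rewrite nth_behead.
Qed.

Lemma sph_weightE k (v : seq R) :
  sph_weight k v = \prod_(0 <= j < k) `|sin v`_j| ^+ (k.-1 - j).
Proof.
elim: k v => [|k IH] v; first by rewrite big_geq.
rewrite [LHS]/= IH big_nat_recl// subn0; congr (_ * _).
by apply: eq_big_nat => j /andP[_ jk]; rewrite nth_behead -subn1 -addn1 subnDA subnAC subn1.
Qed.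

Lemma hypsph_point_cart k (u : R) v : 0 < u -> size v = k.+1 ->
  hypsph_point k.+2 (u :: v) = cart_vec (m := k.+1) (sph_coords k.+1 (sinh u) v).
Proof.
move=> u0 sv; apply/colP => i; rewrite /hypsph_point /cart_vec !mxE.
case: (unliftP ord0 i) => [j ->|->]; last first.
  by rewrite !eqxx norm2_sph_coords sqrt_cosh.
have -> : (lift ord0 j == ord0) = false by [].
rewrite -[nat_of_ord (lift ord0 j)]/(j.+1)%N -[(j.+1).-1]/(nat_of_ord j).
rewrite nth_sph_coords; last by rewrite -ltnS.
by rewrite big_add1 ltnS.
Qed.

Lemma indic_hyperbolic_val n (A : set (hyperbolic R n)) x :
  \1_(@hyperbolic_val R n @` A) (hyperbolic_val x) = \1_A x :> R.
Proof.
rewrite !indicE; congr (_%:R); congr nat_of_bool; apply/idP/idP => /set_mem h; apply/mem_set.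
  by case: h => y Ay /hyperbolic_inj <-.
by exists x.
Qed.

Lemma horo_measure_hypsph m (nu : {measure set (borel (hyperbolic R m.+1)) -> \bar R}) A :
  horo_measure nu -> measurable A -> nu A = hypsph_measure A.
Proof.
case: m nu A => [|k] nu A nuE mA.
  (* For [n = 1] both charts are the same parametrization by [t]. *)
  rewrite (horo_measureE nuE)//; apply: eq_integral => t _.
  rewrite /iter_integral /hypsph_density expr0 mul1r big_geq// mul1r; congr EFin.
  have -> : hypsph_point 1 [:: t] = hyperbolic_val (horo (m := 0) [:: t]).
    have q1 : horo_sq (m := 0) [:: t] = 1 by rewrite /horo_sq big_ord0 addr0.
    apply/colP => i; rewrite horo_val /horo_vec /hypsph_point !mxE q1 mul1r.
    case: (unliftP ord0 i) => [j ->|->//]; rewrite ord1 /=.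
    by rewrite big_geq// !mulr1.
  by rewrite indic_hyperbolic_val.
rewrite (horo_measure_cart nuE mA) iter_integral_polar; last 2 first.
- by move=> s; exact: cart_density_ge0.
- exact: seq_measurable_cart_density.
pose H r := iter_integral (sph_dom k.+1) (fun v =>
  (`|r| ^+ k.+1 * sph_weight k.+1 v)%:E * cart_density A (sph_coords k.+1 r v))%E.
have H0 r : (0 <= H r)%E.
  apply: iter_integral_ge0 => v; rewrite mule_ge0 ?cart_density_ge0// lee_fin.
  by rewrite mulr_ge0 ?exprn_ge0// sph_weight_ge0.
have mc := @seq_measurable_sph R k.+1 k.+1 _ (seq_measurable_cart_density mA).
have mH : measurable_fun setT H.
  apply: measurable_iter_integral_param; first exact: measurable_sph_dom.
    move=> r v; rewrite mule_ge0 ?cart_density_ge0// lee_fin.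
    by rewrite mulr_ge0 ?exprn_ge0// sph_weight_ge0.
  by rewrite size_sph_dom.
(* The radius is [r = sinh u]; its derivative [cosh u] will cancel the denominator, the square root
   of [1 + r^2]. *)
transitivity (\int[mu]_(u in `]0%R, +oo[) (H (sinh u) * (cosh u)%:E))%E.
  rewrite [LHS]integral_mkcond [RHS]integral_mkcond.
  rewrite (ge0_integral_sinh (a := 1))//.
  - apply: eq_integral => u _; rewrite !mul1r !patchE.
    have -> : (sinh u \in `]0%R, +oo[%classic) = (u \in `]0%R, +oo[%classic).
      by apply/idP/idP => /set_mem h; apply/mem_set; move: h;
        rewrite /= !in_itv/= !andbT sinh_gt0.
    by case: ifP => // _; rewrite mul0e.
  - exact/(measurable_restrictT H)/measurable_funTS.
  - by move=> x; rewrite patchE; case: ifP => // _; exact: H0.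
rewrite /hypsph_measure [RHS]/=.
apply: eq_integral => u /set_mem/=; rewrite in_itv/= andbT => u0.
rewrite muleC -iter_integralZl; last 4 first.
- exact/ltW/cosh_gt0.
- exact: measurable_sph_dom.
- move=> v; rewrite mule_ge0 ?cart_density_ge0// lee_fin.
  by rewrite mulr_ge0 ?exprn_ge0// sph_weight_ge0.
- by rewrite size_sph_dom; exact: (seq_measurable_param (sinh u) mc).
apply: eq_iter_integral => v; rewrite size_sph_dom => sv vdom.
have su : 0 < sinh u by rewrite sinh_gt0.
rewrite hypsph_point_cart// -!EFinM /cart_density norm2_sph_coords sqrt_cosh.
have -> : \1_(hyperbolic_val (n:=_) @` A) (cart_vec (m := k.+1) (sph_coords k.+1 (sinh u) v)) =
    \1_A (cart (m := k.+1) (sph_coords k.+1 (sinh u) v)) :> R.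
  by rewrite -(indic_hyperbolic_val A).
have -> : hypsph_density k.+2 (u :: v) = sinh u ^+ k.+1 * sph_weight k.+1 v.
  rewrite sph_weightE /hypsph_density /= big_add1 /=; congr (_ * _).
  apply: eq_big_nat => j /andP[_ jk].
  (* The last angle, which runs over []0, 2 pi[], has exponent 0; for the others the sine is
     positive and the absolute value disappears. *)
  rewrite subSS; have [->|ne0] := eqVneq (k - j)%N 0%N; first by rewrite !expr0.
  rewrite ger0_norm//.
  have jk' : (j < k)%N by rewrite -subn_gt0 lt0n.
  have := vdom j; rewrite /sph_dom nth_rcons size_nseq jk' nth_nseq jk' => /(_ jk)/=.
  by rewrite in_itv/= => v0pi; rewrite ltW// sin_gt0_pi.
rewrite ger0_norm ?ltW//; congr EFin; field; rewrite gt_eqF ?cosh_gt0//.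
Qed.

End hyperbolic_spherical.

(** * Measures with uniform balls *)

Section balls.
Context {R : realType} {m : nat}.
Notation n := m.+1.
Notation Hn := (hyperbolic R n).
Implicit Types (x y : Hn) (c : R) (g h : lorentz R n) (U V : set (borel Hn))
  (mu nu : {measure set (borel Hn) -> \bar R}).

(** The hyperbolic cosine of the distance from [x] to [y]; thus [hball x c] is an open metric ball,
    empty unless [1 < c]. *)
Definition height x y : R := - lform (hyperbolic_val x) (hyperbolic_val y).

Definition hball x c : set (borel Hn) := [set y | height x y < c].

Definition origin : Hn := hyperbolic_of (@hyp_e0 R n).

Definition hyp_section x : lorentz R n := lorentz_of (sect_SO01 (hyperbolic_val x)).

Lemma hyperbolic_actM g h x :
  hyperbolic_act (g * h)%g x = hyperbolic_act g (hyperbolic_act h x).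
Proof. by apply: hyperbolic_inj; rewrite !hyperbolic_actE -mulmxA. Qed.

Lemma hyperbolic_act1 x : hyperbolic_act (1%g : lorentz R n) x = x.
Proof. by apply: hyperbolic_inj; rewrite !hyperbolic_actE mul1mx. Qed.

Lemma hyperbolic_actK g x : hyperbolic_act g^-1%g (hyperbolic_act g x) = x.
Proof. by rewrite -hyperbolic_actM mulVg hyperbolic_act1. Qed.

Lemma hyperbolic_actKV g x : hyperbolic_act g (hyperbolic_act g^-1%g x) = x.
Proof. by rewrite -hyperbolic_actM mulgV hyperbolic_act1. Qed.

Lemma hyp_sectionE x : hyperbolic_act (hyp_section x) origin = x.
Proof. by apply: hyperbolic_inj; rewrite hyperbolic_actE; exact/sectE/hyperbolicP. Qed.

Lemma height_act g x y : height (hyperbolic_act g x) (hyperbolic_act g y) = height x y.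
Proof.
by rewrite /height !hyperbolic_actE; have [_ ->] := SO01_SO1 (lorentzP g).
Qed.

Lemma hball_act g x c : hyperbolic_act g @^-1` hball (hyperbolic_act g x) c = hball x c.
Proof. by apply/seteqP; split=> y; rewrite /hball/= height_act. Qed.

Lemma hball_sym x y c : hball x c y <-> hball y c x.
Proof. by rewrite /hball/= /height lformC. Qed.

Lemma hball_center x c : 1 < c -> hball x c x.
Proof. by move=> c1; rewrite /hball/= /height (hyperbolicP x).2 opprK. Qed.

Lemma height_origin x : height origin x = hyperbolic_val x ord0 0.
Proof. by rewrite /height lform_e0 opprK. Qed.

Lemma continuous_height x : continuous (height x).
Proof.
have -> : height x = fun y => -1 * (flat (hyperbolic_val x) *m hyperbolic_val y) 0 0.
  apply/funext => y; rewrite mulN1r; congr (- _).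
  rewrite !mxE big_ord_recl /lform !mxE/= mulN1r mulNr.
  by congr (_ + _); apply: eq_bigr => k _; rewrite !mxE/= mul1r.
have mc : continuous (fun y : Hn => flat (hyperbolic_val x) *m hyperbolic_val y).
  apply: mulmx_continuous; first exact: cst_continuous.
  exact: hyperbolic_val_continuous.
apply: scale_continuous => y.
exact: (continuous_comp (mc y) (@coord_continuous R _ _ 0 0 _)).
Qed.

Lemma open_hball x c : open (hball x c).
Proof. by apply: open_comp (@open_lt R c) => y _; exact: continuous_height. Qed.

Lemma open_measurable_borel (T : ptopologicalType) (U : set T) :
  open U -> measurable (U : set (borel T)).
Proof. exact: sub_sigma_algebra. Qed.

Lemma measurable_hball x c : measurable (hball x c).
Proof. exact: (@open_measurable_borel Hn _ (@open_hball x c)). Qed.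

Lemma measurable_height2 :
  measurable_fun setT (fun z : borel Hn * borel Hn => height z.1 z.2).
Proof.
have h1 i : measurable_fun setT (fun z : borel Hn * borel Hn => hyperbolic_val z.1 i 0).
  exact: (measurableT_comp (measurable_hyperbolic_coord i) measurable_fst).
have h2 i : measurable_fun setT (fun z : borel Hn * borel Hn => hyperbolic_val z.2 i 0).
  exact: (measurableT_comp (measurable_hyperbolic_coord i) measurable_snd).
rewrite /height; apply: measurable_funN; apply: measurable_funD.
  by apply: measurable_funN; exact: measurable_funM.
by apply: measurable_sum => i; exact: measurable_funM.
Qed.

Lemma hball_origin_sub (U : set Hn) : open U -> U origin ->
  exists2 c, 1 < c & hball origin c `<=` U.
Proof.
move=> [V oV <-] V0.
have /nbhs_ballP[e /= e0 eV] : nbhs (hyperbolic_val origin) V by exact: open_nbhs_nbhs.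
pose c := Num.sqrt (1 + (Num.min e 1) ^+ 2).
pose d := Num.min e 1; have d0 : 0 < d by rewrite lt_min e0 ltr01.
have de : d <= e by rewrite ge_min lexx.
have d1 : d <= 1 by rewrite ge_min lexx orbT.
have [x0 xx] : 0 < 1 + d /\ 1 < 1 + d ^+ 2 by rewrite ltrDl exprn_gt0//; lra.
(* If [x_0 < 1 + d^2 / 4] with [d <= 1], then every other coordinate satisfies
   [x_i^2 <= x_0^2 - 1 < d^2], and [x_0 - 1 < d]. *)
exists (1 + d ^+ 2 / 4); first by rewrite ltrDl divr_gt0// exprn_gt0.
move=> y; rewrite /hball/= height_origin => yc; apply: eV.
have [y0] := hyperbolicP y; set v := hyperbolic_val y in y0 yc *.
rewrite /lform => yy.
have S0 (i : 'I_n) : v (lift ord0 i) 0 ^+ 2 <= v ord0 0 ^+ 2 - 1.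
  have : \sum_(i < n) v (lift ord0 i) 0 * v (lift ord0 i) 0 = v ord0 0 ^+ 2 - 1 by lra.
  rewrite (bigD1 i)//= => <-; rewrite -expr2 lerDl.
  by apply: sumr_ge0 => k _; rewrite -expr2 sqr_ge0.
have v1 : 1 <= v ord0 0.
  have := S0 ord0; have := sqr_ge0 (v (lift ord0 ord0) 0) => h1 h2.
  by rewrite -(ler_pXn2r (n := 2)) ?nnegrE ?expr1n// ?(ltW y0); lra.
have h4 : d ^+ 2 <= 1 by rewrite expr_le1// ltW.
have hd : d ^+ 2 <= d by rewrite expr2 ger_pMl.
split => // i j; rewrite ord1; case: (unliftP ord0 i) => [k ->|->].
  rewrite /ball/= !mxE /= sub0r normrN; apply: lt_le_trans de.
  rewrite -(ltr_pXn2r (n := 2)) ?nnegrE ?(ltW d0)//.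
  rewrite real_normK ?num_real//; apply: le_lt_trans (S0 k) _; nra.
by rewrite /ball/= !mxE /= ler0_norm; lra.
Qed.

Lemma open_hyperbolic_act g (U : set Hn) : open U -> open (hyperbolic_act g @^-1` U).
Proof. by apply: open_comp => x _; exact: hyperbolic_act_continuous. Qed.

Lemma hball_sub (U : set Hn) x : open U -> U x -> exists2 c, 1 < c & hball x c `<=` U.
Proof.
move=> oU Ux; have := open_hyperbolic_act (hyp_section x) oU.
move=> /hball_origin_sub[|c c1 cU]; first by rewrite /= hyp_sectionE.
exists c => // y; rewrite -{1}(hyp_sectionE x) -[y](hyperbolic_actKV (hyp_section x)).
by rewrite /hball/= height_act => /cU.
Qed.

Definition ball_measure nu (c a : R) := 0 < a /\ forall x, nu (hball x c) = a%:E.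

(** Can be checked for the image of a measure under an isometry not yet known to preserve it. *)
Definition ball_uniform nu := forall c, 1 < c -> exists a, ball_measure nu c a.

Lemma hball_cover : \bigcup_k hball origin k.+1%:R = setT.
Proof.
apply/seteqP; split => // x _.
exists (Num.trunc (height origin x)) => //.
rewrite /hball/=; apply: truncnS_gt.
Qed.

Lemma hball_nondecreasing x : {homo hball x : c c' / c <= c' >-> c `<=` c'}.
Proof. by move=> c c' cc' y; rewrite /hball/= => /lt_le_trans; apply. Qed.

Lemma ball_uniform_lty nu c : ball_uniform nu -> (nu (hball origin c) < +oo)%E.
Proof.
move=> unu; have [|a [a0 ha]] := unu (Num.max c 2); first by rewrite lt_max ltr1n orbT.
apply: (@le_lt_trans _ _ (nu (hball origin (Num.max c 2)))).
  apply: le_measure; rewrite ?inE; try exact: measurable_hball.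
  by apply: hball_nondecreasing; rewrite le_max lexx.
by rewrite ha ltry.
Qed.

Lemma ball_finite_sigma_finite nu :
  (forall c, nu (hball origin c) < +oo)%E -> sigma_finite setT nu.
Proof.
move=> fnu; exists (fun k => hball origin k.+1%:R); first by rewrite hball_cover.
by move=> k; split; [exact: measurable_hball|exact: fnu].
Qed.

(* Both sides bound the measure, for the product of [nu] and [mu], of the pairs
   of points of W x U at bounded height from each other. *)
Lemma ball_measure_le mu nu (c a b : R) (U W : set (borel Hn)) :
  sigma_finite setT mu -> sigma_finite setT nu ->
  ball_measure mu c a -> ball_measure nu c b ->
  measurable U -> measurable W -> (forall x, W x -> hball x c `<=` U) ->
  (nu W * a%:E <= b%:E * mu U)%E.
Proof.
move=> /sigma_finite_measure_exists[mu' [mu'E mu'I]].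
move=> /sigma_finite_measure_exists[nu' [nu'E nu'I]].
move=> [a0 ha] [b0 hb] mU mW WU.
pose f (z : borel Hn * borel Hn) := (\1_[set z | height z.1 z.2 < c] z)%:E : \bar R.
have mB : measurable [set z : borel Hn * borel Hn | height z.1 z.2 < c].
  have := measurable_height2 measurableT (measurable_itv `]-oo, c[).
  by rewrite setTI; congr measurable; apply/seteqP; split=> z; rewrite /= in_itv.
have mf : measurable_fun setT f by exact/measurable_EFinP/measurable_indic.
have f0 z : (0 <= f z)%E by rewrite lee_fin.
have fl x : (fun y => f (x, y)) = (fun y => (\1_(hball x c) y)%:E).
  by apply/funext => y; rewrite /f !indicE; congr (_%:R%:E); apply/idP/idP => /set_mem h;
    apply/mem_set.
have fr y : (fun x => f (x, y)) = (fun x => (\1_(hball y c) x)%:E).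
  apply/funext => x; rewrite /f !indicE.
  suff -> : ((x, y) \in [set z : borel Hn * borel Hn | height z.1 z.2 < c]) =
            (x \in hball y c) by [].
  by apply/idP/idP => /set_mem h; apply/mem_set/hball_sym.
apply: (@le_trans _ _ (\int[nu']_(x in W) \int[mu']_(y in U) f (x, y))%E).
  rewrite nu'I muleC -integral_cst//; apply: ge0_le_integral => //.
  - by move=> x _; rewrite lee_fin ltW.
  - exact: (measurable_funTS (measurable_integral_param mu' mU mf f0)).
  move=> x /WU xU; rewrite fl mu'I integral_indic//; last exact: measurable_hball.
  by rewrite setIidl// ha.
rewrite ge0_tonelli// mu'I -integral_cst//; apply: ge0_le_integral => //.
- by move=> x _; exact: integral_ge0.
- pose f' (z : borel Hn * borel Hn) := f (z.2, z.1).
  have mf' : measurable_fun setT f'.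
    by apply: (measurableT_comp mf); exact: measurable_fun_pair.
  exact: (measurable_funTS (measurable_integral_param nu' mW mf' (fun=> f0 _))).
move=> y Uy; rewrite fr nu'I integral_indic//; last exact: measurable_hball.
rewrite -(hb y) le_measure// ?inE; last exact: measurable_hball.
by apply: measurableI => //; exact: measurable_hball.
Qed.

(** Erosion of [U]: the largest set that can be taken for [W] in [ball_measure_le]. *)
Definition hcore (U : set (borel Hn)) c : set (borel Hn) := [set x | hball x c `<=` U].

Lemma closed_hcore U c : closed (hcore U c : set Hn).
Proof.
rewrite -openC.
(* By symmetry of [height], [x] is outside the core exactly when it lies in a ball about a point
   outside [U]. *)
have -> : ~` (hcore U c) = \bigcup_(y in ~` U) hball y c.
  apply/seteqP; split=> [x /= /existsNP[y /not_implyP[xy Uy]]|x [y Uy yx] xU].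
    by exists y => //; exact/hball_sym.
  by apply/Uy/xU/hball_sym.
by apply: bigcup_open => y _; exact: open_hball.
Qed.

Lemma measurable_hcore U c : measurable (hcore U c).
Proof.
rewrite -[hcore U c]setCK; apply: measurableC; apply: (@open_measurable_borel Hn).
by apply: closed_openC; exact: closed_hcore.
Qed.

(** Height 1 is distance 0, so balls of these heights shrink to their centre. *)
Definition radius (k : nat) : R := 1 + k.+1%:R^-1.

Lemma radius_gt1 k : 1 < radius k. Proof. by rewrite /radius ltrDl. Qed.

Lemma hcore_bigcup U : open (U : set Hn) -> \bigcup_k hcore U (radius k) = U.
Proof.
move=> oU; apply/seteqP; split=> [x [k _ kU]|x Ux].
  by apply: kU; apply: hball_center; exact: radius_gt1.
have [c c1 cU] := hball_sub oU Ux.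
have /ltr_add_invr[k] : 0 < c - 1 by rewrite subr_gt0.
rewrite add0r => kc; exists k => // y yk; apply: cU.
by apply: hball_nondecreasing yk; rewrite /radius -lerBrDl ltW.
Qed.

Lemma hcore_nondecreasing U : nondecreasing_seq (fun k => hcore U (radius k)).
Proof.
move=> j k jk; apply/subsetPset => x xU y yk; apply: xU.
apply: hball_nondecreasing yk; rewrite lerD2l lef_pV2 ?posrE//.
by rewrite ler_nat ltnS.
Qed.

Lemma hcore_cvg nu U : open (U : set Hn) ->
  (nu (hcore U (radius k)) @[k --> \oo] --> nu U)%E.
Proof.
move=> oU; rewrite -[in X in _ --> X](hcore_bigcup oU); apply: nondecreasing_cvg_mu.
- by move=> k; exact: measurable_hcore.
- by rewrite hcore_bigcup//; exact: (@open_measurable_borel Hn).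
- exact: hcore_nondecreasing.
Qed.

(** [ball_measure_le] compares [nu] with [mu] up to a ratio of ball masses, which is not controlled
    as the radius tends to 0. When it is used for [U] one way and for [V] the other way, the masses
    [a] and [b] cancel in the product; then the cores increase to [U] and [V]. *)
Lemma ball_uniform_cross mu nu (U V : set (borel Hn)) : ball_uniform mu -> ball_uniform nu ->
  open (U : set Hn) -> open (V : set Hn) ->
  (mu U < +oo)%E -> (nu U < +oo)%E -> (mu V < +oo)%E -> (nu V < +oo)%E ->
  (nu U * mu V <= mu U * nu V)%E.
Proof.
move=> umu unu oU oV muU nuU muV nuV.
have smu := ball_finite_sigma_finite (fun c => ball_uniform_lty c umu).
have snu := ball_finite_sigma_finite (fun c => ball_uniform_lty c unu).
have mU : measurable U by exact: (@open_measurable_borel Hn).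
have mV : measurable V by exact: (@open_measurable_borel Hn).
have fin (mu' : {measure set (borel Hn) -> \bar R}) (W : set (borel Hn)) :
    (mu' W < +oo)%E -> mu' W \is a fin_num by move=> h; rewrite ge0_fin_numE.
have key k : (nu (hcore U (radius k)) * mu (hcore V (radius k)) <= mu U * nu V)%E.
  have [a amu] := umu _ (radius_gt1 k); have [b bnu] := unu _ (radius_gt1 k).
  have h1 := ball_measure_le smu snu amu bnu mU (measurable_hcore U _) (fun x => id).
  have h2 := ball_measure_le snu smu bnu amu mV (measurable_hcore V _) (fun x => id).
  case: amu bnu => a0 _ [b0 _]; have ab : 0 < a * b by exact: mulr_gt0.
  rewrite -(@lee_pmul2r _ (a * b)%:E)//.
  have a1 : (0 <= a%:E)%E by rewrite lee_fin ltW.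
  have b1 : (0 <= b%:E)%E by rewrite lee_fin ltW.
  have := lee_pmul (mule_ge0 (measure_ge0 _ _) a1) (mule_ge0 (measure_ge0 _ _) b1) h1 h2.
  by rewrite EFinM muleACA [(b%:E * _)%E]muleC [(a%:E * nu V)%E]muleC
    [leRHS]muleACA [(b%:E * _)%E]muleC.
have cvgM : (nu (hcore U (radius k)) * mu (hcore V (radius k)) @[k --> \oo] -->
    nu U * mu V)%E.
  apply: cvgeM; [|exact: hcore_cvg|exact: hcore_cvg].
  by rewrite -(fineK (fin _ _ nuU)) -(fineK (fin _ _ muV)).
rewrite -(cvg_lim _ cvgM)//; apply: lime_le; first by apply/cvg_ex; exists (nu U * mu V)%E.
exact: nearW.
Qed.

(** With [V] a fixed ball, the two cross inequalities make [mu U] a fixed multiple of [nu U] for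
    bounded open [U]. These sets form a pi-system that generates the Borel sets and contains an
    exhaustion by sets of finite measure. *)
Lemma ball_uniform_unique mu nu : ball_uniform mu -> ball_uniform nu ->
  exists2 c : R, 0 < c & forall A, measurable A -> mu A = (c%:E * nu A)%E.
Proof.
move=> umu unu.
have [|a [a0 ha]] := umu 2; first by rewrite ltr1n.
have [|b [b0 hb]] := unu 2; first by rewrite ltr1n.
exists (a / b); first exact: divr_gt0.
have c0 : 0 <= a / b by rewrite ltW// divr_gt0.
pose G : set (set (borel Hn)) := [set U | open (U : set Hn) /\ exists c, U `<=` hball origin c].
have Gm : G `<=` measurable by move=> U [oU _]; exact: (@open_measurable_borel Hn).
have GI : setI_closed G.
  by move=> U V [oU [c Uc]] [oV _]; split; [exact: openI|exists c => x [/Uc]].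
have Gsigma : @measurable _ (borel Hn) = <<s G >>.
  apply/seteqP; split; last by apply: smallest_sub => //; exact: sigma_algebra_measurable.
  apply: smallest_sub; first exact: smallest_sigma_algebra.
  move=> U oU; have -> : U = \bigcup_k (U `&` hball origin k.+1%:R).
    by rewrite -setI_bigcupr hball_cover setIT.
  apply: sigma_algebra_bigcup => k; apply: sub_sigma_algebra; split.
    by apply: openI => //; exact: open_hball.
  by exists k.+1%:R => x [].
have fin (mu' : {measure set (borel Hn) -> \bar R}) U : ball_uniform mu' -> G U -> (mu' U < +oo)%E.
  move=> umu' GU; have [oU [c Uc]] := GU; apply: le_lt_trans (ball_uniform_lty c umu').
  by apply: le_measure; rewrite ?inE//; [exact: Gm|exact: measurable_hball].
have GB c : G (hball origin c) by split; [exact: open_hball|exists c].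
move=> A mA; rewrite -[RHS]/(mscale (NngNum c0) nu A).
apply: (@measure_unique _ _ _ G (fun k => hball origin k.+1%:R)) => //.
- by rewrite hball_cover.
- move=> U GU; rewrite -[RHS]/((a / b)%:E * nu U)%E.
  have oB := open_hball origin 2.
  have h1 := ball_uniform_cross umu unu GU.1 oB (fin _ _ umu GU) (fin _ _ unu GU)
    (fin _ _ umu (GB 2)) (fin _ _ unu (GB 2)).
  have h2 := ball_uniform_cross unu umu GU.1 oB (fin _ _ unu GU) (fin _ _ umu GU)
    (fin _ _ unu (GB 2)) (fin _ _ umu (GB 2)).
  have : (mu U * b%:E = nu U * a%:E)%E by rewrite -(ha origin) -(hb origin); apply/le_anti/andP.
  have := fin _ _ umu GU; have := fin _ _ unu GU.
  rewrite -!ge0_fin_numE// => /fineK <- /fineK <-.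
  rewrite -!EFinM => -[h]; congr EFin; apply: (mulIf (lt0r_neq0 b0)).
  by rewrite h; field; rewrite lt0r_neq0.
- by move=> k; exact: fin.
Qed.

Lemma height_origin_ge1 x : 1 <= height origin x.
Proof.
rewrite height_origin; have [x0 /hyp_ge1] := hyperbolicP x.
by rewrite -[X in X <= _](expr1n _ 2) ler_pXn2r ?nnegrE// ltW.
Qed.

Lemma hyp_tail_ext (v w : 'cV[R]_n.+1) : hyp v -> hyp w ->
  (forall i, v (lift ord0 i) 0 = w (lift ord0 i) 0) -> v = w.
Proof.
move=> [v0 vv] [w0 ww] vw; apply/colP => i; case: (unliftP ord0 i) => [j ->//|->].
move: vv ww; rewrite /lform (eq_bigr _ (fun i _ => congr2 _ (vw i) (vw i))) => h1 h2.
have : (v ord0 0 - w ord0 0) * (v ord0 0 + w ord0 0) = 0 by lra.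
by move/eqP; rewrite mulf_eq0 subr_eq0 => /orP[/eqP//|/eqP]; lra.
Qed.

(** [x_0 < N] forces [|x_i| < N] for the other coordinates, so the ball lies in the image of a
    compact cube under the continuous map [cart]. *)
Lemma hball_compact N : exists2 K : set Hn, compact K & hball origin N `<=` K.
Proof.
pose f (w : 'rV[R]_n) : Hn := cart (m := m) [seq w 0 i | i <- enum 'I_n].
have nf (w : 'rV[R]_n) i : (i < n)%N -> [seq w 0 i | i <- enum 'I_n]`_i = w 0 (inord i).
  move=> ltin; rewrite (nth_map ord0) ?size_enum_ord//; congr (w _ _).
  by apply: val_inj; rewrite /= nth_enum_ord// inordK.
have cf : continuous f.
  have cw (i : 'I_n) : continuous (fun w : 'rV[R]_n => w 0 i) by exact: coord_continuous.
  apply: continuous_hyperbolic_coord => i; case: (unliftP ord0 i) => [j ->|->].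
    rewrite (_ : (fun _ => _) = fun w : 'rV[R]_n => w 0 j); first exact: cw.
    apply/funext => w; rewrite /= mxE /= nf ?ltn_ord//; congr (w 0 _); exact: inord_val.
  have cs : continuous (fun w : 'rV[R]_n => \sum_(i < n) w 0 i ^+ 2).
    apply: continuous_big => [|k _]; first exact: add_continuous.
    by move=> w; exact: (continuous_comp (g := fun t : R => t ^+ 2) (cw k w)
      (@exprn_continuous _ 2 _)).
  have cq : continuous (fun t : R => Num.sqrt (1 + t)).
    have c1 : continuous (fun t : R => 1 + t).
      by move=> t; apply: cvgD; [exact: cvg_cst|exact: cvg_id].
    by move=> t; have h := continuous_comp (c1 t) (@sqrt_continuous R (1 + t)); exact: h.
  rewrite (_ : (fun _ => _) = (fun t => Num.sqrt (1 + t)) \o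
      fun w : 'rV[R]_n => \sum_(i < n) w 0 i ^+ 2).
    by move=> w; exact: (continuous_comp (cs w) (cq _)).
  apply/funext => w; rewrite /= mxE /= /norm2; congr (Num.sqrt (1 + _)).
  by apply: eq_bigr => k _; rewrite nf// inord_val.
exists (f @` [set w : 'rV[R]_n | forall i, `[- N, N]%classic (w 0 i)]).
  apply: continuous_compact; first exact: continuous_subspaceT.
  by apply: (@rV_compact R n (fun=> `[- N, N]%classic)) => i; exact: segment_compact.
move=> x; rewrite /hball/= height_origin => xN.
exists (\row_i hyperbolic_val x (lift ord0 i) 0).
  move=> i; rewrite /= mxE in_itv/= -ler_norml.
  have := hyperbolicP x; rewrite /hyp/lform/= => -[x0 xx].
  have := height_origin_ge1 x; rewrite height_origin => x1.
  rewrite ltW//; apply: le_lt_trans xN.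
  rewrite -(ler_pXn2r (n := 2)) ?nnegrE ?(ltW x0)// real_normK ?num_real//.
  have : \sum_(i < n) hyperbolic_val x (lift ord0 i) 0 * hyperbolic_val x (lift ord0 i) 0
    = hyperbolic_val x ord0 0 ^+ 2 - 1 by lra.
  rewrite (bigD1 i)//= -expr2.
  have : 0 <= \sum_(j < n | j != i)
      hyperbolic_val x (lift ord0 j) 0 * hyperbolic_val x (lift ord0 j) 0.
    by apply: sumr_ge0 => k _; rewrite -expr2 sqr_ge0.
  set S := \sum_(_ < _ | _) _; lra.
apply: hyperbolic_inj; apply: hyp_tail_ext; [exact: cart_vec_hyp|exact: hyperbolicP|].
by move=> i; rewrite /= mxE /= nf ?ltn_ord// mxE; congr (hyperbolic_val x (lift ord0 _) 0); exact: inord_val.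
Qed.

Lemma measure_bigsetU0 d (T : measurableType d) (mu' : {measure set T -> \bar R})
    (I : Type) (s : seq I) (F : I -> set T) :
  (forall i, measurable (F i)) -> (forall i, mu' (F i) = 0%E) ->
  mu' (\big[setU/set0]_(i <- s) F i) = 0%E.
Proof.
move=> mF F0; elim: s => [|i s IH]; first by rewrite big_nil measure0.
rewrite big_cons measureU0//; exact: bigsetU_measurable.
Qed.

(** By compactness every ball about [origin] is covered by finitely many balls of height [c], all
    null. This is the source of positivity in [ball_uniform]. *)
Lemma measure_hball0 mu c : 1 < c -> (forall x, mu (hball x c) = 0%E) -> mu setT = 0%E.
Proof.
move=> c1 mu0.
have B0 N : mu (hball origin N) = 0%E.
  have [K Kc NK] := hball_compact N; move: Kc; rewrite compact_cover.
  move=> /(_ Hn setT (fun x => hball x c)) [|x _|D _ KD].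
  - by move=> x _; exact: open_hball.
  - by exists x => //; exact: hball_center.
  apply/eqP; rewrite -measure_le0 -(measure_bigsetU0 (finmap.enum_fset D) (fun x => measurable_hball x c) mu0).
  rewrite le_measure// ?inE; [exact: measurable_hball| |].
    by apply: bigsetU_measurable => x _; exact: measurable_hball.
  by rewrite -bigcup_fset; exact: (subset_trans NK).
have : (mu (hball origin k.+1%:R) @[k --> \oo] --> mu setT)%E.
  rewrite -hball_cover; apply: nondecreasing_cvg_mu.
  - by move=> k; exact: measurable_hball.
  - by rewrite hball_cover.
  - by move=> j k jk; apply/subsetPset/hball_nondecreasing; rewrite ler_nat.
by move/cvg_lim => <- //; under eq_fun do rewrite B0; rewrite lim_cst.
Qed.

(** The section moves [origin] to any point, so invariance under its values already equates the
    masses of all balls of one radius. *)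
Lemma invariant_ball_uniform mu : (forall x, invariant_under mu (hyp_section x)) ->
  (forall c, mu (hball origin c) < +oo)%E -> mu setT != 0%E -> ball_uniform mu.
Proof.
move=> imu fmu mu0 c c1.
have E x : mu (hball x c) = mu (hball origin c).
  have := imu x _ (measurable_hball (hyperbolic_act (hyp_section x) origin) c).
  by rewrite hball_act hyp_sectionE.
have fm : mu (hball origin c) \is a fin_num by rewrite ge0_fin_numE.
exists (fine (mu (hball origin c))); split; last by move=> x; rewrite fineK.
rewrite lt0r fine_ge0// andbT; apply: contra mu0 => /eqP m0; apply/eqP.
by apply: (measure_hball0 c1) => x; rewrite E -(fineK fm) m0.
Qed.

(** The indicator of the ball is at most [e^c e^(- x_0)], and the integral of [e^(- x_0)] is known,
    being the case [k = 1] of [integral_expR_height]. *)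
Lemma horo_measure_lty nu c : horo_measure nu -> (nu (hball origin c) < +oo)%E.
Proof.
move=> nuE; rewrite -[X in nu X]setIT -integral_indic//; last exact: measurable_hball.
pose f (v : borel Hn) := (expR (- (1 * hyperbolic_val v ord0 0)))%:E : \bar R.
have mf : measurable_fun setT f.
  apply/measurable_EFinP; apply: measurableT_comp => //; apply: measurable_funN.
  by apply: measurable_funM => //; exact: measurable_hyperbolic_coord.
have h : (\int[nu]_v (\1_(hball origin c) v)%:E <= \int[nu]_v ((expR c)%:E * f v))%E.
  apply: ge0_le_integral => //.
  - by apply/measurable_EFinP; apply: measurable_indic; exact: measurable_hball.
  - exact: measurable_funeM.
  move=> v _; rewrite -EFinM lee_fin -expRD indicE.
  case: (boolP (v \in hball origin c)) => [/set_mem|_]; last exact: expR_ge0.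
  rewrite /hball/= height_origin => vc.
  by rewrite mul1r -expR0 ler_expR subr_ge0 ltW.
apply: (le_lt_trans h); rewrite ge0_integralZl_EFin// ?expR_ge0//.
  by rewrite (integral_expR_height nuE ltr01) -EFinM ltry.
by move=> v _; rewrite lee_fin expR_ge0.
Qed.

Lemma hyp_section_invariant nu x : horo_measure nu -> invariant_under nu (hyp_section x).
Proof.
move=> nuE A mA.
have -> : hyp_section x = (lorentz_of (nrot_SO01 ((ucoord (hyperbolic_val x))^-1 *: hyperbolic_val x)) *
    lorentz_of (abst_SO01 (ln (ucoord (hyperbolic_val x)))))%g by exact: lorentz_inj.
rewrite -[RHS](nrot_invariant nuE ((ucoord (hyperbolic_val x))^-1 *: hyperbolic_val x))//.
rewrite -[RHS](abst_invariant nuE (ln (ucoord (hyperbolic_val x)))); last exact: measurable_hyperbolic_act.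
by congr (nu _); apply/seteqP; split => y; rewrite /= hyperbolic_actM.
Qed.

Lemma horo_ball_uniform nu : horo_measure nu -> ball_uniform nu.
Proof.
move=> nuE; apply: invariant_ball_uniform => [x|c|].
- exact: hyp_section_invariant.
- exact: horo_measure_lty.
- by rewrite (horo_measure_setT nuE).
Qed.

(** Since [g] permutes the balls of each radius, the image of [nu] under [g] has the same ball
    masses as [nu]. It is therefore a multiple [k] of [nu], and one ball shows [k = 1]. *)
Lemma horo_invariant nu g : horo_measure nu -> invariant_under nu g.
Proof.
move=> /horo_ball_uniform unu.
have [nug [nugE _]] := pushforward_measure nu
  (continuous_borel_map (@hyperbolic_act_continuous _ _ g)).
have hE x c : nug (hball x c) = nu (hball (hyperbolic_act g^-1%g x) c).
  by rewrite nugE -(hball_act g (hyperbolic_act _ _)) hyperbolic_actKV.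
have ung : ball_uniform nug.
  by move=> c /unu[a [a0 ha]]; exists a; split => // x; rewrite hE.
have [k k0 kE] := ball_uniform_unique ung unu.
have k1 : k = 1.
  have [|a [a0 ha]] := unu 2; first by rewrite ltr1n.
  have := kE _ (measurable_hball origin 2); rewrite hE !ha -EFinM => -[].
  by rewrite -{1}[a]mul1r => /(mulIf (lt0r_neq0 a0)).
by move=> A mA; have := kE A mA; rewrite nugE k1 mul1e.
Qed.

Lemma invariant_measure_unique mu nu : horo_measure nu ->
  (forall g, invariant_under mu g) ->
  (forall c, mu (hball origin c) < +oo)%E -> mu setT != 0%E ->
  exists2 k : R, 0 < k & forall A, measurable A -> mu A = (k%:E * nu A)%E.
Proof.
move=> nuE imu fmu mu0; apply: ball_uniform_unique; last exact: horo_ball_uniform.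
by apply: invariant_ball_uniform => // x; exact: imu.
Qed.

End balls.

(** * The homogeneous space G/H *)

Section real_continuity.
Context {R : realType} {T : topologicalType}.
Implicit Types f g : T -> R.

Lemma continuousDf f g : continuous f -> continuous g -> continuous (fun x => f x + g x).
Proof. by move=> cf cg x; apply: cvgD; [exact: cf|exact: cg]. Qed.

Lemma continuousNf f : continuous f -> continuous (fun x => - f x).
Proof. by move=> cf x; apply: cvgN; exact: cf. Qed.

Lemma continuousMf f g : continuous f -> continuous g -> continuous (fun x => f x * g x).
Proof. by move=> cf cg x; apply: cvgM; [exact: cf|exact: cg]. Qed.

Lemma continuousVf f : (forall x, f x != 0) -> continuous f -> continuous (fun x => (f x)^-1).
Proof. by move=> f0 cf x; apply: cvgV => //; exact: cf. Qed.

End real_continuity.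

Section identification.
Local Open Scope quotient_scope.
Context {R : realType} {m : nat}.
Notation n := m.+1.
Notation Hn := (hyperbolic R n).
Notation G := (lorentz R n).
Notation H := (@SOn R n).
Notation X := (homog H).
Implicit Types (x y : Hn) (g h : G) (q : X).

Lemma pi_homogP g h : \pi_X g = \pi_X h <-> coset_of_set H g = coset_of_set H h.
Proof.
split; first by move/eqmodP => /asboolP.
by move=> e; apply/eqmodP/asboolP.
Qed.

Lemma SOn_origin g : H g <-> hyperbolic_act g origin = origin.
Proof.
split=> [/SOnP ge|ge]; first exact: hyperbolic_inj.
by apply/SOnP; rewrite -[RHS]/(hyperbolic_val origin) -ge.
Qed.

Lemma pi_homog_origin g h : \pi_X g = \pi_X h <-> hyperbolic_act g origin = hyperbolic_act h origin.
Proof.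
have H1 : H 1%g by apply/SOn_origin; rewrite hyperbolic_act1.
split=> [/pi_homogP e|e].
  have : coset_of_set H g g by exists 1%g => //; rewrite mulg1.
  by rewrite e => -[k /SOn_origin ko <-]; rewrite hyperbolic_actM ko.
have sub g1 h1 : hyperbolic_act g1 origin = hyperbolic_act h1 origin ->
    coset_of_set H g1 `<=` coset_of_set H h1.
  move=> e1 _ [k /SOn_origin ko <-]; exists (h1^-1 * (g1 * k))%g; last by rewrite mulgA mulgV mul1g.
  by apply/SOn_origin; rewrite !hyperbolic_actM ko e1 hyperbolic_actK.
by apply/pi_homogP/seteqP; split; apply: sub.
Qed.

Lemma hyp_of_coset_pi g : hyp_of_coset (\pi_X g) = hyperbolic_act g origin.
Proof. by apply/pi_homog_origin; rewrite reprK. Qed.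

Definition coset_of_hyp x : X := \pi_X (hyp_section x).

Lemma coset_of_hypK : cancel coset_of_hyp (@hyp_of_coset R n).
Proof. by move=> x; rewrite hyp_of_coset_pi hyp_sectionE. Qed.

Lemma hyp_of_cosetK : cancel (@hyp_of_coset R n) coset_of_hyp.
Proof.
move=> q; rewrite -[q]reprK hyp_of_coset_pi /coset_of_hyp.
by apply/pi_homog_origin; rewrite hyp_sectionE.
Qed.

Lemma hyp_of_coset_bij : bijective (@hyp_of_coset R n).
Proof. by exists coset_of_hyp; [exact: hyp_of_cosetK|exact: coset_of_hypK]. Qed.

Lemma hyp_of_coset_act g q :
  hyp_of_coset (homog_act g q) = hyperbolic_act g (hyp_of_coset q).
Proof. by rewrite /homog_act hyp_of_coset_pi hyperbolic_actM. Qed.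

Lemma hyp_of_coset_continuous : continuous (@hyp_of_coset R n).
Proof.
apply/quotient_continuous.
have -> : (@hyp_of_coset R n) \o \pi_X = fun g => hyperbolic_act g origin.
  by apply/funext => g /=; rewrite hyp_of_coset_pi.
apply: continuous_hyperbolic; apply: mulmx_continuous; last exact: cst_continuous.
exact: lorentz_val_continuous.
Qed.

(** Makes [coset_of_hyp] continuous, so that the bijection from G/H is a homeomorphism by an
    explicit inverse, without an open mapping argument. *)
Lemma hyp_section_continuous : continuous (@hyp_section R m).
Proof.
have cu : continuous (fun x : Hn => ucoord (hyperbolic_val x)).
  by apply: continuousDf; exact: hyperbolic_coord_continuous.
have u0 x : ucoord (hyperbolic_val x) != 0.
  by rewrite gt_eqF// hyp_ucoord_gt0//; exact: hyperbolicP.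
apply: continuous_lorentz; apply: mulmx_continuous; last first.
  have cl : continuous (fun x : Hn => ln (ucoord (hyperbolic_val x))).
    move=> x; have cx := continuous_ln (hyp_ucoord_gt0 (hyperbolicP x)).
    have h := continuous_comp (cu x) cx; exact: h.
  have ca : continuous (@abst R m).
    by apply: continuous_plane_mx; [exact: continuous_cosh|exact: continuous_sinh].
  by move=> x; have h := continuous_comp (cl x) (ca _); exact: h.
pose b x := hpart ((ucoord (hyperbolic_val x))^-1 *: hyperbolic_val x).
have cb i : continuous (fun x => b x i 0).
  rewrite (_ : (fun _ => _) = fun x => if (i < 2)%N then 0 else
    (ucoord (hyperbolic_val x))^-1 * hyperbolic_val x i 0).
    case: (i < 2)%N; first exact: cst_continuous.
    by apply: continuousMf; [exact: continuousVf|exact: hyperbolic_coord_continuous].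
  by apply/funext => x; rewrite !mxE.
have outerij (p q : 'cV[R]_n.+1) i j :
    outer p q i j = p i 0 * ((if j == ord0 then -1 else 1) * q j 0).
  by rewrite !mxE big_ord1 !mxE.
have cs : continuous (fun x => lform (b x) (b x)).
  apply: continuousDf; first by apply: continuousNf; exact: continuousMf.
  apply: continuous_big => [|i _]; first exact: add_continuous.
  exact: continuousMf.
apply: mx_continuous => i j.
rewrite (_ : (fun _ => _) = fun x => (i == j)%:R
  - b x i 0 * ((if j == ord0 then -1 else 1) * nul j 0)
  + nul i 0 * ((if j == ord0 then -1 else 1) * b x j 0)
  - (2^-1 * lform (b x) (b x)) * (nul i 0 * ((if j == ord0 then -1 else 1) * nul j 0))); last first.
  apply/funext => x; rewrite /nrot /null_mx -/(b x).
  rewrite -!outerij; move: (outer _ nul) (outer nul (b x)) (outer nul nul) => A B C.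
  by rewrite !mxE; field.
have cc (c : R) : continuous (fun _ : Hn => c) by exact: cst_continuous.
apply: continuousDf; last first.
  by apply: continuousNf; apply: continuousMf => //; exact: continuousMf.
apply: continuousDf; last by apply: continuousMf => //; exact: continuousMf.
by apply: continuousDf => //; apply: continuousNf; exact: continuousMf.
Qed.

Lemma coset_of_hyp_continuous : continuous coset_of_hyp.
Proof.
move=> x; apply: continuous_comp; first exact: hyp_section_continuous.
exact: pi_continuous.
Qed.

Lemma hyp_of_coset_open (U : set X) : open U -> open (@hyp_of_coset R n @` U).
Proof.
move=> oU; rewrite (_ : _ @` U = coset_of_hyp @^-1` U).
  by apply: open_comp => // x _; exact: coset_of_hyp_continuous.
apply/seteqP; split=> [_ [q Uq <-]|x Ux]; first by rewrite /= hyp_of_cosetK.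
by exists (coset_of_hyp x) => //; rewrite coset_of_hypK.
Qed.

End identification.

(** * Regularity of Borel measures *)

Section regularity.
Context {R : realType} {T : ptopologicalType}.
Hypothesis open_closed_union : forall U : set T, open U -> exists F : nat -> set T,
  [/\ forall k, closed (F k), nondecreasing_seq F & \bigcup_k F k = U].
Implicit Types (mu : {measure set (borel T) -> \bar R}) (A U C K : set T).

Let mopen U : open U -> measurable (U : set (borel T)).
Proof. exact: sub_sigma_algebra. Qed.

Let mclosed C : closed C -> measurable (C : set (borel T)).
Proof. by move=> cC; rewrite -[C]setCK; apply: measurableC; by apply: mopen; exact: closed_openC. Qed.

Lemma nonincreasing_measure_lt mu (F : nat -> set (borel T)) (e : \bar R) :
  (forall k, measurable (F k)) -> (mu setT < +oo)%E -> nonincreasing_seq F ->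
  (mu (\bigcap_k F k) < e)%E -> exists k, (mu (F k) < e)%E.
Proof.
move=> mF muT niF; apply: contraPP => /forallNP h; apply/negP; rewrite -leNgt.
have cv : (mu (F k) @[k --> \oo] --> mu (\bigcap_k F k))%E.
  apply: nonincreasing_cvg_mu => //; last exact: bigcapT_measurable.
  by apply: le_lt_trans muT; apply: le_measure; rewrite ?inE.
rewrite -(cvg_lim _ cv)//; apply: lime_ge; first by apply/cvg_ex; exists (mu (\bigcap_k F k)).
by apply: nearW => k; rewrite leNgt; apply/negP/h.
Qed.

(** Approximation by closed sets from inside and by open sets from outside at once: symmetric under
    complement, which suits an induction over the Borel sets. *)
Definition squeezed mu A := forall e : R, 0 < e -> exists U C,
  [/\ open U, closed C, C `<=` A, A `<=` U & (mu (U `\` C) < e%:E)%E].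

Lemma squeezed_open mu U : (mu setT < +oo)%E -> open U -> squeezed mu U.
Proof.
move=> muT oU e e0; have [F [cF ndF FU]] := open_closed_union oU.
have mF k : measurable (F k : set (borel T)) by exact: mclosed.
have mUF k : measurable (U `\` F k : set (borel T)) by apply: measurableD => //; exact: mopen.
have cap0 : \bigcap_k (U `\` F k) = set0.
  rewrite -subset0 => x h; have [Ux _] := h 0%N I.
  by move: Ux; rewrite -FU => -[k _ Fx]; have [_] := h k I; apply.
have [||k Hk] := nonincreasing_measure_lt (e := e%:E) mUF muT.
- by move=> j k jk; apply/subsetPset; apply: setDS; apply/subsetPset; exact: ndF.
- by rewrite cap0 measure0 lte_fin.
- exists U, (F k); split => //.
  by rewrite -FU; exact: bigcup_sup.
Qed.

Lemma squeezedC mu A : squeezed mu A -> squeezed mu (~` A).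
Proof.
move=> sA e /sA[U [C [oU cC CA AU UC]]]; exists (~` C), (~` U).
split; [exact: closed_openC|exact: open_closedC|exact: subsetC|exact: subsetC|].
by rewrite setDE setCK setIC -setDE.
Qed.

(** An infinite union of closed sets need not be closed, so the inner sets are the finite unions
    [C k]. The differences of [U] and [C k] decrease to a set covered by all the small pieces, hence
    of measure at most [e / 2]; the other half leaves room for a strict inequality at some finite
    [k]. *)
Lemma squeezed_bigcup mu (A : nat -> set T) : (mu setT < +oo)%E ->
  (forall k, squeezed mu (A k)) -> squeezed mu (\bigcup_k A k).
Proof.
move=> muT sA e e0.
have e2 k : 0 < (e / 2) / (2 ^ k.+1)%:R by rewrite divr_gt0 ?divr_gt0// ltr0n expn_gt0.
have /choice[UC hUC] : forall k, exists UC : set T * set T,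
    [/\ open UC.1, closed UC.2, UC.2 `<=` A k, A k `<=` UC.1 &
      (mu (UC.1 `\` UC.2) < ((e / 2) / (2 ^ k.+1)%:R)%:E)%E].
  by move=> k; have [U [C h]] := sA k _ (e2 k); exists (U, C).
pose U := \bigcup_k (UC k).1; pose C k := \bigcup_(j in `I_k) (UC j).2.
have oU : open U by apply: bigcup_open => k _; case: (hUC k).
have cC k : closed (C k).
  by apply: closed_bigcup => [|j _]; [exact: finite_II|case: (hUC j)].
have ndC : nondecreasing_seq C.
  by move=> j k jk; apply/subsetPset; apply: bigcup_subset => i /= /leq_trans; apply.
have CA k : C k `<=` \bigcup_k A k.
  by move=> x [j _ Cx]; exists j => //; have [_ _ CA _ _] := hUC j; exact: CA.
have mUC k : measurable (U `\` C k : set (borel T)).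
  by apply: measurableD; [exact: mopen|exact: mclosed].
have mUCk k : measurable ((UC k).1 `\` (UC k).2 : set (borel T)).
  by have [oUk cCk _ _ _] := hUC k; apply: measurableD; [exact: mopen|exact: mclosed].
have capE : \bigcap_k (U `\` C k) `<=` \bigcup_k ((UC k).1 `\` (UC k).2).
  move=> x h; have [[k _ Ux] _] := h 0%N I; exists k => //; split => // Cx.
  have [_] := h k.+1 I; by apply; exists k => //=.
have mcap : measurable (\bigcap_k (U `\` C k) : set (borel T)) by exact: bigcapT_measurable.
have small : (mu (\bigcap_k (U `\` C k)) < e%:E)%E.
  apply: (@le_lt_trans _ _ (e / 2)%:E); last by rewrite lte_fin; lra.
  apply: (le_trans _ (epsilon_trick0 xpredT _)); last by rewrite divr_ge0// ltW.
  apply: (@le_trans _ _ (\sum_(k <oo) mu ((UC k).1 `\` (UC k).2))%E).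
    exact: measure_sigma_subadditive.
  by apply: lee_nneseries => // k _; apply: ltW; case: (hUC k).
have [|k Hk] := nonincreasing_measure_lt mUC muT _ small.
  by move=> j k jk; apply/subsetPset; apply: setDS; apply/subsetPset; exact: ndC.
exists U, (C k); split => //.
by apply: subset_bigcup => j _; case: (hUC j).
Qed.

(** The squeezed sets form a sigma-algebra that contains the open sets. *)
Lemma finite_squeezed mu A : (mu setT < +oo)%E ->
  measurable (A : set (borel T)) -> squeezed mu A.
Proof.
move=> muT; move: A; apply: smallest_sub; last by move=> U; exact: squeezed_open.
split; first by have := squeezed_open muT openT; move=> /squeezedC; rewrite setCT.
  by move=> A sA; rewrite setTD; exact: squeezedC.
by move=> F; exact: squeezed_bigcup.
Qed.

(** [finite_squeezed] needs a finite measure, so it is applied to [mu] restricted to each [B k],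
    with error [e / 2^(k + 1)], and the open sets obtained are glued in [V]; this is outer
    regularity. Inner regularity of an open set is continuity from below along the compact sets that
    exhaust it. *)
Lemma radon_of_exhaustion mu (B : nat -> set T) :
  (forall k, open (B k)) -> nondecreasing_seq B -> \bigcup_k B k = setT ->
  (forall k, mu (B k) < +oo)%E ->
  (forall K, compact K -> closed K) ->
  (forall U, open U -> exists F : nat -> set T,
    [/\ forall k, compact (F k), nondecreasing_seq F & \bigcup_k F k = U]) ->
  radon mu.
Proof.
move=> oB ndB BT muB cpt_closed sigma_cpt; split.
- move=> K Kc; have mK : measurable (K : set (borel T)) by apply: mclosed; exact: cpt_closed.
  have [k KB] : exists k, K `<=` B k.
    move: Kc; rewrite compact_cover => /(_ nat setT B) [//|x _|D _ KD].
      by have : setT x by []; rewrite -BT => -[k _ Bx]; exists k.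
    exists (\max_(i <- finmap.enum_fset D) i)%N => x /KD [i /= iD]; apply/subsetPset/ndB.
    exact: leq_bigmax_seq.
  by apply: le_lt_trans (muB k); apply: le_measure; rewrite ?inE//; exact: mopen.
- move=> A mA; apply/eqP; rewrite eq_le; apply/andP; split.
    apply: le_ereal_inf_tmp => _ [U [oU AU] <-].
    by apply: le_measure; rewrite ?inE//; exact: mopen.
  apply/lee_addgt0Pr => e e0.
  have mBk k : measurable (B k : set (borel T)) by exact: mopen.
  have e2 k : 0 < e / (2 ^ k.+1)%:R by rewrite divr_gt0// ltr0n expn_gt0.
  have /choice[U hU] : forall k, exists U : set T, [/\ open U, A `<=` U &
      (mu ((U `\` A) `&` B k) <= (e / (2 ^ k.+1)%:R)%:E)%E].
    move=> k; have [|U [C [oU cC CA AU UC]]] := @finite_squeezed (mrestr mu (mBk k)) A _ mA _ (e2 k).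
      by rewrite -[X in (X < _)%E]/(mu (setT `&` B k)) setTI.
    exists U; split => //; apply: (le_trans _ (ltW UC)).
    rewrite -[leRHS]/(mu ((U `\` C) `&` B k)).
    apply: le_measure; rewrite ?inE.
    + by apply: measurableI => //; apply: measurableD => //; exact: mopen.
    + by apply: measurableI => //; apply: measurableD; [exact: mopen|exact: mclosed].
    by apply: setSI; apply: setDS.
  pose V := \bigcup_k (U k `&` B k).
  have oV : open V by apply: bigcup_open => k _; apply: openI => //; case: (hU k).
  have AV : A `<=` V.
    move=> x Ax; have : setT x by []; rewrite -BT => -[k _ Bx]; exists k => //; split => //.
    by have [_ AU _] := hU k; exact: AU.
  apply: (@le_trans _ _ (mu V)); first by apply: ereal_inf_lbound; exists V.
  have mV : measurable (V : set (borel T)) by exact: mopen.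
  have mk k : measurable ((U k `\` A) `&` B k : set (borel T)).
    by apply: measurableI => //; apply: measurableD => //; apply: mopen; case: (hU k).
  have -> : V = A `|` (V `\` A) by rewrite setDUK.
  rewrite measureU//; last 2 first.
  - exact: measurableD.
  - by rewrite setDIK.
  apply: leeD2l; apply: (le_trans _ (epsilon_trick0 xpredT (ltW e0))).
  apply: (@le_trans _ _ (\sum_(k <oo) mu ((U k `\` A) `&` B k))%E).
    apply: measure_sigma_subadditive => //; first exact: measurableD.
    by move=> x [[k _ [Ux Bx]] nAx]; exists k.
  by apply: lee_nneseries => // k _; case: (hU k).
- move=> U oU; have [F [cF ndF FU]] := sigma_cpt U oU.
  have mF k : measurable (F k : set (borel T)) by apply: mclosed; exact: cpt_closed.
  apply/eqP; rewrite eq_le; apply/andP; split.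
    have : (mu (F k) @[k --> \oo] --> mu U)%E.
      by rewrite -FU; apply: nondecreasing_cvg_mu => //; rewrite FU; exact: mopen.
    move=> cv; rewrite -(cvg_lim _ cv)//; apply: lime_le; first by apply/cvg_ex; exists (mu U).
    apply: nearW => k; apply: ereal_sup_ubound; exists (F k) => //; split => //.
    by rewrite -FU; exact: bigcup_sup.
  apply: ge_ereal_sup => _ [K [Kc KU] <-]; apply: le_measure; rewrite ?inE//; last exact: mopen.
  by apply: mclosed; exact: cpt_closed.
Qed.

End regularity.

(** * The invariant Radon measure on G/H *)

Section homogeneous_measure.
Context {R : realType} {m : nat}.
Notation n := m.+1.
Notation Hn := (hyperbolic R n).
Notation G := (lorentz R n).
Notation H := (@SOn R n).
Notation X := (homog H).
Implicit Types (x y : Hn) (g h : G) (q : X).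

Lemma hyperbolic_hausdorff : hausdorff_space Hn.
Proof.
move=> x y xy; apply: hyperbolic_inj; apply/colP => i.
apply: (@Rhausdorff R) => A B.
have cx := @hyperbolic_coord_continuous R n i x; have cy := @hyperbolic_coord_continuous R n i y.
move=> /cx Ax /cy By; have [z [/= Az Bz]] := xy _ _ Ax By.
by exists (hyperbolic_val z i 0).
Qed.

Lemma homog_compact_closed (K : set X) : compact K -> closed K.
Proof.
move=> cK; have cHK : compact (@hyp_of_coset R n @` K).
  apply: continuous_compact => //; apply: continuous_subspaceT.
  exact: hyp_of_coset_continuous.
have -> : K = @hyp_of_coset R n @^-1` (@hyp_of_coset R n @` K).
  apply/seteqP; split=> [q Kq|q [p Kp /(bij_inj hyp_of_coset_bij) <-//]]; by exists q.
apply: closed_comp; first by move=> q _; exact: hyp_of_coset_continuous.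
exact: compact_closed hyperbolic_hausdorff cHK.
Qed.

(** The compact pieces are closed and bounded in hyperbolic space: cores of the open set at
    shrinking radii, cut off at height [k]. They are carried back by [coset_of_hyp]. *)
Lemma homog_sigma_compact (U : set X) : open U -> exists F : nat -> set X,
  [/\ forall k, compact (F k), nondecreasing_seq F & \bigcup_k F k = U].
Proof.
move=> oU; pose V : set Hn := @hyp_of_coset R n @` U.
have oV : open V by exact: hyp_of_coset_open.
pose F k : set Hn := hcore V (radius k) `&` [set x | height origin x <= k%:R].
have cF k : compact (F k).
  have [K cK sK] := @hball_compact R m k.+1%:R.
  apply: (subclosed_compact _ cK).
    apply: closedI; first exact: closed_hcore.
    rewrite -[X in closed X]/(height origin @^-1` [set t | t <= k%:R]).
    apply: closed_comp; last exact: (@closed_le R k%:R).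
    by move=> x _; exact: continuous_height.
  by move=> x [_ /= xk]; apply: sK; rewrite /hball/= (le_lt_trans xk)// ltr_nat.
have ndF : nondecreasing_seq F.
  move=> j k jk; apply/subsetPset; apply: setISS.
    by apply/subsetPset; exact: hcore_nondecreasing.
  by move=> x /= /le_trans; apply; rewrite ler_nat.
have FV : \bigcup_k F k = V.
  rewrite -[RHS](hcore_bigcup oV); apply/seteqP; split=> x.
    by move=> [k _ [Fx _]]; exists k.
  move=> [k _ Fx]; pose N := Num.bound (height origin x).
  exists (maxn k N) => //; split.
    by move: (x) Fx; apply/subsetPset; exact/hcore_nondecreasing/leq_maxl.
  rewrite /=; apply: (@le_trans _ _ N%:R); last by rewrite ler_nat leq_maxr.
  by apply: ltW; apply: archi_boundP; exact: le_trans ler01 (height_origin_ge1 x).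
exists (fun k => @coset_of_hyp R m @` F k); split.
- move=> k; apply: continuous_compact => //; apply: continuous_subspaceT.
  exact: coset_of_hyp_continuous.
- by move=> j k jk; apply/subsetPset; apply: image_subset; apply/subsetPset; exact: ndF.
- rewrite -image_bigcup FV; apply/seteqP; split.
    by move=> _ [_ [q Uq <-] <-]; rewrite hyp_of_cosetK.
  by move=> q Uq; exists (hyp_of_coset q); [exists q|rewrite hyp_of_cosetK].
Qed.

Lemma measurable_hyp_of_coset (A : set (borel Hn)) : measurable A ->
  measurable (@hyp_of_coset R n @^-1` A : set (borel X)).
Proof.
move=> mA; rewrite -[X in measurable X]setTI.
exact: (continuous_borel_map hyp_of_coset_continuous measurableT mA).
Qed.

Lemma homog_measure_exists (nu : {measure set (borel Hn) -> \bar R}) : horo_measure nu ->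
  exists mu : {measure set (borel X) -> \bar R},
    [/\ radon mu, mu setT != 0%E, G_invariant mu &
      forall A : set (borel Hn), measurable A -> nu A = mu (@hyp_of_coset R n @^-1` A)].
Proof.
move=> nuE; have [mu [muE _]] := pushforward_measure nu
  (continuous_borel_map (@coset_of_hyp_continuous R m)).
have muA A : mu (@hyp_of_coset R n @^-1` A) = nu A.
  by rewrite muE; congr (nu _); apply/seteqP; split=> x; rewrite /= coset_of_hypK.
exists mu; split.
- apply: (@radon_of_exhaustion _ _ _ mu (fun k => @hyp_of_coset R n @^-1` hball origin k.+1%:R)).
  + move=> U /homog_sigma_compact[F [cF ndF FU]]; exists F; split => // k.
    exact: homog_compact_closed.
  + move=> k; apply: open_comp => [q _|]; last exact: open_hball.
    exact: hyp_of_coset_continuous.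
  + move=> j k jk; apply/subsetPset; apply: preimage_subset; apply: hball_nondecreasing.
    by rewrite ler_nat.
  + by rewrite -preimage_bigcup hball_cover preimage_setT.
  + by move=> k; rewrite muA; exact: horo_measure_lty.
  + exact: homog_compact_closed.
  + exact: homog_sigma_compact.
- by rewrite muE preimage_setT (horo_measure_setT nuE).
- move=> g A mA; rewrite !muE.
  have E : homog_act g \o @coset_of_hyp R m = @coset_of_hyp R m \o hyperbolic_act g.
    apply/funext => x; apply: (bij_inj (@hyp_of_coset_bij R m)).
    by rewrite /= hyp_of_coset_act !coset_of_hypK.
  rewrite -comp_preimage E comp_preimage; apply: (horo_invariant g nuE).
  rewrite -[X in measurable X]setTI.
  exact: (continuous_borel_map (@coset_of_hyp_continuous R m) measurableT mA).
- by move=> A mA; rewrite muA.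
Qed.

Section chi.
Variable mu : {measure set (borel X) -> \bar R}.

Lemma transport_measure : exists mu' : {measure set (borel Hn) -> \bar R},
  (forall A, mu' A = mu (@hyp_of_coset R n @^-1` A)) /\
  forall f : Hn -> \bar R, measurable_fun setT (f : borel Hn -> \bar R) ->
   (forall x, 0 <= f x)%E -> (\int[mu']_x f x = \int[mu]_q f (hyp_of_coset q))%E.
Proof.
have [mu' [mu'E intE]] := pushforward_measure mu (continuous_borel_map (@hyp_of_coset_continuous R m)).
by exists mu'; split => // f mf f0; exact: intE.
Qed.

Lemma radon_hball_lty c : radon mu -> (mu (@hyp_of_coset R n @^-1` hball origin c) < +oo)%E.
Proof.
move=> [fK _ _]; have [K cK cs] := @hball_compact R m c.
have cK' : compact (@coset_of_hyp R m @` K).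
  by apply: continuous_compact => //; apply: continuous_subspaceT; exact: coset_of_hyp_continuous.
apply: le_lt_trans (fK _ cK'); apply: le_measure; rewrite ?inE.
- by apply: measurable_hyp_of_coset; exact: measurable_hball.
- rewrite -[X in measurable X]setCK; apply: measurableC; apply: sub_sigma_algebra.
  by apply: closed_openC; exact: homog_compact_closed.
- by move=> q /cs Kq; exists (hyp_of_coset q) => //; rewrite hyp_of_cosetK.
Qed.

End chi.
End homogeneous_measure.

(** * Characters of the Lorentz group *)

Section characters.
Context {R : realType} {k : nat}.
Notation m := k.+1.
Notation n := m.+1.
Notation G := (lorentz R n).
Implicit Types (b x : 'cV[R]_n.+1) (t : R).

Let e2 : 'cV[R]_n.+1 := e_ R (lift ord0 (lift ord0 ord0)).
Notation e0 := (@e0 R m).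
Notation e1 := (@e1 R m).
Notation nul := (@nul R m).
Notation abst := (@abst R m).
Notation nrot := (@nrot R m).

Let lform_e2 x : lform e2 x = x (lift ord0 (lift ord0 ord0)) 0.
Proof. by rewrite lform_e mul1r. Qed.

Let e2e2 : lform e2 e2 = 1. Proof. by rewrite lform_e2 mxE !eqxx. Qed.
Let e1e2 : lform e1 e2 = 0. Proof. by rewrite lform_e1 mxE. Qed.
Let e0e2 : lform e0 e2 = 0. Proof. by rewrite lform_e0 mxE oppr0. Qed.

(** The half turn in the plane of [e_1] and [e_2], which fixes [e_0] and sends [e_1] to [- e_1]. It
    exists from [n = 2] on, whence [m = k.+1] in this section. *)
Definition flip : 'M[R]_n.+1 := plane_mx e1 e2 false (cos pi) (sin pi).

Lemma flip_SO01 : SO01 flip.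
Proof. exact: rotation_SO01 e1e1 e2e2 e1e2. Qed.

Lemma flipE x : flip *m x = x + (- 2 * lform e1 x) *: e1 + (- 2 * lform e2 x) *: e2.
Proof.
rewrite plane_mxE cospi sinpi; apply/colP => i; rewrite !mxE expr0; ring.
Qed.

Lemma flip_abst t : flip *m abst t = abst (- t) *m flip.
Proof.
apply: mx_act_inj => x; rewrite -!mulmxA.
have f0 : flip *m e0 = e0 by rewrite flipE !(lformC _ e0) e0e1 e0e2 !mulr0 !scale0r !addr0.
have f1 : flip *m e1 = - e1.
  rewrite flipE e1e1 (lformC e2) e1e2 !mulr0 scale0r addr0 mulr1.
  by apply/colP => i; rewrite !mxE; ring.
have l0 : lform e0 (flip *m x) = lform e0 x.
  by rewrite flipE !lformDr !lformZr e0e1 e0e2 !mulr0 !addr0.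
have l1 : lform e1 (flip *m x) = - lform e1 x.
  by rewrite flipE !lformDr !lformZr e1e1 e1e2; ring.
rewrite [abst t *m x]plane_mxE [RHS]plane_mxE !mulmxDr -!scalemxAr f0 f1 l0 l1.
by rewrite coshN sinhN; apply/colP => i; rewrite !mxE expr1; ring.
Qed.

Lemma abst_nul t : abst t *m nul = expR (- t) *: nul.
Proof.
rewrite plane_mxE -(cosh_sinh_expR (- t)) coshN sinhN.
have -> : lform e0 nul = -1 by rewrite lform_e0 !mxE /=; ring.
have -> : lform e1 nul = -1 by rewrite lform_e1 !mxE /=; ring.
by rewrite /nul; apply/colP => i; rewrite !mxE expr1; ring.
Qed.

Lemma lform_hpart_e0 b : lform e0 (hpart b) = 0.
Proof. by rewrite lform_e0 mxE oppr0. Qed.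
Lemma lform_hpart_e1 b : lform e1 (hpart b) = 0.
Proof. by rewrite lform_e1 mxE. Qed.

Lemma abst_hpart t b : abst t *m hpart b = hpart b.
Proof. by rewrite plane_mxE lform_hpart_e0 lform_hpart_e1 !mulr0 !addr0 subr0 !scale0r !addr0. Qed.

Lemma lform_hpart_abst t b x : lform (hpart b) (abst t *m x) = lform (hpart b) x.
Proof. by rewrite -{1}(abst_hpart t) (SO01_SO1 (abst_SO01 t)).2. Qed.

Lemma hpartZ t b : hpart (t *: b) = t *: hpart b.
Proof. by apply/colP => i; rewrite !mxE; case: ifP => _; rewrite ?mulr0. Qed.

Lemma abst_nrot t b : abst t *m nrot b = nrot (expR (- t) *: b) *m abst t.
Proof.
apply: mx_act_inj => x; rewrite -!mulmxA.
have lx : lform nul (abst t *m x) = expR t * lform nul x.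
  by rewrite !lform_nul ucoord_abst mulrN.
rewrite [nrot b *m x]null_mxE [RHS]null_mxE lx hpartZ !lformZl !lformZr lform_hpart_abst.
rewrite !mulmxDr mulmxN -!scalemxAr abst_nul abst_hpart.
have := expRxMexpNx_1 t; set u := expR t; set v := expR (- t) => uv.
move: (lform nul x) (lform (hpart b) x) (lform (hpart b) (hpart b)) => L D E.
move: (abst t *m x) (hpart b) nul => A B C; apply/colP => i; rewrite !mxE.
have -> : 1 * (u * L) * (v * B i 0) = (u * v) * (L * B i 0) by ring.
have -> : (1 * (v * D) - 1 ^+ 2 / 2 * (v * (v * E)) * (u * L)) * C i 0 =
  (v * D - 2^-1 * (v * (u * v) * E) * L) * C i 0 by ring.
by rewrite uv; ring.
Qed.

Lemma nrot_half b : nrot b = nrot (2^-1 *: b) *m nrot (2^-1 *: b).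
Proof.
rewrite /nrot (null_mxM (@nulnul R m) (nul_hpart _)); apply: mx_act_inj => x; rewrite !null_mxE !hpartZ !lformZl !lformZr.
by apply/colP => i; rewrite !mxE; field.
Qed.

Lemma abst_opp t : abst t *m abst (- t) = 1%:M.
Proof.
rewrite /abst (plane_mxM (eps := true) (@e0e0 R m) (@e1e1 R m) (@e0e1 R m)) coshN sinhN expr1.
rewrite [X in plane_mx _ _ _ X _](_ : _ = 1); last by have := cosh2_sinh2 t; rewrite !expr2 => h; lra.
by rewrite [X in plane_mx _ _ _ _ X](_ : _ = 0) ?plane_mx10//; ring.
Qed.

(** Formulated for positive multiplicative characters so as to cover both the multiplier of a
    relatively invariant measure and [expR] of an element of [W0]. *)
Lemma lorentz_character_trivial (chi : G -> R) : (forall g, 0 < chi g) ->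
  (forall g h, chi (g * h)%g = chi g * chi h) -> (forall h, SOn h -> chi h = 1) ->
  forall g, chi g = 1.
Proof.
move=> chi0 chiM chiH.
have inj (x y : R) : 0 < x -> x * y = x -> y = 1.
  by move=> x0 h; apply: (mulfI (lt0r_neq0 x0)); rewrite mulr1.
have chi1 : chi 1%g = 1 by apply: (inj (chi 1%g)) => //; rewrite -chiM mulg1.
have chiA t : chi (lorentz_of (abst_SO01 t)) = 1.
  set a := lorentz_of _; pose a' : G := lorentz_of (@abst_SO01 R m (- t)).
  pose f : G := lorentz_of flip_SO01.
  have fH : chi f = 1.
    apply: chiH; apply/SOnP.
    by rewrite -[LHS]/(flip *m e0) flipE !(lformC _ e0) e0e1 e0e2 !mulr0 !scale0r !addr0.
  (* Thus a boost and its inverse have the same value under [chi]; it squares to 1 and is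
     positive. *)
  have : chi (f * a)%g = chi (a' * f)%g by congr chi; apply: lorentz_inj; exact: flip_abst.
  rewrite !chiM fH mul1r mulr1 => E.
  have : chi (a * a')%g = 1 by rewrite -chi1; congr chi; apply: lorentz_inj; exact: abst_opp.
  rewrite chiM -E -expr2 => /eqP; rewrite sqrf_eq1 => /orP[/eqP//|/eqP h].
  by have := chi0 a; rewrite h; lra.
have chiN b : chi (lorentz_of (nrot_SO01 b)) = 1.
  set c := lorentz_of _; pose c' : G := lorentz_of (nrot_SO01 (2^-1 *: b)).
  (* Conjugation by the boost of parameter [ln 2] halves a null rotation. So [chi c = chi c'], while
     [c] is the square of [c']. *)
  have : chi (lorentz_of (abst_SO01 (ln 2)) * c)%g = chi (c' * lorentz_of (abst_SO01 (ln 2)))%g.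
    congr chi; apply: lorentz_inj; rewrite -[LHS]/(abst (ln 2) *m nrot b) abst_nrot.
    by rewrite expRN lnK// posrE.
  rewrite !chiM chiA mul1r mulr1 => E; rewrite E; apply: (inj (chi c')) => //.
  rewrite -chiM -E; congr chi; apply: lorentz_inj.
  by rewrite -[RHS]/(nrot b) nrot_half.
(* The element [s] of NA agrees with [g] on [e_0], so [s^-1 g] lies in SO(n). *)
move=> g; pose x := hyperbolic_act g origin; pose s := hyp_section x.
have -> : g = (s * (s^-1 * g))%g by rewrite mulgA mulgV mul1g.
rewrite chiM [chi (_^-1 * _)%g]chiH ?mulr1; last first.
  by apply/SOn_origin; rewrite hyperbolic_actM -/x -(hyp_sectionE x) hyperbolic_actK.
set v := hyperbolic_val x.
have -> : s = (lorentz_of (nrot_SO01 ((ucoord v)^-1 *: v)) *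
    lorentz_of (abst_SO01 (ln (ucoord v))))%g by exact: lorentz_inj.
by rewrite chiM chiN chiA mulr1.
Qed.

End characters.

Lemma character_trivial (R : realType) m (chi : lorentz R m.+1 -> R) : (0 < m)%N ->
  (forall g, 0 < chi g) -> (forall g h, chi (g * h)%g = chi g * chi h) ->
  (forall h, SOn h -> chi h = 1) -> forall g, chi g = 1.
Proof. by case: m chi => // k chi _; exact: lorentz_character_trivial. Qed.

Lemma W0_trivial (R : realType) m (tau : lorentz R m.+1 -> R) : (0 < m)%N ->
  W0 (@SOn R m.+1) tau -> tau = fun=> 0.
Proof.
move=> m0 [_ tauD tauH]; apply/funext => g; apply: (@expR_inj R); rewrite expR0.
apply: (@character_trivial R m (fun g => expR (tau g))) => // [h|h h'|h Hh].
- exact: expR_gt0.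
- by rewrite tauD expRD.
- by rewrite tauH// expR0.
Qed.

(** * Relatively invariant Radon measures on G/H *)

Section relative_invariance.
Context {R : realType} {m : nat}.
Notation n := m.+1.
Notation Hn := (hyperbolic R n).
Notation X := (homog (@SOn R n)).
Variable mu : {measure set (borel X) -> \bar R}.
Hypotheses (rmu : radon mu) (mu0 : mu setT != 0%E).

Lemma homog_act_preimage g (A : set Hn) :
  homog_act g @^-1` (@hyp_of_coset R n @^-1` A) =
  @hyp_of_coset R n @^-1` (hyperbolic_act g @^-1` A).
Proof. by apply/seteqP; split=> q; rewrite /= hyp_of_coset_act. Qed.

Lemma homog_ball_charged : exists2 c, 0 < c &
  exists N, mu (@hyp_of_coset R n @^-1` hball origin N) = c%:E.
Proof.
have B k := measurable_hyp_of_coset (@measurable_hball R m origin k.+1%:R).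
have [|/existsNP[k mk]] := pselect (forall k, mu (@hyp_of_coset R n @^-1` hball origin k.+1%:R) = 0%E).
  move=> h; exfalso; move/negP: mu0; apply; apply/eqP.
  have : (mu (@hyp_of_coset R n @^-1` hball origin k.+1%:R) @[k --> \oo] --> mu setT)%E.
    rewrite (_ : setT = \bigcup_k (@hyp_of_coset R n @^-1` hball origin k.+1%:R)).
      apply: nondecreasing_cvg_mu => //; first exact: bigcupT_measurable.
      move=> j i ji; apply/subsetPset; apply: preimage_subset; apply: hball_nondecreasing.
      by rewrite ler_nat.
    by rewrite -preimage_bigcup hball_cover preimage_setT.
  by move/cvg_lim => <- //; under eq_fun do rewrite h; rewrite lim_cst.
have fin : mu (@hyp_of_coset R n @^-1` hball origin k.+1%:R) \is a fin_num.
  by rewrite ge0_fin_numE// radon_hball_lty.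
exists (fine (mu (@hyp_of_coset R n @^-1` hball origin k.+1%:R))).
  rewrite lt0r fine_ge0// andbT; apply/negP => /eqP h; apply: mk.
  by rewrite -(fineK fin) h.
by exists k.+1%:R; rewrite fineK.
Qed.

(** Evaluated at a ball about the base point, of finite positive mass, the multiplier is seen to be
    multiplicative, and trivial on [SOn] because rotations preserve the ball. *)
Lemma relative_character_trivial (chi : lorentz R n -> R) : (0 < m)%N ->
  (forall g, 0 < chi g) ->
  (forall g (A : set (borel X)), measurable A ->
    mu (homog_act g @^-1` A) = (((chi g)^-1)%:E * mu A)%E) ->
  forall g, chi g = 1.
Proof.
move=> m0 chi0 chiE; have [c c0 [N muN]] := homog_ball_charged.
set B := @hyp_of_coset R n @^-1` hball origin N in muN.
have mB : measurable (B : set (borel X)) by apply: measurable_hyp_of_coset; exact: measurable_hball.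
have chiM g h : chi (g * h)%g = chi g * chi h.
  have := chiE (g * h)%g B mB.
  have -> : homog_act (g * h)%g @^-1` B = homog_act h @^-1` (homog_act g @^-1` B).
    rewrite !homog_act_preimage; apply/seteqP.
    by split=> q; rewrite /= hyperbolic_actM.
  rewrite (chiE h); last first.
    rewrite homog_act_preimage; apply: measurable_hyp_of_coset.
    by apply: measurable_hyperbolic_act; exact: measurable_hball.
  rewrite (chiE g)// muN -!EFinM => -[] /(congr1 ( *%R^~ c^-1)).
  rewrite !mulrA !mulfK ?lt0r_neq0// -invfM => /invr_inj <-.
  exact: mulrC.
have chiH h : SOn h -> chi h = 1.
  move=> /SOn_origin ho; have := chiE h B mB.
  have -> : homog_act h @^-1` B = B.
    by rewrite homog_act_preimage -{1}ho hball_act.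
  rewrite muN -EFinM => -[] /(congr1 ( *%R^~ c^-1)).
  by rewrite mulfK ?divff ?lt0r_neq0// => /(congr1 GRing.inv); rewrite invr1 invrK.
exact: character_trivial.
Qed.

Lemma relatively_invariant_invariant : (0 < m)%N -> relatively_invariant mu -> G_invariant mu.
Proof.
move=> m0 [chi [chi0 chiE]] g A mA.
by rewrite chiE// (relative_character_trivial m0 chi0 chiE) invr1 mul1e.
Qed.

Lemma invariant_radon_unique (nu : {measure set (borel Hn) -> \bar R}) :
  horo_measure nu -> G_invariant mu -> exists2 c : R, 0 < c &
  forall (A : set (borel Hn)) (f : Hn -> \bar R), measurable A ->
    measurable_fun setT (f : borel Hn -> \bar R) -> (forall x, 0 <= f x)%E ->
    (\int[mu]_(q in @hyp_of_coset R n @^-1` A) f (hyp_of_coset q) =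
     c%:E * \int[nu]_(x in A) f x)%E.
Proof.
move=> nuE imu; have [mu' [mu'E mu'I]] := transport_measure mu.
have [|c||c c0 cE] := invariant_measure_unique (mu := mu') nuE.
- move=> g A mA; rewrite !mu'E -homog_act_preimage; apply: imu.
  exact: measurable_hyp_of_coset.
- by rewrite mu'E; exact: radon_hball_lty.
- by rewrite mu'E preimage_setT.
exists c => // A f mA mf f0.
have mfA : measurable_fun setT (fun x : borel Hn => (f x * (\1_A x)%:E)%E).
  by apply: emeasurable_funM => //; apply/measurable_EFinP; exact: measurable_indic.
have fA0 x : (0 <= f x * (\1_A x)%:E)%E by rewrite mule_ge0// lee_fin.
have -> : (\int[mu]_(q in @hyp_of_coset R n @^-1` A) f (hyp_of_coset q) =
    \int[mu]_q (f (hyp_of_coset q) * (\1_A (hyp_of_coset q))%:E))%E.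
  rewrite integral_mkcond; apply: eq_integral => q _; rewrite patchE indicE.
  have -> : (q \in @hyp_of_coset R n @^-1` A) = (hyp_of_coset q \in A).
    by apply/idP/idP => /set_mem h; apply/mem_set.
  by case: ifP => _; rewrite ?mule1 ?mule0.
have -> : (\int[nu]_(x in A) f x = \int[nu]_x (f x * (\1_A x)%:E))%E.
  rewrite integral_mkcond; apply: eq_integral => q _; rewrite patchE indicE.
  by case: ifP => _; rewrite ?mule1 ?mule0.
rewrite -(mu'I (fun x => f x * (\1_A x)%:E)%E)//.
rewrite -(@ge0_integral_mscale _ _ _ nu _ measurableT (NngNum (ltW c0)))//.
by apply: eq_measure_integral => B mB _; rewrite cE.
Qed.

End relative_invariance.

(** * Exponential integrals *)

Section exponential_integral.
Context {R : realType} {m : nat}.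
Notation n := m.+1.
Notation Hn := (hyperbolic R n).
Notation e0 := (@e0 R m).
Notation e1 := (@e1 R m).
Variable nu : {measure set (borel Hn) -> \bar R}.
Hypothesis nuE : horo_measure nu.
Implicit Types (x : Hn) (eta u v w : 'cV[R]_n.+1).

Lemma lformBl u v w : lform (v - w) u = lform v u - lform w u.
Proof. by rewrite -scaleN1r lformDl lformZl mulN1r. Qed.

(** The sign of [w] is chosen so that in the borderline case [eta ord0 0 = r] the vector is
    [r *: (e0 - w)], a multiple of the null vector in [null_slab_pinfty]. If [eta] is a multiple of
    [e0], the direction is arbitrary and [e1] is taken. *)
Lemma spatial_decomposition eta : exists r w,
  [/\ 0 <= r, lform w w = 1, lform e0 w = 0 & eta = eta ord0 0 *: e0 - r *: w].
Proof.
pose s : 'cV[R]_n.+1 := eta - eta ord0 0 *: e0.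
have s0 : lform e0 s = 0 by rewrite lform_e0 !mxE eqxx mulr1 subrr oppr0.
have ss : lform s s = \sum_(i < n) (s (lift ord0 i) 0) ^+ 2.
  have s00 : s ord0 0 = 0 by move: s0; rewrite lform_e0 => /eqP; rewrite oppr_eq0 => /eqP.
  rewrite /lform s00 mulr0 oppr0 add0r; apply: eq_bigr => i _; exact: expr2.
have ss0 : 0 <= lform s s by rewrite ss sumr_ge0// => i _; exact: sqr_ge0.
have [r0|r0] := eqVneq (lform s s) 0.
  exists 0, e1; split => //; [exact: e1e1|exact: e0e1|].
  have s00 : s = 0.
    apply/colP => i; rewrite [RHS]mxE; case: (unliftP ord0 i) => [j ->|->]; last first.
      by move: s0; rewrite lform_e0 => /eqP; rewrite oppr_eq0 => /eqP.
    apply/eqP; rewrite -sqrf_eq0; move: r0; rewrite ss => /eqP.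
    rewrite psumr_eq0; last by move=> k _; exact: sqr_ge0.
    by move=> /allP/(_ j); rewrite mem_index_enum => /(_ isT).
  by rewrite scale0r subr0; apply/eqP; rewrite -subr_eq0 -/s s00.
pose r := Num.sqrt (lform s s).
have rr : r ^+ 2 = lform s s by rewrite sqr_sqrtr.
have rn0 : r != 0 by rewrite -sqrf_eq0 rr.
exists r, (- r^-1 *: s); split; first exact: sqrtr_ge0.
- by rewrite lformZl lformZr mulrA mulrNN -invfM -expr2 rr mulVf.
- by rewrite lformZr s0 mulr0.
- by rewrite scalerA mulrN divff// scaleN1r opprK /s addrC subrK.
Qed.

Lemma measurable_lform eta :
  measurable_fun setT (fun v : borel Hn => lform eta (hyperbolic_val v)).
Proof.
apply: measurable_funD.
  by apply: measurable_funN; apply: measurable_funM => //; exact: measurable_hyperbolic_coord.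
by apply: measurable_sum => i; apply: measurable_funM => //; exact: measurable_hyperbolic_coord.
Qed.

Lemma measurable_expR_lform eta :
  measurable_fun setT (fun v : borel Hn => (expR (lform eta (hyperbolic_val v)))%:E).
Proof.
by apply/measurable_EFinP; apply: measurableT_comp => //; exact: measurable_lform.
Qed.

Lemma null_slab_pinfty w c : lform w w = 1 -> lform e0 w = 0 -> 0 < c ->
  nu [set v | - lform (e0 - w) (hyperbolic_val v) < c] = +oo%E.
Proof.
move=> ww e0w c0; pose S c : set (borel Hn) := [set v | - lform (e0 - w) (hyperbolic_val v) < c].
have mS d : measurable (S d).
  have := measurable_funN (measurable_lform (e0 - w)) measurableT (measurable_itv `]-oo, d[).
  by rewrite setTI; congr measurable; apply/seteqP; split=> v; rewrite /= in_itv.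
have ST d : 0 < d -> nu (S d) = nu (S 1).
  (* This boost, in the plane of [e0] and [w], multiplies the functional of [e0 - w] by [d], so it
     pulls [S d] back to [S 1]. *)
  move=> d0; pose g := lorentz_of (boost_SO01 (ln d) e0e0 ww e0w).
  rewrite -(horo_invariant g nuE (mS d)); congr (nu _); apply/seteqP.
  suff E (v : Hn) : lform (e0 - w) (hyperbolic_val (hyperbolic_act g v)) = d * lform (e0 - w) (hyperbolic_val v).
    by split=> v; rewrite /S/= E -mulrN gtr_pMr.
  rewrite hyperbolic_actE !lformBl.
  rewrite -[lorentz_val g]/(plane_mx e0 w true (cosh (ln d)) (sinh (ln d))).
  rewrite (lform_plane_p (eps := true) (@e0e0 R m) e0w) (lform_plane_q true ww e0w).
  have : cosh (ln d) + sinh (ln d) = d by rewrite cosh_sinh_expR lnK ?posrE.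
  by move=> dE; rewrite -[X in _ = X * _]dE expr1; ring.
have SU : \bigcup_k S k.+1%:R = setT.
  apply/seteqP; split=> // v _; exists (Num.trunc (- lform (e0 - w) (hyperbolic_val v))) => //.
  exact: truncnS_gt.
have cv : (nu (S k.+1%:R) @[k --> \oo] --> nu setT)%E.
  rewrite -SU; apply: nondecreasing_cvg_mu => //; first exact: bigcupT_measurable.
  by move=> j k jk; apply/subsetPset => v; rewrite /S/= => /lt_le_trans; apply; rewrite ler_nat.
rewrite -/(S c) (ST c c0) -(horo_measure_setT nuE) -(cvg_lim _ cv)//.
under eq_fun => k do rewrite ST//.
by rewrite lim_cst.
Qed.

Lemma integral_expR_lform_lty eta :
  (\int[nu]_v (expR (lform eta (hyperbolic_val v)))%:E < +oo)%E ->
  exists k x, 0 < k /\ eta = k *: hyperbolic_val x.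
Proof.
move=> fin; have [r [w [r0 ww e0w etaE]]] := spatial_decomposition eta.
set t := eta ord0 0 in etaE.
have lE v : lform eta v = - (t * v ord0 0) - r * lform w v.
  by rewrite etaE -scaleNr lformDl !lformZl lform_e0 mulrN mulNr.
have tr : r < t.
  rewrite ltNge; apply/negP => tr; move: fin; apply/negP; rewrite -leNgt.
  (* On this slab [x_0 + lform w v < 1]. If [t <= r], the exponent [- t x_0 - r lform w v] is there
     at least [- r (x_0 + lform w v)], hence at least [- r]. *)
  pose S : set (borel Hn) := [set v | - lform (e0 - w) (hyperbolic_val v) < 1].
  have nuS : nu S = +oo%E by exact: null_slab_pinfty.
  have mS : measurable S.
    have := measurable_funN (measurable_lform (e0 - w)) measurableT (measurable_itv `]-oo, 1[).
    by rewrite setTI; congr measurable; apply/seteqP; split=> v; rewrite /= in_itv.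
  have : (\int[nu]_v ((expR (- r) * \1_S v)%:E) = +oo)%E.
    under eq_integral do rewrite EFinM.
    rewrite ge0_integralZl_EFin ?expR_ge0//; last by apply/measurable_EFinP; exact: measurable_indic.
    by rewrite integral_indic// setIT nuS gt0_muley// lte_fin expR_gt0.
  move=> <-; apply: ge0_le_integral => //.
  - by apply/measurable_EFinP; apply: measurable_funM => //; exact: measurable_indic.
  - exact: measurable_expR_lform.
  move=> v _; rewrite lee_fin indicE; case: (boolP (v \in S)) => [/set_mem|_]; last first.
    by rewrite mulr0 expR_ge0.
  rewrite /S/= mulr1 ler_expR lE lformBl lform_e0.
  have [v0 _] := hyperbolicP v; set a := hyperbolic_val v ord0 0 in v0 *.
  set b := lform w _ => ab; have h1 : t * a <= r * a by rewrite ler_wpM2r// ltW.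
  have h2 : r * (a + b) <= r by rewrite ler_piMr; lra.
  lra.
have t0 : 0 < t by exact: le_lt_trans tr.
(* Now [eta] is timelike, and [k] is its Lorentzian length. *)
pose k := Num.sqrt (t ^+ 2 - r ^+ 2).
have k2 : k ^+ 2 = t ^+ 2 - r ^+ 2 by rewrite sqr_sqrtr// subr_ge0; nra.
have k0 : 0 < k by rewrite sqrtr_gt0 subr_gt0; nra.
have hx : hyp (k^-1 *: eta).
  split; first by rewrite mxE mulr_gt0// invr_gt0.
  have w0 : w ord0 0 = 0 by move: e0w; rewrite lform_e0 => /eqP; rewrite oppr_eq0 => /eqP.
  rewrite lformZl lformZr lE -/t (lformC w) lE w0 ww mulr0 oppr0 sub0r mulr1 mulrN opprK.
  have -> : - (t * t) + r * r = - k ^+ 2 by rewrite k2; ring.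
  by field; exact: lt0r_neq0.
exists k, (hyperbolic_of hx); split => //.
by rewrite -[hyperbolic_val _]/(k^-1 *: eta) scalerA divff ?gt_eqF// scale1r.
Qed.

Lemma integral_hyperbolic_act g (f : Hn -> \bar R) :
  measurable_fun setT (f : borel Hn -> \bar R) -> (forall x, 0 <= f x)%E ->
  (\int[nu]_x f (hyperbolic_act g x) = \int[nu]_x f x)%E.
Proof.
move=> mf f0; have [nug [nugE nugI]] := pushforward_measure nu
  (continuous_borel_map (@hyperbolic_act_continuous _ _ g)).
rewrite -nugI//; apply: eq_measure_integral => A mA _.
by rewrite nugE; exact: (horo_invariant g nuE).
Qed.

(** By invariance of [nu] the point [x] may be moved to the base point, where the exponent is
    [- k x_0]. *)
Lemma integral_expR_hyperbolic k x : 0 < k ->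
  (\int[nu]_v (expR (k * lform (hyperbolic_val x) (hyperbolic_val v)))%:E)%E =
  ((hyperboloid_const n k)^-1)%:E.
Proof.
move=> k0; rewrite -(integral_expR_height nuE k0).
pose f (v : Hn) := (expR (- (k * hyperbolic_val v ord0 0)))%:E : \bar R.
rewrite -[RHS](integral_hyperbolic_act (hyp_section x)^-1%g (f := f)).
- apply: eq_integral => v _; rewrite /f -mulrN -height_origin /height opprK.
  have := height_act (hyp_section x)^-1%g x v; rewrite /height.
  rewrite -{2}(hyp_sectionE x) hyperbolic_actK => /oppr_inj <-.
  by [].
- apply/measurable_EFinP; apply: measurableT_comp => //; apply: measurable_funN.
  by apply: measurable_funM => //; exact: measurable_hyperbolic_coord.
- by move=> v; rewrite lee_fin expR_ge0.
Qed.

End exponential_integral.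

(** * The two families *)

Section probability_image.
Context d d' (S : measurableType d) (T : measurableType d') (R : realType).
Variables (P : probability S R) (phi : S -> T) (mphi : measurable_fun setT phi).

Definition image_probability of measurable_fun setT phi : set T -> \bar R :=
  fun A => P (phi @^-1` A).
Local Notation Q := (image_probability mphi).

Let Q0 : Q set0 = 0%E. Proof. by rewrite /Q preimage_set0 measure0. Qed.
Let Qge0 A : (0 <= Q A)%E. Proof. exact: measure_ge0. Qed.
Let Qsa : semi_sigma_additive Q.
Proof. exact: (@measure_semi_sigma_additive _ _ _ (pushforward P phi)). Qed.
HB.instance Definition _ := isMeasure.Build _ _ _ Q Q0 Qge0 Qsa.
Let Q1 : Q setT = 1%E. Proof. by rewrite /Q preimage_setT probability_setT. Qed.
HB.instance Definition _ := Measure_isProbability.Build _ _ _ Q Q1.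

Lemma image_probability_exists : exists Q' : probability T R, forall A, Q' A = P (phi @^-1` A).
Proof. by exists Q. Qed.

End probability_image.

Section family.
Context {R : realType} {m : nat}.
Notation n := m.+1.
Notation Hn := (hyperbolic R n).
Notation G := (lorentz R n).
Notation X := (homog (@SOn R n)).

(** The form is nondegenerate. The minus sign of the method combines with that of the form, so it
    changes the sign of the coordinates of [eta] other than the one of index 0. *)
Lemma scalar_lform (phi : {scalar 'cV[R]_n.+1}) : exists eta, forall v, - phi v = lform eta v.
Proof.
exists (\col_i ((if i == ord0 then 1 else -1) * phi (e_ R i))) => v.
have -> : phi v = \sum_i v i 0 * phi (e_ R i).
  rewrite {1}[v]matrix_sum_delta linear_sum; apply: eq_bigr => i _.
  by rewrite big_ord1 linearZ.
rewrite big_ord_recl /lform !mxE eqxx mul1r opprD mulrC; congr (_ + _).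
by rewrite -sumrN; apply: eq_bigr => i _; rewrite !mxE /= mulN1r mulNr mulrC.
Qed.

Lemma lform_scalar (eta : 'cV[R]_n.+1) :
  exists phi : {scalar 'cV[R]_n.+1}, forall v, - phi v = lform eta v.
Proof.
pose f v := - lform eta v.
have lf : linear_for *%R f.
  by move=> a u v; rewrite /f lformDr lformZr opprD mulrN.
pose phi : {scalar 'cV[R]_n.+1} := HB.pack f (GRing.isLinear.Build _ _ _ _ f lf).
by exists phi => v; rewrite /phi/= /f opprK.
Qed.

Variable nu : {measure set (borel Hn) -> \bar R}.
Hypothesis nuE : horo_measure nu.

Lemma integral_hyperboloid_density kappa (xi : Hn) (A : set (borel Hn)) :
  0 < kappa -> measurable A ->
  (\int[nu]_(v in A) (hyperboloid_density kappa xi v)%:E =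
   (hyperboloid_const n kappa)%:E *
   \int[nu]_(v in A) (expR (lform (kappa *: hyperbolic_val xi) (hyperbolic_val v)))%:E)%E.
Proof.
move=> k0 mA; set eta := kappa *: hyperbolic_val xi.
transitivity (\int[nu]_(v in A)
    ((hyperboloid_const n kappa)%:E * (expR (lform eta (hyperbolic_val v)))%:E))%E.
  by apply: eq_integral => v _; rewrite -EFinM /hyperboloid_density lformZl.
apply: ge0_integralZl_EFin => //.
- exact: (measurable_funTS (measurable_expR_lform eta)).
- exact/ltW/hyperboloid_const_gt0.
Qed.

Lemma integral_expR_lformE kappa (xi : Hn) : 0 < kappa ->
  (\int[nu]_v (expR (lform (kappa *: hyperbolic_val xi) (hyperbolic_val v)))%:E =
   ((hyperboloid_const n kappa)^-1)%:E)%E.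
Proof.
move=> k0; rewrite -(integral_expR_hyperbolic nuE xi k0).
by apply: eq_integral => v _; rewrite lformZl.
Qed.

Lemma hyperboloid_density_total kappa (xi : Hn) : 0 < kappa ->
  (\int[nu]_v (hyperboloid_density kappa xi v)%:E = 1)%E.
Proof.
move=> k0; rewrite integral_hyperboloid_density// integral_expR_lformE// -EFinM.
by rewrite divff// gt_eqF// hyperboloid_const_gt0.
Qed.

(** By uniqueness [mu] corresponds to a multiple [c] of [nu], and [c] cancels on normalization. One
    inclusion rests on [integral_expR_lform_lty], which turns an admissible [eta] into
    [kappa *: xi]; for the other, the given probability is carried to the cosets by
    [coset_of_hyp]. *)
Lemma exp_family0E (mu : {measure set (borel X) -> \bar R}) :
  radon mu -> mu setT != 0%E -> G_invariant mu ->
  transport (exp_family_on (natural_rep R n) (e_ R ord0) mu [set (fun _ : G => 0)]) =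
  hyperboloid_family nu.
Proof.
move=> rmu mu0 imu; have [c c0 cE] := invariant_radon_unique rmu mu0 nuE imu.
pose I (eta : 'cV[R]_n.+1) (A : set (borel Hn)) :=
  (\int[nu]_(v in A) (expR (lform eta (hyperbolic_val v)))%:E)%E.
have tE (phi : {scalar 'cV[R]_n.+1}) eta (A : set (borel Hn)) : (forall v, - phi v = lform eta v) -> measurable A ->
    tilde_p (natural_rep R n) (e_ R ord0) mu phi (fun=> 0) (@hyp_of_coset R n @^-1` A) =
    (c%:E * I eta A)%E.
  move=> pE mA; pose f (v : Hn) := (expR (lform eta (hyperbolic_val v)))%:E : \bar R.
  have f0 v : (0 <= f v)%E by rewrite lee_fin expR_ge0.
  rewrite -[RHS](cE A f mA (measurable_expR_lform eta) f0).
  apply: eq_integral => q _; rewrite /tilde_density addr0 pE.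
  by rewrite -[natural_rep R n (repr q) *m _]/(hyperbolic_val (hyp_of_coset q)).
have key (phi : {scalar 'cV[R]_n.+1}) (eta : 'cV[R]_n.+1) (kappa : R) (xi : Hn) (A : set (borel Hn)) :
    (forall v, - phi v = lform eta v) -> 0 < kappa ->
    eta = kappa *: hyperbolic_val xi -> measurable A ->
    (((fine (tilde_p (natural_rep R n) (e_ R ord0) mu phi (fun=> 0%R) setT))^-1)%:E *
      tilde_p (natural_rep R n) (e_ R ord0) mu phi (fun=> 0%R) (@hyp_of_coset R n @^-1` A)%classic)%E =
    (\int[nu]_(v in A) (hyperboloid_density kappa xi v)%:E)%E.
  move=> pE k0 etaE mA; have K0 := @hyperboloid_const_gt0 R m kappa k0.
  rewrite (tE phi eta)// -(preimage_setT (@hyp_of_coset R n)) (tE phi eta)//.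
  rewrite integral_hyperboloid_density// -etaE -/(I eta A).
  have -> : I eta setT = ((hyperboloid_const n kappa)^-1)%:E.
    by rewrite /I etaE integral_expR_lformE.
  rewrite -EFinM/= muleA -EFinM; congr (_%:E * _)%E.
  by field; rewrite !gt_eqF.
apply/seteqP; split=> q /=.
  move=> [p [phi [_ [-> fin pA]]] qA].
  have [eta pE] := scalar_lform phi.
  have [|kappa [xi [k0 etaE]]] := integral_expR_lform_lty nuE (eta := eta).
    move: fin; rewrite -(preimage_setT (@hyp_of_coset R n)) (tE phi eta)//.
    suff fin_c z : (c%:E * z < +oo)%E -> (z < +oo)%E by exact: fin_c.
    by case: z => [r _|//|//]; rewrite ?ltry// gt0_muley ?lte_fin.
  exists kappa, xi; split => // A mA; rewrite qA// pA; last exact: measurable_hyp_of_coset.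
  exact: key.
move=> [kappa [xi [k0 qA]]].
have [phi pE] := lform_scalar (kappa *: hyperbolic_val xi).
have [p pqE] := image_probability_exists q (continuous_borel_map (@coset_of_hyp_continuous R m)).
have pK A : p (@hyp_of_coset R n @^-1` A) = q A.
  by rewrite pqE; congr (q _); apply/seteqP; split=> x; rewrite /= coset_of_hypK.
exists p; last by move=> A _; rewrite pK.
exists phi, (fun=> 0); split => //.
  rewrite -(preimage_setT (@hyp_of_coset R n)) (tE phi (kappa *: hyperbolic_val xi))//.
  by rewrite /I integral_expR_lformE// -EFinM ltry.
move=> B mB.
have BE : B = @hyp_of_coset R n @^-1` (@coset_of_hyp R m @^-1` B).
  by apply/seteqP; split=> x; rewrite /= hyp_of_cosetK.
have mB' : measurable (@coset_of_hyp R m @^-1` B : set (borel Hn)).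
  rewrite -[X in measurable X]setTI.
  exact: (continuous_borel_map (@coset_of_hyp_continuous R m) measurableT mB).
by rewrite BE pK qA// (key _ _ _ _ _ pE k0 erefl mB').
Qed.

End family.

Theorem proposition4p17 (R : realType) (n : nat) (n_gt0 : (0 < n)%N) :
  [/\ (* v0 = e_0 is H-fixed *)
      forall h : lorentz R n, SOn h -> natural_rep R n h *m e_ R ord0 = e_ R ord0,
      (* the identification G/H = H^n, gH |-> g e_0 *)
      [/\ bijective (@hyp_of_coset R n), continuous (@hyp_of_coset R n),
          (forall U, open U -> open (@hyp_of_coset R n @` U)) &
          forall g : lorentz R n,
            hyperbolic_val (hyp_of_coset (\pi_(homog (@SOn R n)) g)%qT) =
            lorentz_val g *m e_ R ord0] &
      exists nu : {measure set (borel (hyperbolic R n)) -> \bar R},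
      [/\ (* nu is G-invariant *)
          forall (g : lorentz R n) (A : set (borel (hyperbolic R n))),
            measurable A -> nu (hyperbolic_act g @^-1` A) = nu A,
          (* nu in hyperbolic-spherical coordinates *)
          forall A : set (borel (hyperbolic R n)), measurable A ->
            nu A = hypsph_measure A,
          (* c_kappa is the normalizing constant *)
          forall (kappa : R) (xi : hyperbolic R n), 0 < kappa ->
            (\int[nu]_v (hyperboloid_density kappa xi v)%:E)%E = 1%E,
          (* nu corresponds to a nonzero G-invariant Radon measure on G/H *)
          exists mu : {measure set (borel (homog (@SOn R n))) -> \bar R},
            [/\ radon mu, mu setT != 0%E, G_invariant mu &
                forall A : set (borel (hyperbolic R n)), measurable A ->
                  nu A = mu (@hyp_of_coset R n @^-1` A)] &
          (* the family obtained by the method is the hyperboloid family *)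
          (forall mu : {measure set (borel (homog (@SOn R n))) -> \bar R},
            (1 < n)%N -> radon mu -> mu setT != 0%E -> relatively_invariant mu ->
            transport (exp_family (natural_rep R n) (e_ R ord0) mu) =
            hyperboloid_family nu) /\
          (* n = 1, where W0 is not {0}: the subfamily tau = 0 *)
          (forall mu : {measure set (borel (homog (@SOn R n))) -> \bar R},
            n = 1%N -> radon mu -> mu setT != 0%E -> G_invariant mu ->
            transport (exp_family_on (natural_rep R n) (e_ R ord0) mu
              [set (fun _ : lorentz R n => 0)]) =
            hyperboloid_family nu)]].
Proof.
case: n n_gt0 => // m _; split.
- by move=> h /SOnP.
- split; [exact: hyp_of_coset_bij|exact: hyp_of_coset_continuous|exact: hyp_of_coset_open|].
  by move=> g; rewrite hyp_of_coset_pi.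
have [nu nuE] := @horo_measure_exists R m; exists nu; split.
- by move=> g A; exact: (horo_invariant g nuE).
- by move=> A; exact: horo_measure_hypsph.
- by move=> kappa xi; exact: hyperboloid_density_total.
- exact: homog_measure_exists.
split=> mu; last by move=> _; exact: exp_family0E.
(* For [n >= 2] the multiplier of [mu] and the space [W0] are trivial, so the whole family is the
   subfamily [tau = 0], which was identified for every [n]. *)
move=> m0 rmu mu0 rimu; rewrite -(exp_family0E nuE rmu mu0); last first.
  exact: relatively_invariant_invariant.
rewrite /exp_family; congr (transport (exp_family_on _ _ _ _)).
apply/seteqP; split=> [tau /(W0_trivial m0) ->//|_ ->].
split; [exact: cst_continuous|by move=> g h; rewrite addr0|by []].
Qed.
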